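(* Let $f:\mathcal{M}\to\mathcal{M}$ be an Anosov diffeomorphism of a compact manifold $\mathcal{M}$ and let $\mathcal{E}=\mathcal{M}\times\mathbb{R}^d$ with $d\ge 3$. For any $\epsilon>0$ there exists a Lipschitz continuous linear cocycle $F:\mathcal{E}\to\mathcal{E}$ over $f$, which is $\epsilon$-close to the identity, such that for all periodic points $p\in\mathcal{M}$ the return maps $F^n_p:\mathcal{E}_p\to\mathcal{E}_p$ (where $f^np=p$) are conjugate to orthogonal maps, but $F$ is not conformal with respect to any continuous Riemannian metric on $\mathcal{E}$.
   Context: A linear cocycle over $f$ on the trivial bundle $\mathcal{M}\times\mathbb{R}^d$ is a map $F(x,v)=(f(x),A(x)v)$ with $A:\mathcal{M}\to GL(d,\mathbb{R})$. It is Lipschitz continuous if $A$ is Lipschitz, and $\epsilon$-close to the identity if $A(x)$ is $\epsilon$-close to $\mathrm{Id}$ for all $x\in\mathcal{M}$. For $n\ge1$, $F^n_x=A(f^{n-1}x)\cdots A(fx)A(x)$, viewed as a linear map from the fiber $\mathcal{E}_x=\mathbb{R}^d$ to the fiber $\mathcal{E}_{f^nx}=\mathbb{R}^d$. ''Conjugate to an orthogonal map'' means conjugate by an element of $GL(d,\mathbb{R})$ to an element of $O(d,\mathbb{R})$. A continuous Riemannian metric on $\mathcal{E}$ is a family of inner products on the fibers $\mathcal{E}_x$ depending continuously on $x$. $F$ is conformal with respect to such a metric if, in that metric, $\|F^n_x\|\cdot\|(F^n_x)^{-1}\|=1$ for all $x\in\mathcal{M}$, $n\in\mathbb{Z}$.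 *)

(* Defs.v *)
From HB Require Import structures.
From mathcomp Require Import all_boot all_order all_algebra.
From mathcomp Require Import all_classical all_reals all_analysis.
Import Order.TTheory GRing.Theory Num.Theory.
Import numFieldNormedType.Exports.

Set Implicit Arguments.
Unset Strict Implicit.
Unset Printing Implicit Defensive.

Local Open Scope classical_set_scope.
Local Open Scope ring_scope.

Record is_inner_product (R : realType) (V : lmodType R) (b : V -> V -> R) :
    Prop := IsInnerProduct {
  ip_sym : forall u v, b u v = b v u ;
  ip_lin : forall a u u' v, b (a *: u + u') v = a * b u v + b u' v ;
  ip_pos : forall u, u != 0 -> 0 < b u u }.

Definition ip_norm (R : realType) (V : lmodType R) (b : V -> V -> R) (v : V) :
  R := Num.sqrt (b v v).

(* Operator norm of L : (V, b) -> (W, b'). *)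
Definition op_norm (R : realType) (V W : lmodType R) (b : V -> V -> R)
    (b' : W -> W -> R) (L : V -> W) : R :=
  sup [set ip_norm b' (L v) | v in [set v | ip_norm b v <= 1]].

Definition euclid (R : realType) (d : nat) (u v : 'cV[R]_d) : R :=
  \sum_(i < d) u i 0 * v i 0.

Definition mx_norm2 (R : realType) (d : nat) (B : 'M[R]_d) : R :=
  op_norm (@euclid R d) (@euclid R d) (mulmx B).

Definition C1_on (R : realType) (V W : normedModType R) (U : set V)
    (h : V -> W) : Prop :=
  forall x, U x -> differentiable h x /\
    forall v, {for x, continuous (fun y => 'd h y v)}.

Fixpoint iter_derive (R : realType) (V W : normedModType R) (vs : seq V)
    (h : V -> W) : V -> W :=
  if vs is v :: vs' then iter_derive vs' (fun x => 'D_v h x) else h.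

(* C^oo : all iterated directional derivatives are differentiable. *)
Definition smooth_on (R : realType) (V W : normedModType R) (U : set V)
    (h : V -> W) : Prop :=
  forall (vs : seq V) x, U x -> differentiable (iter_derive vs h) x.

(* A homeomorphism between an open subset of M and an open subset of R^m; both
   directions are total functions, with irrelevant values outside cdom, ccod. *)
Record chart (R : realType) (M : topologicalType) (m : nat) := Chart {
  cdom : set M ;
  ccod : set 'rV[R]_m ;
  cfwd : M -> 'rV[R]_m ;
  cbwd : 'rV[R]_m -> M ;
  cdom_open : open cdom ;
  ccod_open : open ccod ;
  cfwd_cod : forall x, cdom x -> ccod (cfwd x) ;
  cbwd_dom : forall u, ccod u -> cdom (cbwd u) ;
  cfwdK : forall x, cdom x -> cbwd (cfwd x) = x ;
  cbwdK : forall u, ccod u -> cfwd (cbwd u) = u ;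
  cfwd_cont : {within cdom, continuous cfwd} ;
  cbwd_cont : {within ccod, continuous cbwd} }.

(* A C^oo atlas of dimension m, with a chosen chart chart_at x around each
   point x.  The choice is a device to define tangent spaces: T_x M is 'rV_m,
   a vector being given by its coordinates in chart_at x. *)
Record smooth_structure (R : realType) (M : topologicalType) (m : nat) :=
  SmoothStructure {
  atlas : set (chart R M m) ;
  chart_at : M -> chart R M m ;
  chart_at_atlas : forall x, atlas (chart_at x) ;
  chart_at_dom : forall x, cdom (chart_at x) x ;
  atlas_smooth : forall c c', atlas c -> atlas c' ->
    smooth_on [set u | ccod c u /\ cdom c' (cbwd c u)]
              (cfwd c' \o cbwd c) }.

Definition C1_map (R : realType) (M : topologicalType) (m : nat)
    (S : smooth_structure R M m) (f : M -> M) : Prop :=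
  continuous f /\
  forall c c', atlas S c -> atlas S c' ->
    C1_on [set u | ccod c u /\ cdom c' (f (cbwd c u))]
          (cfwd c' \o f \o cbwd c).

Record diffeo (R : realType) (M : topologicalType) (m : nat)
    (S : smooth_structure R M m) := Diffeo {
  diffeo_fun :> M -> M ;
  diffeo_inv : M -> M ;
  diffeoK : cancel diffeo_fun diffeo_inv ;
  diffeo_invK : cancel diffeo_inv diffeo_fun ;
  diffeo_C1 : C1_map S diffeo_fun ;
  diffeo_inv_C1 : C1_map S diffeo_inv }.

(* D_x f : T_x M -> T_(f x) M *)
Definition tangent_map (R : realType) (M : topologicalType) (m : nat)
    (S : smooth_structure R M m) (f : M -> M) (x : M) (v : 'rV[R]_m) :
    'rV[R]_m :=
  'd (cfwd (chart_at S (f x)) \o f \o cbwd (chart_at S x))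
     (cfwd (chart_at S x) x) v.

(* The tangent vector at cbwd c u whose coordinates in the chart c are v. *)
Definition chart_vec (R : realType) (M : topologicalType) (m : nat)
    (S : smooth_structure R M m) (c : chart R M m) (u v : 'rV[R]_m) :
    'rV[R]_m :=
  'd (cfwd (chart_at S (cbwd c u)) \o cbwd c) u v.

Record riemannian_metric (R : realType) (M : topologicalType) (m : nat)
    (S : smooth_structure R M m) := RiemannianMetric {
  rmetric :> M -> 'rV[R]_m -> 'rV[R]_m -> R ;
  rmetric_ip : forall x, is_inner_product (rmetric x) ;
  rmetric_smooth : forall c, atlas S c -> forall v w : 'rV[R]_m,
    smooth_on (ccod c) (fun u : 'rV[R]_m =>
      rmetric (cbwd c u) (chart_vec S c u v) (chart_vec S c u w) : R^o) }.

(* Only the restriction of the curve to [0, 1] matters below. *)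
Definition C1_curve (R : realType) (M : topologicalType) (m : nat)
    (S : smooth_structure R M m) (gam : R -> M) : Prop :=
  continuous gam /\
  forall c, atlas S c ->
    C1_on (V := R^o) [set t : R^o | cdom c (gam t)] (cfwd c \o gam).

Definition velocity (R : realType) (M : topologicalType) (m : nat)
    (S : smooth_structure R M m) (gam : R -> M) (t : R) : 'rV[R]_m :=
  derive1 (cfwd (chart_at S (gam t)) \o gam) t.

Definition curve_length (R : realType) (M : topologicalType) (m : nat)
    (S : smooth_structure R M m) (g : riemannian_metric S) (gam : R -> M) :
    \bar R :=
  (\int[lebesgue_measure]_(t in `[0%R, 1%R])
     (ip_norm (g (gam t)) (velocity S gam t))%:E)%E.

(* +oo between distinct connected components. *)
Definition riemannian_dist (R : realType) (M : topologicalType) (m : nat)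
    (S : smooth_structure R M m) (g : riemannian_metric S) (x y : M) : \bar R :=
  ereal_inf [set curve_length g gam | gam in
    [set gam | [/\ C1_curve S gam, gam 0 = x & gam 1 = y]]].

(* Continuity of the splitting is a consequence and is not required.  On a
   compact M the property does not depend on g. *)
Definition anosov (R : realType) (M : topologicalType) (m : nat)
    (S : smooth_structure R M m) (g : riemannian_metric S) (f : diffeo S) :
    Prop :=
  exists (Es Eu : M -> {vspace 'rV[R]_m}) (C lam : R),
    [/\ 0 < C, 0 < lam < 1,
     (forall x, (Es x + Eu x)%VS = fullv /\ (Es x :&: Eu x)%VS = 0%VS),
     (forall x,
        [set tangent_map S f x v | v in [set v | v \in Es x]] =
          [set w | w \in Es (f x)] /\
        [set tangent_map S f x v | v in [set v | v \in Eu x]] =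
          [set w | w \in Eu (f x)])
    & (forall x (n : nat) (v : 'rV[R]_m),
        (v \in Es x ->
           ip_norm (g (iter n f x)) (tangent_map S (iter n f) x v)
             <= C * lam ^+ n * ip_norm (g x) v) /\
        (v \in Eu x ->
           ip_norm (g (iter n (diffeo_inv f) x))
                   (tangent_map S (iter n (diffeo_inv f)) x v)
             <= C * lam ^+ n * ip_norm (g x) v))].

(* The cocycle F(x, v) = (f x, A x *m v) is represented by its generator A. *)
Definition linear_cocycle (R : realType) (M : Type) (d : nat)
    (A : M -> 'M[R]_d) : Prop := forall x, A x \in unitmx.

Definition lipschitz_cocycle (R : realType) (M : topologicalType) (m d : nat)
    (S : smooth_structure R M m) (g : riemannian_metric S)
    (A : M -> 'M[R]_d) : Prop :=
  exists2 K : R, 0 < K & forall x y : M,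
    ((mx_norm2 (A x - A y))%:E <= K%:E * riemannian_dist g x y)%E.

Fixpoint cocycle_iter (R : realType) (M : Type) (d : nat) (f : M -> M)
    (A : M -> 'M[R]_d) (n : nat) (x : M) : 'M[R]_d :=
  if n is k.+1 then A (iter k f x) *m cocycle_iter f A k x else 1%:M.

(* f^n x and F^n_x for n : int; F^(-n)_x is the inverse of F^n_(f^(-n) x). *)
Definition ziter (M : Type) (f finv : M -> M) (n : int) (x : M) : M :=
  match n with Posz k => iter k f x | Negz k => iter k.+1 finv x end.

Definition zcocycle_iter (R : realType) (M : Type) (d : nat) (f finv : M -> M)
    (A : M -> 'M[R]_d) (n : int) (x : M) : 'M[R]_d :=
  match n with
  | Posz k => cocycle_iter f A k x
  | Negz k => invmx (cocycle_iter f A k.+1 (iter k.+1 finv x))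
  end.

Definition orthogonal_mx (R : realType) (d : nat) (O : 'M[R]_d) : Prop :=
  O^T *m O = 1%:M.

Definition conjugate_to_orthogonal (R : realType) (d : nat) (B : 'M[R]_d) :
    Prop :=
  exists P O : 'M[R]_d,
    [/\ P \in unitmx, orthogonal_mx O & B = invmx P *m O *m P].

Definition continuous_metric (R : realType) (M : topologicalType) (d : nat)
    (b : M -> 'cV[R]_d -> 'cV[R]_d -> R) : Prop :=
  (forall x, is_inner_product (b x)) /\
  (forall u v, continuous (fun x => b x u v)).

Definition conformal_cocycle (R : realType) (M : Type) (d : nat)
    (f finv : M -> M) (A : M -> 'M[R]_d) (b : M -> 'cV[R]_d -> 'cV[R]_d -> R) : Prop :=
  forall (x : M) (n : int),
    let y := ziter f finv n x in
    let B := zcocycle_iter f finv A n x in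
    op_norm (b x) (b y) (mulmx B) * op_norm (b y) (b x) (mulmx (invmx B)) = 1.

(* Main.v *)
Require Import Defs.
From HB Require Import structures.
From mathcomp Require Import all_boot all_order all_algebra.
From mathcomp Require Import all_classical all_reals all_analysis.
From mathcomp Require Import measurable_realfun.
From mathcomp Require Import ring lra.
Import Order.TTheory GRing.Theory Num.Theory.
Import numFieldNormedType.Exports.
Set Implicit Arguments.
Unset Strict Implicit.
Unset Printing Implicit Defensive.
Local Open Scope classical_set_scope.
Local Open Scope ring_scope.

(** The cocycle is [A x = T + w x * E], where [T] rotates the plane of the first
two basis vectors [e0], [e1] by a small constant angle [t] and fixes the other
basis vectors, while [E] sends [e2] to [e0] and kills the other basis vectors.
As [E T = E] and [E E = 0],
[F^n_x = T^n + sum_(k < n) w (f^k x) T^(n-1-k) E]; hence [F^n_x e2 - e2] lies in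
the plane of [e0] and [e1], and its Euclidean length is the modulus of the
twisted sum [sum_(k < n) w (f^k x) exp (i k t)] ([cocycle_formula]).

If [n t] is not a multiple of [2 pi], then [T^n - 1] is invertible on the plane
and a conjugation by a shear removes the second summand of [F^n_x]
([conj_orthogonal]).  All the return maps are then conjugate to a rotation, by
algebra alone.  If [F] were conformal for a continuous metric, then
[F^n_x e2] would be, up to a factor bounded by compactness, as long as
[F^n_x e0 = T^n e0], so the twisted sums would be bounded in [n] and [x]
([not_conformal]).

What remains is to find a small Lipschitz function [w] and a small angle [t]
with unbounded twisted sums, [n t] never being a multiple of [2 pi]
([resonance]).  Both are limits of a Baire type construction, in which stage [k]
adds to [w] a small multiple of a function whose sums are unbounded at angles of
the current interval, then shrinks the interval and the later corrections so
that some twisted sum keeps a size of at least [k].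

So for each interval of angles a Lipschitz function [phi] is needed whose
twisted sums at angles of this interval are unbounded ([resonant_bump]).  It is
a bump around a point [z] on which an orbit accumulates and which is not fixed
by [f], ..., [f^L]: the support can then be chosen disjoint from its first [L]
images.  With [c k = phi (f^k x)], average the square modulus of
[sum_k c k exp (i k t)] over the interval with the weights of a Fejer kernel.
The diagonal contributes [sum_k c k ^ 2], which is unbounded as the orbit comes
back to [z]; the other pairs of indices at distance at most [L] contribute
nothing, and the remaining ones little if [L] is large with respect to the
length of the interval ([trig_lower]).

Only the existence of [z] uses hyperbolicity.  Some iterate [f^n], with [n]
divisible by all integers up to [L], has a finite open cover that separates
orbits ([anosov_generator]).  If every limit point of every forward and backward
orbit of [f^n] were fixed by [f^n], the itinerary of each point through this
cover could be chosen eventually constant in both directions, and [M] would be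
countable ([recurrent_point]).  The cover comes from finitely many functions
[psi_i] that separate nearby points and tangent vectors ([sep_family]):
hyperbolicity makes the norm [sum_i |d psi_i v|] grow under [f^n] or under its
inverse, and strict differentiability carries this over to the distance
[sum_i |psi_i x - psi_i y|] between nearby points ([expansive_local]). *)

(** * Strict differentiability *)

Section StrictDiff.
Variable R : realType.

(** The increment is compared at two moving points [u], [u'].  This
uniformity is what carries linear estimates on tangent spaces over to pairs of
nearby points. *)
Definition strict_estimate (V W : normedModType R) (h : V -> W) (x : V) (L : V -> W) :=
  forall e : R, 0 < e -> exists2 r : R, 0 < r &
    forall u u', `|u - x| < r -> `|u' - x| < r ->
      `|h u - h u' - L (u - u')| <= e * `|u - u'|.

Definition strict_diff (V W : normedModType R) (h : V -> W) (x : V) :=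
  differentiable h x /\ strict_estimate h x ('d h x).

Lemma strict_diffI (V W : normedModType R) (h : V -> W) (x : V)
    (L : {linear V -> W}) :
  continuous L -> strict_estimate h x L -> strict_diff h x /\ 'd h x = L :> (V -> W).
Proof.
move=> Lc Lh.
have hL : h \o shift x = cst (h x) + L +o_ 0 id.
  apply/eqaddoP => e e0; have [r r0 hr] := Lh _ e0.
  apply/nbhs_ballP; exists r => //= v; rewrite -ball_normE /= sub0r normrN => vr.
  have := hr (v + x) x; rewrite addrK subrr normr0 => /(_ vr r0).
  by rewrite opprD addrA.
have dL : 'd h x = L :> (V -> W) by exact: diff_unique.
split=> //; split; last by rewrite dL.
by apply/diff_locallyP; split; rewrite dL.
Qed.

Lemma strict_diff_bound (V W : normedModType R) (h : V -> W) (x : V) :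
  strict_diff h x -> exists2 k, 0 < k & forall v, `|'d h x v| <= k * `|v|.
Proof. by move=> [dh _]; exact/linear_lipschitz/diff_continuous. Qed.

Lemma strict_diff_lip (V W : normedModType R) (h : V -> W) (x : V) :
  strict_diff h x -> exists k r, [/\ 0 < k, 0 < r &
    forall u u', `|u - x| < r -> `|u' - x| < r -> `|h u - h u'| <= k * `|u - u'|].
Proof.
move=> hx; have [k k0 hk] := strict_diff_bound hx; have [r r0 hr] := hx.2 1 ltr01.
exists (k + 1), r; split=> //; first by rewrite addr_gt0.
move=> u u' ur u'r; rewrite -[h u - h u'](subrK ('d h x (u - u'))).
rewrite (le_trans (ler_normD _ _))// addrC mulrDl lerD//.
exact: hr.
Qed.

Lemma strict_diff_near (V W : normedModType R) (h h' : V -> W) (x : V) :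
  (\forall u \near x, h u = h' u) -> strict_diff h x ->
  strict_diff h' x /\ 'd h' x = 'd h x :> (V -> W).
Proof.
move=> /nbhs_ballP[r /= r0 hr] [dh sh]; apply: strict_diffI; first exact: diff_continuous.
move=> e e0; have [s s0 hs] := sh _ e0.
exists (Num.min r s); first by rewrite lt_min r0.
move=> u u'; rewrite !lt_min => /andP[ur us] /andP[u'r u's].
by rewrite -!hr ?hs// -ball_normE/= distrC.
Qed.

Lemma strict_diff_comp (U V W : normedModType R) (h : U -> V) (k : V -> W) (x : U) :
  strict_diff h x -> strict_diff k (h x) ->
  strict_diff (k \o h) x /\ 'd (k \o h) x = 'd k (h x) \o 'd h x :> (U -> W).
Proof.
move=> hx kx; apply: strict_diffI.
  move=> u; apply: continuous_comp; apply: diff_continuous; [exact: hx.1|exact: kx.1].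
move=> e e0; have [cK cK0 hcK] := strict_diff_bound kx.
have [c [r0 [c0 r00 hc]]] := strict_diff_lip hx.
have e1 : 0 < e / 2 / c by rewrite !divr_gt0.
have e2 : 0 < e / 2 / cK by rewrite !divr_gt0.
have [r1 r10 hr1] := kx.2 _ e1.
have [r2 r20 hr2] := hx.2 _ e2.
exists (Num.min (Num.min r0 r2) (r1 / c)); first by rewrite !lt_min r00 r20 divr_gt0.
move=> u u'; rewrite !lt_min => /andP[/andP[u0 u2] u1] /andP[/andP[u'0 u'2] u'1].
have near1 w : `|w - x| < r0 -> `|w - x| < r1 / c -> `|h w - h x| < r1.
  move=> w0 w1; apply: (le_lt_trans (hc _ _ w0 _)); first by rewrite subrr normr0.
  by rewrite mulrC -ltr_pdivlMr.
have -> : (k \o h) u - (k \o h) u' - ('d k (h x) \o 'd h x) (u - u') =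
  (k (h u) - k (h u') - 'd k (h x) (h u - h u'))
  + 'd k (h x) (h u - h u' - 'd h x (u - u')).
  by move: (h u - h u') => z; rewrite (linearB _ z) /= addrA subrK.
rewrite (le_trans (ler_normD _ _))// [e]splitr mulrDl lerD//.
  apply: (le_trans (hr1 _ _ (near1 _ u0 u1) (near1 _ u'0 u'1))).
  have := hc _ _ u0 u'0; rewrite -(ler_pM2l e1) => /le_trans; apply.
  by rewrite mulrA divfK ?gt_eqF.
apply: (le_trans (hcK _)).
have := hr2 _ _ u2 u'2; rewrite -(ler_pM2l cK0) => /le_trans; apply.
by rewrite mulrA mulrCA divff ?gt_eqF// mulr1.
Qed.

Lemma is_diff_rv_coord (m : nat) (i : 'I_m) (x : 'rV[R]_m) :
  is_diff x (fun v : 'rV[R]_m => v 0 i : R) (fun v => v 0 i).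
Proof.
have co_lin : linear (fun v : 'rV[R]_m => v 0 i : R).
  by move=> u y z; rewrite !mxE.
pose coM := GRing.isLinear.Build _ _ _ _ _ co_lin.
pose coL : {linear 'rV[R]_m -> R} := HB.pack (fun v : 'rV[R]_m => v 0 i : R) coM.
have -> : (fun v : 'rV[R]_m => v 0 i : R) = coL by [].
have coc : continuous coL by exact: coord_continuous.
by apply: DiffDef; [exact/linear_differentiable|rewrite diff_lin].
Qed.

Lemma rv_norm_le (m : nat) (v : 'rV[R]_m) (e : R) : 0 <= e ->
  (forall i, `|v 0 i| <= e) -> `|v| <= e.
Proof.
move=> e0 ve; rewrite /Num.norm/= mx_normrE; apply/bigmax_leP; split=> //.
by case=> i j _ /=; rewrite ord1.
Qed.

Lemma rv_coord_le (m : nat) (v : 'rV[R]_m) i : `|v 0 i| <= `|v|.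
Proof.
rewrite [leRHS]/Num.norm/= mx_normrE.
exact: (le_bigmax_cond _ (fun ij : 'I_1 * 'I_m => `|v ij.1 ij.2|) (j := (0, i))).
Qed.

(** Mean value theorem, coordinate by coordinate, for [h] minus
its differential at [x] on the segment from [u'] to [u].  The finite frame [b]
turns the pointwise continuity of the differential into continuity in norm; it
also lets [R] itself be a source, although it is not a space of row vectors. *)
Lemma C1_strict_diff_frame (V : normedModType R) (n m : nat) (U : set V)
    (h : V -> 'rV[R]_m) (b : 'I_n -> V) (co : V -> 'I_n -> R) (x : V) :
  (forall v, v = \sum_i co v i *: b i) -> (forall v i, `|co v i| <= `|v|) ->
  open U -> C1_on U h -> U x -> strict_diff h x.
Proof.
move=> vE co_le Uo Uh Ux; have [dx cx] := Uh _ Ux.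
split=> // e e0.
pose e' := e / (n%:R + 1).
have n1 : (0:R) < n%:R + 1 by rewrite ltr_wpDl.
have e'0 : 0 < e' by rewrite divr_gt0.
have [r r0 hr] : exists2 r, 0 < r & forall y, `|y - x| < r ->
    U y /\ forall j, `|'d h y (b j) - 'd h x (b j)| <= e'.
  have H : \forall y \near x, U y /\ forall j, `|'d h y (b j) - 'd h x (b j)| <= e'.
    have H1 : \forall y \near x, U y by exact: open_nbhs_nbhs.
    have H2 : \forall y \near x, forall j, `|'d h y (b j) - 'd h x (b j)| <= e'.
      apply: filter_forall => j.
      have /cvgrPdist_le/(_ _ e'0) := cx (b j).
      by apply: filterS => y; rewrite distrC.
    by apply: filterS2 H1 H2.
  move/nbhs_ballP: H => [r r0 hr]; exists r => // y yr.
  by apply: hr; rewrite -ball_normE/= distrC.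
exists r => // u u' ur u'r; set w := u - u'.
have dw y : `|y - x| < r -> `|'d h y w - 'd h x w| <= e * `|w|.
  move=> yr; have [_ hy] := hr _ yr.
  have -> : 'd h y w - 'd h x w = \sum_i co w i *: ('d h y (b i) - 'd h x (b i)).
    have E z : 'd h z w = \sum_i co w i *: 'd h z (b i).
      rewrite {1}(vE w) (linear_sum ('d h z)); apply: eq_bigr => i _.
      exact: linearZ.
    by rewrite !E -sumrB; apply: eq_bigr => i _; rewrite scalerBr.
  rewrite (le_trans (ler_norm_sum _ _ _))//.
  apply: (@le_trans _ _ (\sum_(i < n) e' * `|w|)).
    apply: ler_sum => i _; rewrite normrZ mulrC.
    exact: ler_pM.
  rewrite sumr_const card_ord -mulr_natr mulrAC ler_wpM2r// /e' mulrAC ler_pdivrMr//.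
  by rewrite ler_wpM2l ?(ltW e0)// lerDl.
apply: rv_norm_le => [|i]; first by rewrite mulr_ge0// ltW.
pose p (t : R) := u' + t *: w.
have pin (t : R) : t \in `[0, 1] -> `|p t - x| < r.
  rewrite in_itv /= => /andP[t0 t1].
  have -> : p t - x = (1 - t) *: (u' - x) + t *: (u - x).
    have -> : p t - x = u' - x + t *: ((u - x) - (u' - x)).
      by rewrite /p /w opprB [u - x + _]addrA subrK addrAC.
    by rewrite scalerBl scale1r scalerBr addrA addrAC.
  rewrite (le_lt_trans (ler_normD _ _))// !normrZ !ger0_norm ?subr_ge0//.
  have [/eqP t1'|t1'] := eqVneq t 1; first by rewrite (eqP t1') subrr mul0r add0r mul1r.
  have : (1 - t) * `|u' - x| < (1 - t) * r by rewrite ltr_pM2l// subr_gt0 lt_neqAle t1'.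
  have : t * `|u - x| <= t * r by rewrite ler_wpM2l// ltW.
  by lra.
pose q (t : R) := h (p t) 0 i - t * 'd h x w 0 i.
pose dq (t : R) := 'd h (p t) w 0 i - 'd h x w 0 i.
have dh (t : R) : t \in `[0, 1] -> differentiable h (p t).
  by move=> /pin /hr[/Uh[]].
have qd (t : R) : t \in `[0, 1] -> is_derive t 1 q (dq t).
  move=> t01.
  have dp : is_diff t p (fun s => s *: w).
    have H := is_diffD (is_diff_cst u' t) (is_diff_scalel t w).
    by apply: (is_diff_eq H); apply/funext => s /=; rewrite add0r.
  have dhp : is_diff t (h \o p) ('d h (p t) \o (fun s => s *: w)).
    exact: (is_diff_comp dp (differentiableP (dh _ t01))).
  have dc : is_diff (h (p t)) (fun v : 'rV[R]_m => v 0 i : R) (fun v => v 0 i).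
    exact: is_diff_rv_coord.
  have dq1 : is_diff t ((fun v : 'rV[R]_m => v 0 i : R) \o (h \o p)) ((fun v : 'rV[R]_m => v 0 i : R) \o ('d h (p t) \o (fun s => s *: w))).
    exact: (is_diff_comp dhp dc).
  have dd : is_derive t 1 ((fun v : 'rV[R]_m => v 0 i : R) \o (h \o p)) ('d h (p t) w 0 i).
    apply: DeriveDef; first by apply: diff_derivable; exact: (@ex_diff _ _ _ _ _ _ _ dq1).
    rewrite deriveE; last exact: (@ex_diff _ _ _ _ _ _ _ dq1).
    by rewrite (@diff_val _ _ _ _ _ _ _ dq1) /= scale1r.
  have dl : is_derive t 1 (fun s : R => s * 'd h x w 0 i) ('d h x w 0 i).
    have := is_deriveM (is_derive_id t 1) (is_derive_cst ('d h x w 0 i) t 1).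
    by move=> H; apply: is_derive_eq H _; rewrite scaler0 add0r /= scaler1.
  exact: (is_deriveB dd dl).
have qc : {within `[0, 1], continuous q}.
  apply: continuous_in_subspaceT => t; rewrite inE /= => t01.
  have /derivable1_diffP/differentiable_continuous : derivable q t 1 by apply: (@ex_derive _ _ _ _ _ _ _ (qd _ t01)).
  exact.
have qd' (t : R) : t \in `]0, 1[%R -> is_derive t 1 q (dq t).
  by move=> t01; apply: qd; exact: subset_itv_oo_cc t01.
have [c c01] := MVT_segment ler01 qd' qc.
rewrite subr0 mulr1 /q /p scale1r scale0r addr0 mul0r subr0 mul1r.
have -> : u' + w = u by rewrite /w addrC subrK.
move=> E.
rewrite !mxE addrAC E.
have := dw _ (pin _ c01); apply: le_trans.
by have := rv_coord_le ('d h (p c) w - 'd h x w) i; rewrite !mxE.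
Qed.

Lemma C1_strict_diff_rV (n m : nat) (U : set 'rV[R]_n) (h : 'rV[R]_n -> 'rV[R]_m) x :
  open U -> C1_on U h -> U x -> strict_diff h x.
Proof.
apply: (@C1_strict_diff_frame _ n m U h (fun i => delta_mx 0 i) (fun v i => v 0 i)).
  exact: row_sum_delta.
exact: rv_coord_le.
Qed.

Lemma C1_strict_diff_R (m : nat) (U : set R^o) (h : R^o -> 'rV[R]_m) x :
  open U -> C1_on U h -> U x -> strict_diff h x.
Proof.
apply: (@C1_strict_diff_frame R^o 1 m U h (fun i => 1) (fun v i => v)) => //.
by move=> v; rewrite big_ord1 /GRing.scale /= mulr1.
Qed.

Lemma dist_tri (a b c k : R) :
  `|c - a| <= k -> `|c - b| <= k -> `|a - b| <= k + k.
Proof.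
move=> ca cb; have -> : a - b = (c - b) - (c - a).
  by ring.
by rewrite (le_trans (ler_normB _ _))// lerD.
Qed.

(** The difference quotient on a short interval starting
at [t] is close to the derivative at [t], and, by strictness at [t0], close to
the derivative at [t0] as well. *)
Lemma strict_diff_derive1_continuous (h : R -> R) (t0 : R) :
  (forall t : R, strict_diff h t) -> {for t0, continuous (derive1 h)}.
Proof.
move=> hs; apply/cvgrPdist_le => e; rewrite -[0 < e]/(0 < (e : R)) => e0.
have [r r0 hr] := (hs t0).2 _ (divr_gt0 e0 (ltr0n R 2)).
apply/nbhs_ballP; exists r => //= t /=; rewrite distrC => tr.
have [s s0 hs'] := (hs t).2 _ (divr_gt0 e0 (ltr0n R 2)).
pose d := Num.min s (r - `|t - t0|) / 2.
have d0 : 0 < d by rewrite divr_gt0// lt_min s0 subr_gt0.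
have dlt : d < Num.min s (r - `|t - t0|).
  by rewrite /d ltr_pdivrMr// ltr_pMr ?ltr1n// lt_min s0 subr_gt0.
have [ds dr] : d < s /\ d < r - `|t - t0| by move: dlt; rewrite lt_min => /andP.
have E1 := hr (t + d) t; have E2 := hs' (t + d) t.
have tdr : `|t + d - t0| < r.
  rewrite addrAC (le_lt_trans (ler_normD _ _))// (gtr0_norm d0) -ltrBrDl//.
have tdt : t + d - t = d by rewrite addrAC subrr add0r.
have {}E1 := E1 tdr tr.
have {}E2 : `|h (t + d) - h t - 'd h t d| <= e / 2 * d.
  have := E2; rewrite tdt subrr normr0 (gtr0_norm d0).
  by apply.
have {}E1 : `|h (t + d) - h t - 'd h t0 d| <= e / 2 * d.
  by move: E1; rewrite tdt (gtr0_norm d0).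
have dE s' : 'd h s' d = d * derive1 h s'.
  rewrite derive1E deriveE; last exact: (hs s').1.
  by rewrite -[d in LHS]mulr1 -/(d *: (1 : R)) linearZ.
have : `|d * derive1 h t0 - d * derive1 h t| <= e * d.
  rewrite -(dE t0) -(dE t) [e]splitr mulrDl.
  exact: dist_tri E1 E2.
by rewrite -mulrBr normrM (gtr0_norm d0) mulrC ler_pM2r.
Qed.

End StrictDiff.

(** * Strictly differentiable maps and functions on the manifold *)

Section Charts.
Variables (R : realType) (M : topologicalType) (m : nat).
Variable S : smooth_structure R M m.

Lemma cbwd_continuous (c : chart R M m) u : ccod c u -> {for u, continuous (cbwd c)}.
Proof.
move=> cu; have := @cbwd_cont _ _ _ c; rewrite (continuous_open_subspace _ (@ccod_open _ _ _ c)).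
by apply; rewrite inE.
Qed.

Lemma cfwd_continuous (c : chart R M m) x : cdom c x -> {for x, continuous (cfwd c)}.
Proof.
move=> cx; have := @cfwd_cont _ _ _ c; rewrite (continuous_open_subspace _ (@cdom_open _ _ _ c)).
by apply; rewrite inE.
Qed.

Lemma near_in_chart (T : topologicalType) (h : T -> M) (c : chart R M m) (t : T) :
  {for t, continuous h} -> cdom c (h t) -> \forall s \near t, cdom c (h s).
Proof. by move=> hc ct; apply: hc; apply: open_nbhs_nbhs; split=> //; exact: cdom_open. Qed.

Lemma open_chart_preimage (h : M -> M) (c c' : chart R M m) : continuous h ->
  open [set u | ccod c u /\ cdom c' (h (cbwd c u))].
Proof.
move=> hc; rewrite openE => u [cu c'u]; apply: filterI.
  by apply: open_nbhs_nbhs; split=> //; exact: ccod_open.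
apply: (@near_in_chart _ (h \o cbwd c)) => //.
by apply: continuous_comp; [exact: cbwd_continuous|exact: hc].
Qed.

(** A consequence of C1 that is easier to compose, as it is a condition at
single points rather than on open sets of charts. *)
Definition strict_map (f : M -> M) := continuous f /\
  forall c c', atlas S c -> atlas S c' -> forall u, ccod c u ->
    cdom c' (f (cbwd c u)) -> strict_diff (cfwd c' \o f \o cbwd c) u.

Lemma C1_map_strict_map f : C1_map S f -> strict_map f.
Proof.
move=> [fc fC1]; split=> // c c' cS c'S u cu c'u.
exact: (C1_strict_diff_rV (open_chart_preimage fc) (fC1 _ _ cS c'S)).
Qed.

(** This is about changes of charts.  Smoothness makes each
directional derivative differentiable, hence continuous, which is the C1
property. *)
Lemma strict_map_id : strict_map id.
Proof.
split; first by move=> x; exact: cvg_id.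
move=> c c' cS c'S u cu c'u.
have sm := atlas_smooth cS c'S.
apply: (@C1_strict_diff_rV _ m m [set u | ccod c u /\ cdom c' (cbwd c u)] (cfwd c' \o cbwd c)) => //.
  by apply: (@open_chart_preimage id) => x; exact: cvg_id.
move=> w cw; split; first exact: (sm [::] _ cw).
move=> v; have dv : differentiable (fun y => 'D_v (cfwd c' \o cbwd c) y) w.
  exact: (sm [:: v] _ cw).
have cD : {for w, continuous (fun y => 'D_v (cfwd c' \o cbwd c) y)}.
  exact: differentiable_continuous dv.
have E : \forall y \near w, 'D_v (cfwd c' \o cbwd c) y = 'd (cfwd c' \o cbwd c) y v.
  have : \forall y \near w, ccod c y /\ cdom c' (cbwd c y).
    apply: open_nbhs_nbhs; split=> //.
    by apply: (@open_chart_preimage id) => x; exact: cvg_id.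
  by apply: filterS => y cy; rewrite deriveE//; exact: (sm [::] _ cy).
move: cD; rewrite /prop_for /continuous_at (nbhs_singleton E) => cD.
exact: (cvg_trans (near_eq_cvg E) cD).
Qed.

(** Near [u], the function [F \o h \o cbwd c] factors through the chart
[c'] around [h (cbwd c u)].  The rules of calculus on [M] below are all
instances of this one. *)
Lemma chart_chain (W : normedModType R) (F : M -> W) (h : M -> M)
    (c c' : chart R M m) (u : 'rV[R]_m) :
  strict_map h -> atlas S c -> atlas S c' -> ccod c u -> cdom c' (h (cbwd c u)) ->
  strict_diff (F \o cbwd c') (cfwd c' (h (cbwd c u))) ->
  strict_diff (F \o h \o cbwd c) u /\
  'd (F \o h \o cbwd c) u =
    'd (F \o cbwd c') (cfwd c' (h (cbwd c u))) \o 'd (cfwd c' \o h \o cbwd c) u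
    :> ('rV[R]_m -> W).
Proof.
move=> [hc hs] cS c'S cu c'u Fs.
have [s1 d1] := strict_diff_comp (hs _ _ cS c'S _ cu c'u) Fs.
rewrite -d1; apply: strict_diff_near s1.
have : \forall s \near u, cdom c' (h (cbwd c s)).
  apply: (@near_in_chart _ (h \o cbwd c)) => //.
  by apply: continuous_comp; [exact: cbwd_continuous|exact: hc].
by apply: filterS => s c's /=; rewrite cfwdK.
Qed.

Lemma strict_map_comp f h : strict_map f -> strict_map h -> strict_map (f \o h).
Proof.
move=> fs hs; split.
  by move=> x; apply: continuous_comp; [exact: hs.1|exact: fs.1].
move=> c c' cS c'S u cu c'u.
pose c1 := chart_at S (h (cbwd c u)).
have c1S : atlas S c1 by exact: chart_at_atlas.
have c1u : cdom c1 (h (cbwd c u)) by exact: chart_at_dom.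
have [] // := @chart_chain _ (cfwd c' \o f) h c c1 u hs cS c1S cu c1u.
by apply: fs.2 => //; [exact: cfwd_cod|rewrite cfwdK].
Qed.

Lemma strict_map_iter f n : strict_map f -> strict_map (iter n f).
Proof.
move=> fs; elim: n => [|n IH]; first exact: strict_map_id.
rewrite (_ : iter n.+1 f = f \o iter n f); first exact: strict_map_comp.
by apply/funext.
Qed.

Let at_S x : atlas S (chart_at S x). Proof. exact: chart_at_atlas. Qed.
Let at_dom x : cdom (chart_at S x) x. Proof. exact: chart_at_dom. Qed.
Let at_cod x : ccod (chart_at S x) (cfwd (chart_at S x) x).
Proof. exact: cfwd_cod. Qed.

Lemma tangent_comp f h x v : strict_map f -> strict_map h ->
  tangent_map S (f \o h) x v = tangent_map S f (h x) (tangent_map S h x v).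
Proof.
move=> fs hs; rewrite /tangent_map /=.
have E : h (cbwd (chart_at S x) (cfwd (chart_at S x) x)) = h x by rewrite cfwdK.
have [] := @chart_chain _ (cfwd (chart_at S (f (h x))) \o f) h (chart_at S x)
   (chart_at S (h x)) _ hs (at_S _) (at_S _) (at_cod x).
- by rewrite E.
- by rewrite E; apply: fs.2 => //; rewrite cfwdK.
by rewrite E => _ /(congr1 (@^~ v)).
Qed.

Lemma diff_chart_id (c : chart R M m) u v : ccod c u ->
  'd (cfwd c \o id \o cbwd c) u v = v.
Proof.
move=> cu.
pose I : {linear 'rV[R]_m -> 'rV[R]_m} := idfun.
have Ic : continuous I by move=> z; exact: cvg_id.
have Ie : strict_estimate (idfun : 'rV[R]_m -> 'rV[R]_m) u I.
  by move=> e e0; exists 1 => // w w' _ _ /=; rewrite subrr normr0 mulr_ge0// ltW.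
have [sid did] := strict_diffI Ic Ie.
have near_id : \forall w \near u, idfun w = (cfwd c \o id \o cbwd c) w.
  have : \forall w \near u, ccod c w by apply: open_nbhs_nbhs; split=> //; exact: ccod_open.
  by apply: filterS => w cw /=; rewrite cbwdK.
have [_ E] := strict_diff_near near_id sid.
exact: (etrans (congr1 (@^~ v) E) (congr1 (@^~ v) did)).
Qed.

Lemma tangent_id x v : tangent_map S id x v = v.
Proof. exact: diff_chart_id. Qed.

Lemma tangent_iterS f n x v : strict_map f ->
  tangent_map S (iter n.+1 f) x v =
  tangent_map S f (iter n f x) (tangent_map S (iter n f) x v).
Proof.
move=> fs; rewrite -tangent_comp//; last exact: strict_map_iter.
Qed.

(** One chart per point suffices: by [strict_fun_chart] the property then
holds in all charts of the atlas. *)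
Definition strict_fun (psi : M -> R) := forall x,
  strict_diff (psi \o cbwd (chart_at S x)) (cfwd (chart_at S x) x).

(** The differential of [psi] at [x], on tangent vectors given by their
coordinates in the chosen chart around [x]. *)
Definition fun_diff (psi : M -> R) x (v : 'rV[R]_m) : R :=
  'd (psi \o cbwd (chart_at S x)) (cfwd (chart_at S x) x) v.

Lemma strict_fun_comp psi h : strict_fun psi -> strict_map h -> strict_fun (psi \o h) /\
  forall x v, fun_diff (psi \o h) x v = fun_diff psi (h x) (tangent_map S h x v).
Proof.
move=> ps hs.
have H x : strict_diff (psi \o h \o cbwd (chart_at S x)) (cfwd (chart_at S x) x) /\
  'd (psi \o h \o cbwd (chart_at S x)) (cfwd (chart_at S x) x)  =
  'd (psi \o cbwd (chart_at S (h x))) (cfwd (chart_at S (h x)) (h x)) \o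
  'd (cfwd (chart_at S (h x)) \o h \o cbwd (chart_at S x)) (cfwd (chart_at S x) x)
    :> ('rV[R]_m -> R).
  have E : h (cbwd (chart_at S x) (cfwd (chart_at S x) x)) = h x by rewrite cfwdK.
  have := @chart_chain _ psi h (chart_at S x)
   (chart_at S (h x)) _ hs (at_S _) (at_S _) (at_cod x).
  rewrite E; apply; first exact: at_dom.
  exact: ps.
split=> [x|x v]; first exact: (H x).1.
exact: (congr1 (@^~ v) (H x).2).
Qed.

Lemma strict_fun_chart psi c u : strict_fun psi -> atlas S c -> ccod c u ->
  strict_diff (psi \o cbwd c) u /\
  forall v, 'd (psi \o cbwd c) u v = fun_diff psi (cbwd c u) (chart_vec S c u v).
Proof.
move=> ps cS cu.
have [s1 d1] := @chart_chain _ psi id c (chart_at S (cbwd c u)) u strict_map_id cS (at_S _) cu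
  (at_dom _) (ps _).
by split=> // v; exact: (congr1 (@^~ v) d1).
Qed.

(** The differential of the inverse change of charts is a left
inverse. *)
Lemma chart_vec_inj c u v : atlas S c -> ccod c u -> chart_vec S c u v = 0 -> v = 0.
Proof.
move=> cS cu; rewrite /chart_vec => v0.
pose c' := chart_at S (cbwd c u).
have c'u : ccod c' (cfwd c' (cbwd c u)) by exact: at_cod.
have sb : strict_diff (cfwd c \o cbwd c') (cfwd c' (cbwd c u)).
  apply: (strict_map_id.2 _ _ (at_S _) cS) => //=.
  have E : cbwd c' (cfwd c' (cbwd c u)) = cbwd c u by apply: cfwdK; exact: at_dom.
  by rewrite -/c' E; exact: cbwd_dom.
have [s1 d1] := @chart_chain _ (cfwd c) id c c' u strict_map_id cS (at_S _) cu
  (at_dom _) sb.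
have := congr1 (@^~ v) d1; rewrite diff_chart_id// => ->.
rewrite -[RHS](linear0 ('d (cfwd c \o cbwd c') (cfwd c' (id (cbwd c u))))).
exact: congr1 v0.
Qed.

Lemma curve_deriv psi gam t : strict_fun psi -> C1_curve S gam ->
  strict_diff (psi \o gam) t /\
  derive1 (psi \o gam) t = fun_diff psi (gam t) (velocity S gam t).
Proof.
move=> ps [gc g1]; pose c := chart_at S (gam t).
have ct : cdom c (gam t) by exact: at_dom.
have cS : atlas S c by exact: at_S.
have [s1 d1] : strict_diff ((psi \o cbwd c) \o (cfwd c \o gam)) t /\
  'd ((psi \o cbwd c) \o (cfwd c \o gam)) t = 'd (psi \o cbwd c) (cfwd c (gam t))
   \o 'd (cfwd c \o gam) t :> (R^o -> R).
  apply: strict_diff_comp; last exact: ps.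
  apply: (@C1_strict_diff_R _ m [set t | cdom c (gam t)]) => //; last exact: g1.
  rewrite openE => s cs; apply: (@near_in_chart _ gam) => //.
  exact: gc.
have near_eq : \forall s \near t, ((psi \o cbwd c) \o (cfwd c \o gam)) s = (psi \o gam) s.
  have : \forall s \near t, cdom c (gam s).
    by apply: (@near_in_chart _ gam) => //; exact: gc.
  by apply: filterS => s cs /=; rewrite cfwdK.
have [s2 d2] := strict_diff_near near_eq s1; split=> //.
rewrite derive1E deriveE; last exact: s2.1.
have vE : velocity S gam t = 'd (cfwd c \o gam) t 1.
  by rewrite /velocity derive1E deriveE//; exact: (g1 _ cS _ ct).1.
apply: (etrans (congr1 (@^~ 1) d2)); apply: (etrans (congr1 (@^~ 1) d1)).
by rewrite vE.
Qed.
End Charts.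

(** * Inner products and the Riemannian metric in charts *)

Section InnerProduct.
Variables (R : realType) (V : lmodType R) (b : V -> V -> R).
Hypothesis ib : is_inner_product b.

Lemma ipDl u u' v : b (u + u') v = b u v + b u' v.
Proof. by have := ip_lin ib 1 u u' v; rewrite scale1r mul1r. Qed.
Lemma ip0l v : b 0 v = 0.
Proof. by have := ipDl 0 0 v; rewrite addr0 => /eqP; rewrite -subr_eq subrr eq_sym => /eqP. Qed.
Lemma ipZl a u v : b (a *: u) v = a * b u v.
Proof. by have := ip_lin ib a u 0 v; rewrite addr0 ip0l addr0. Qed.
Lemma ipDr u v v' : b u (v + v') = b u v + b u v'.
Proof. by rewrite !(ip_sym ib u) ipDl. Qed.
Lemma ipZr a u v : b u (a *: v) = a * b u v.
Proof. by rewrite !(ip_sym ib u) ipZl. Qed.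
Lemma ip0r v : b v 0 = 0.
Proof. by rewrite (ip_sym ib) ip0l. Qed.
Lemma ip_ge0 u : 0 <= b u u.
Proof. by have [->|/(ip_pos ib)/ltW//] := eqVneq u 0; rewrite ip0l. Qed.
Lemma ip_suml (I : finType) (F : I -> V) v : b (\sum_i F i) v = \sum_i b (F i) v.
Proof.
apply: (big_morph (b^~ v)); last exact: ip0l.
by move=> x y; exact: ipDl.
Qed.
Lemma ip_sumr (I : finType) (F : I -> V) v : b v (\sum_i F i) = \sum_i b v (F i).
Proof. by rewrite (ip_sym ib) ip_suml; apply: eq_bigr => i _; exact: (ip_sym ib). Qed.

Lemma ip_norm_ge0 v : 0 <= ip_norm b v. Proof. exact: sqrtr_ge0. Qed.
Lemma ip_norm_sq v : ip_norm b v ^+ 2 = b v v.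
Proof. by rewrite sqr_sqrtr// ip_ge0. Qed.
Lemma ip_normZ a v : ip_norm b (a *: v) = `|a| * ip_norm b v.
Proof. by rewrite /ip_norm ipZl ipZr mulrA -expr2 sqrtrM ?sqr_ge0// sqrtr_sqr. Qed.
Lemma ip_norm_gt0 v : v != 0 -> 0 < ip_norm b v.
Proof. by move=> v0; rewrite sqrtr_gt0 (ip_pos ib). Qed.

Lemma ip_CS u v : b u v <= ip_norm b u * ip_norm b v.
Proof.
have [->|v0] := eqVneq v 0; first by rewrite ip0r mulr_ge0// ip_norm_ge0.
have bv := ip_pos ib v0.
rewrite (le_trans (ler_norm _))// -ler_sqr ?nnegrE ?mulr_ge0 ?ip_norm_ge0//.
rewrite exprMn !ip_norm_sq real_normK ?num_real// -ler_pdivrMr//.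
have := ip_ge0 (u - (b u v / b v v) *: v).
rewrite -scaleNr ipDl !ipDr !ipZl !ipZr (ip_sym ib v u).
set t := b u v / b v v; have -> : b u v = t * b v v by rewrite /t divfK ?gt_eqF.
have -> : (t * b v v) ^+ 2 / b v v = t ^+ 2 * b v v by field; rewrite gt_eqF.
by nra.
Qed.

Lemma ip_normD u v : ip_norm b (u + v) <= ip_norm b u + ip_norm b v.
Proof.
rewrite -ler_sqr ?nnegrE ?addr_ge0 ?ip_norm_ge0// ip_norm_sq.
rewrite ipDl !ipDr (ip_sym ib v u) sqrrD !ip_norm_sq.
have := ip_CS u v; lra.
Qed.

Lemma ip_normB u v : ip_norm b u - ip_norm b v <= ip_norm b (u + v).
Proof.
rewrite lerBlDr; have := ip_normD (u + v) (- v); rewrite addrK.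
by rewrite -scaleN1r ip_normZ normrN1 mul1r.
Qed.
End InnerProduct.

Section Near.
Variable R : realType.
Lemma near_norm (V : normedModType R) (x : V) (r : R) : 0 < r ->
  \forall u \near x, `|u - x| < r.
Proof.
by move=> r0; apply/nbhs_ballP; exists r => // u; rewrite -ball_normE /= distrC.
Qed.

Lemma continuous_at_sum (T : topologicalType) (x : T) (I : finType)
    (f : I -> T -> R) : (forall i, {for x, continuous (f i)}) ->
  {for x, continuous (fun y => \sum_i f i y)}.
Proof.
move=> fc; rewrite /prop_for /continuous_at; elim: (index_enum I) => [|i s IH].
  rewrite big_nil; rewrite (_ : (fun y => _) = cst 0); first exact: cvg_cst.
  by apply/funext => y; rewrite big_nil.
rewrite big_cons (_ : (fun y => _) = f i \+ (fun y => \sum_(i <- s) f i y)).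
  by apply: cvgD => //; exact: fc.
by apply/funext => y; rewrite big_cons.
Qed.
End Near.

Section RowInnerProduct.
Variables (R : realType) (m : nat).
Implicit Types b : 'rV[R]_m -> 'rV[R]_m -> R.

Lemma ip_coord b (v w : 'rV[R]_m) : is_inner_product b ->
  b v w = \sum_i \sum_j v 0 i * w 0 j * b (delta_mx 0 i) (delta_mx 0 j).
Proof.
move=> ib; rewrite {1}(row_sum_delta v) (ip_suml ib); apply: eq_bigr => i _.
rewrite {1}(row_sum_delta w) (ip_sumr ib); apply: eq_bigr => j _.
by rewrite (ipZl ib) (ipZr ib) mulrA.
Qed.

Lemma quad_upper (B : 'I_m -> 'I_m -> R) (k : R) (v : 'rV[R]_m) :
  (\sum_i \sum_j `|B i j| <= k) ->
  `|\sum_i \sum_j v 0 i * v 0 j * B i j| <= k * `|v| ^+ 2.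
Proof.
move=> Bk; rewrite (le_trans (ler_norm_sum _ _ _))//.
apply: (@le_trans _ _ ((\sum_i \sum_j `|B i j|) * `|v| ^+ 2)); last first.
  by rewrite ler_wpM2r// sqr_ge0.
rewrite mulr_suml; apply: ler_sum => i _; rewrite mulr_suml.
rewrite (le_trans (ler_norm_sum _ _ _))//; apply: ler_sum => j _.
rewrite !normrM mulrC ler_wpM2l// expr2.
by apply: ler_pM => //; exact: rv_coord_le.
Qed.

(** The quadratic form has a positive minimum on the unit sphere, which is
compact. *)
Lemma ip_lower b : is_inner_product b ->
  exists2 k : R, 0 < k & forall v, k * `|v| ^+ 2 <= b v v.
Proof.
move=> ib; pose A := [set v : 'rV[R]_m | `|v| = 1].
have [[v0 Av0]|noA] := pselect (A !=set0); last first.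
  exists 1 => // v; have [->|v0] := eqVneq v 0.
    by rewrite (ip0l ib) normr0 expr2 !mulr0.
  case: noA; exists (`|v|^-1 *: v); rewrite /A/= normrZ normfV normr_id mulVf//.
  by rewrite normr_eq0.
have qc : continuous (fun v : 'rV[R]_m => b v v).
  rewrite (_ : (fun v => b v v) = (fun v : 'rV[R]_m => \sum_i \sum_j v 0 i * v 0 j * b (delta_mx 0 i) (delta_mx 0 j))); last first.
    by apply/funext => v; exact: ip_coord.
  move=> v; apply: continuous_at_sum => i; apply: continuous_at_sum => j.
  apply: continuousM; last exact: cst_continuous.
  by apply: continuousM; exact: coord_continuous.
have Ac : compact A.
  apply: bounded_closed_compact.
    by exists 1; split=> // x x1 v /= ->; exact: ltW.
  rewrite (_ : A = (fun v : 'rV[R]_m => `|v|) @^-1` [set 1])//.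
  by apply: closed_comp => [v _|]; [exact: norm_continuous|exact: closed_eq].
have [w Aw wmin] := EVT_min_rV (ex_intro _ v0 Av0) Ac (continuous_subspaceT qc).
have w0 : w != 0 by rewrite -normr_gt0 (set_mem Aw : `|w| = 1).
exists (b w w); first exact: (ip_pos ib).
move=> v; have [->|v0'] := eqVneq v 0; first by rewrite normr0 (ip0l ib) expr2 !mulr0.
have nv : 0 < `|v| by rewrite normr_gt0.
have Av : A (`|v|^-1 *: v) by rewrite /A/= normrZ normfV normr_id mulVf ?gt_eqF.
have := wmin _ (mem_set Av); rewrite (ipZl ib) (ipZr ib) => H.
rewrite -ler_pdivlMr ?exprn_gt0//; apply: le_trans H _.
by rewrite mulrA -expr2 exprVn mulrC.
Qed.
End RowInnerProduct.

Section CompactInd.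
Variable T : topologicalType.
(** Otherwise the complements of the sets that satisfy [P] form a proper
filter, which has no cluster point because [P] holds locally. *)
Lemma compact_ind (P : set T -> Prop) : compact [set: T] ->
  (forall A B : set T, A `<=` B -> P B -> P A) -> P set0 ->
  (forall A B, P A -> P B -> P (A `|` B)) ->
  (forall x : T, exists2 U : set T, nbhs x U & P U) -> P setT.
Proof.
move=> cT Psub P0 PU Ploc; apply: contrapT => PT.
pose F : set_system T := [set A | P (~` A)].
have FF : ProperFilter F.
  split; first by rewrite /F /= setC0.
  split.
  - by rewrite /F /= setCT.
  - by move=> A B; rewrite /F /= setCI; exact: PU.
  - by move=> A B AB; rewrite /F /=; apply: Psub; exact: subsetC.
have [|x [_ clx]] := cT F FF; first by rewrite /F /= setCT.
have [U xU PU'] := Ploc x.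
have FU : F (~` U) by rewrite /F /= setCK.
by have [y []] := clx _ _ FU xU.
Qed.
End CompactInd.

Lemma quad_perturb (R : realType) (q q0 k K n : R) : 0 <= k -> 0 <= n ->
  `|q - q0| <= k / 2 * n -> k * n <= q0 -> q0 <= (K - k) * n ->
  k / 2 * n <= q /\ q <= K * n.
Proof.
move=> k0 n0; have := mulr_ge0 k0 n0; rewrite ler_norml => kn /andP[h1 h2] h3 h4.
by split; lra.
Qed.

Lemma sqrt_lower (R : realType) (k n q : R) : 0 < k -> 0 <= n ->
  k / 2 * n ^+ 2 <= q -> n <= Num.sqrt (2 / k) * Num.sqrt q.
Proof.
move=> k0 n0 h; rewrite -sqrtrM ?divr_ge0 ?(ltW k0)//.
rewrite -{1}(ger0_norm n0) -sqrtr_sqr; apply: ler_wsqrtr.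
rewrite mulrAC ler_pdivlMr//; move: h; lra.
Qed.

Lemma sqrt_upper (R : realType) (K n q : R) : 0 <= K -> 0 <= n ->
  q <= K * n ^+ 2 -> Num.sqrt q <= Num.sqrt K * n.
Proof.
move=> K0 n0 h; rewrite -{1}(ger0_norm n0) -sqrtr_sqr -sqrtrM//.
exact: ler_wsqrtr.
Qed.

Section MetricBounds.
Variables (R : realType) (M : topologicalType) (m : nat).
Variable S : smooth_structure R M m.
Variable g : riemannian_metric S.

Lemma chart_vec_linear (c : chart R M m) u a v w :
  chart_vec S c u (a *: v + w) = a *: chart_vec S c u v + chart_vec S c u w.
Proof. exact: linearP. Qed.

Lemma chart_vec_surj c u (w : 'rV[R]_m) : atlas S c -> ccod c u ->
  exists v, w = chart_vec S c u v.
Proof.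
move=> cS cu; pose c' := chart_at S (cbwd c u).
have c'S : atlas S c' by exact: chart_at_atlas.
have c'd : cdom c' (cbwd c u) by exact: chart_at_dom.
have E : cbwd c' (cfwd c' (cbwd c u)) = cbwd c u by exact: cfwdK.
have c'u : ccod c' (cfwd c' (cbwd c u)) by exact: cfwd_cod.
have sid := strict_map_id S.
have E2 : cfwd c (id (cbwd c' (cfwd c' (cbwd c u)))) = u.
  by rewrite E; exact: cbwdK.
have cd : cdom c (id (cbwd c' (cfwd c' (cbwd c u)))).
  by rewrite E; exact: cbwd_dom.
move: (@chart_chain _ _ _ S _ (cfwd c') id c' c _ sid c'S cS c'u cd).
rewrite E2 => H; have [_ d1] := H (sid.2 _ _ cS c'S _ cu c'd).
exists ('d (cfwd c \o id \o cbwd c') (cfwd c' (cbwd c u)) w).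
apply: etrans (esym (diff_chart_id w c'u)) _.
exact: (congr1 (@^~ w) d1).
Qed.

Lemma gram_ip c u : atlas S c -> ccod c u -> is_inner_product
  (fun v w => g (cbwd c u) (chart_vec S c u v) (chart_vec S c u w)).
Proof.
move=> cS cu; have ig := rmetric_ip g (cbwd c u); split.
- by move=> v w; exact: ip_sym.
- by move=> a v v' w; rewrite chart_vec_linear (ip_lin ig).
- move=> v v0; apply: (ip_pos ig); apply: contra_neq v0.
  exact: chart_vec_inj.
Qed.

(** The Gram matrix of the metric in a chart depends continuously on the
point, so near [u0] the quadratic form is bounded below by half of the definite
lower bound that it satisfies at [u0]. *)
Lemma metric_local c u0 : atlas S c -> ccod c u0 ->
  exists k : R, 0 < k /\ \forall u \near u0, ccod c u /\ forall v,
    `|v| <= k * ip_norm (g (cbwd c u)) (chart_vec S c u v) /\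
    ip_norm (g (cbwd c u)) (chart_vec S c u v) <= k * `|v|.
Proof.
move=> cS cu0.
pose G u v w : R := g (cbwd c u) (chart_vec S c u v) (chart_vec S c u w).
pose e i : 'rV[R]_m := delta_mx 0 i.
have [k0 k00 hk0] := ip_lower (gram_ip cS cu0).
have Gc i j : {for u0, continuous (fun u => G u (e i) (e j))}.
  apply: differentiable_continuous.
  have sm := rmetric_smooth g cS (e i) (e j); exact: (sm [::] _ cu0).
pose D u := \sum_i \sum_j `|G u (e i) (e j) - G u0 (e i) (e j)|.
have Dc : {for u0, continuous D}.
  apply: continuous_at_sum => i; apply: continuous_at_sum => j.
  apply: (@continuous_comp _ _ _ (fun u => G u (e i) (e j) - G u0 (e i) (e j)) (fun r : R => `|r|)).
    by apply: continuousB; [exact: Gc|exact: cst_continuous].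
  exact: norm_continuous.
have D0 : D u0 = 0.
  by rewrite /D big1// => i _; rewrite big1// => j _; rewrite subrr normr0.
have Dsmall : \forall u \near u0, D u <= k0 / 2.
  have k2 : 0 < k0 / 2 by rewrite divr_gt0.
  have /cvgrPdist_le/(_ _ k2) := Dc; apply: filterS => u; rewrite D0 sub0r normrN.
  exact: le_trans (ler_norm _).
pose K := \sum_i \sum_j `|G u0 (e i) (e j)| + k0.
have K0 : 0 <= \sum_i \sum_j `|G u0 (e i) (e j)|.
  by apply: sumr_ge0 => i _; apply: sumr_ge0.
have Kp : 0 < K by rewrite ltr_wpDl.
have main u : ccod c u -> D u <= k0 / 2 -> forall v,
    k0 / 2 * `|v| ^+ 2 <= G u v v /\ G u v v <= K * `|v| ^+ 2.
  move=> cu Du v.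
  have iu := gram_ip cS cu; have iu0 := gram_ip cS cu0.
  have E : G u v v - G u0 v v =
      \sum_i \sum_j v 0 i * v 0 j * (G u (e i) (e j) - G u0 (e i) (e j)).
    rewrite /G (ip_coord v v iu) (ip_coord v v iu0) -sumrB; apply: eq_bigr => i _.
    by rewrite -sumrB; apply: eq_bigr => j _; rewrite mulrBr.
  have := quad_upper v Du; rewrite -E => H1.
  have := hk0 v; rewrite -/(G u0 v v) => H2.
  have H3 : G u0 v v <= (K - k0) * `|v| ^+ 2.
    rewrite /K addrK /G (ip_coord v v iu0); apply: le_trans (ler_norm _) _.
    exact: quad_upper.
  exact: quad_perturb (ltW k00) (sqr_ge0 _) H1 H2 H3.
exists (Num.sqrt (2 / k0) + Num.sqrt K); split.
  by rewrite addr_gt0// sqrtr_gt0// divr_gt0.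
have : \forall u \near u0, ccod c u.
  by apply: open_nbhs_nbhs; split=> //; exact: ccod_open.
apply: filterS2 Dsmall => u Du cu; split=> // v.
have [lo up] := main _ cu Du v; rewrite /ip_norm -/(G u v v).
have Gge : 0 <= G u v v by apply: le_trans lo; rewrite mulr_ge0 ?sqr_ge0// divr_ge0// ltW.
split; rewrite mulrDl.
  apply: (le_trans (sqrt_lower k00 (normr_ge0 v) lo)).
  by rewrite lerDl mulr_ge0 ?sqrtr_ge0.
apply: (le_trans (sqrt_upper (ltW Kp) (normr_ge0 v) up)).
by rewrite lerDr mulr_ge0 ?sqrtr_ge0.
Qed.

Lemma lip_diff_bound (V W : normedModType R) (h : V -> W) u k r :
  0 < r -> strict_diff h u -> (forall w, `|w - u| < r -> `|h w - h u| <= k * `|w - u|) ->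
  forall v, `|'d h u v| <= k * `|v|.
Proof.
move=> r0 hu hk v; apply/ler_addgt0Pr => e e0.
have [->|v0] := eqVneq v 0; first by rewrite linear0 !normr0 mulr0 add0r ltW.
have nv : 0 < `|v| by rewrite normr_gt0.
have e1 : 0 < e / `|v| by rewrite divr_gt0.
have [s s0 hs] := hu.2 _ e1.
pose t := Num.min r s / 2 / `|v|.
have t0 : 0 < t by rewrite !divr_gt0// lt_min r0.
have tv : `|t *: v| < Num.min r s.
  rewrite normrZ gtr0_norm// /t divfK ?gt_eqF// ltr_pdivrMr// ltr_pMr ?ltr1n//.
  by rewrite lt_min r0.
have [tr ts] : `|t *: v| < r /\ `|t *: v| < s by move: tv; rewrite lt_min => /andP.
have E : u + t *: v - u = t *: v by rewrite addrAC subrr add0r.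
have := hk (u + t *: v); rewrite E => /(_ tr) H1.
have := hs (u + t *: v) u; rewrite E subrr normr0 => /(_ ts s0) H2.
have E2 : 'd h u (t *: v) = t *: 'd h u v by exact: linearZ.
have tvE (W' : normedModType R) (w : W') : `|t *: w| = t * `|w|.
  by rewrite normrZ gtr0_norm.
rewrite -(ler_pM2l t0) -tvE -E2.
rewrite tvE in H1; rewrite tvE mulrCA divfK ?gt_eqF// in H2.
have := ler_normB (h (u + t *: v) - h u) (h (u + t *: v) - h u - 'd h u (t *: v)).
rewrite opprB addrC subrK => /le_trans; apply.
by rewrite mulrDr lerD// mulrCA.
Qed.

(** Strict differentiability at [x0] makes [psi] Lipschitz near [x0] in
the chart, which bounds the differentials at all nearby points; compactness does
the rest. *)
Lemma fun_diff_bound psi : compact [set: M] -> strict_fun S psi ->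
  exists2 K : R, 0 < K & forall x v, `|fun_diff S psi x v| <= K * ip_norm (g x) v.
Proof.
move=> cM ps.
pose P (A : set M) := exists2 K : R, 0 < K & forall x v, A x -> `|fun_diff S psi x v| <= K * ip_norm (g x) v.
suff [K K0 hK] : P setT by exists K => // x v; exact: hK.
apply: compact_ind => //.
- by move=> A B AB [K K0 hK]; exists K => // x v /AB; exact: hK.
- by exists 1.
- move=> A B [K K0 hK] [L L0 hL]; exists (K + L); first exact: addr_gt0.
  move=> x v [/hK|/hL]/(_ v)/le_trans; apply; rewrite mulrDl.
    by rewrite lerDl mulr_ge0 ?(ltW L0) ?ip_norm_ge0.
  by rewrite lerDr mulr_ge0 ?(ltW K0) ?ip_norm_ge0.
move=> x0; pose c := chart_at S x0; pose u0 := cfwd c x0.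
have cS : atlas S c by exact: chart_at_atlas.
have cx0 : cdom c x0 by exact: chart_at_dom.
have cu0 : ccod c u0 by exact: cfwd_cod.
have [k [k0 hk]] := metric_local cS cu0.
have [s0 _] := strict_fun_chart ps cS cu0.
have [L [r [L0 r0 hL]]] := strict_diff_lip s0.
have near_u : \forall u \near u0, ccod c u /\ forall v, `|fun_diff S psi (cbwd c u) v| <= L * k * ip_norm (g (cbwd c u)) v.
  have : \forall u \near u0, `|u - u0| < r by exact: near_norm.
  apply: filterS2 hk => u [cu hu] ur; split=> // v'.
  have [v ->] := chart_vec_surj v' cS cu.
  have [su du] := strict_fun_chart ps cS cu.
  rewrite -du -mulrA; apply: (@le_trans _ _ (L * `|v|)); last first.
    by rewrite ler_pM2l//; exact: (hu v).1.
  apply: (@lip_diff_bound _ _ _ _ _ (r - `|u - u0|)) => //.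
    by rewrite subr_gt0.
  move=> w wr; apply: hL => //.
  rewrite -[w](subrK u) -addrA (le_lt_trans (ler_normD _ _))//.
  by rewrite -ltrBrDr.
exists [set x | cdom c x /\ forall v, `|fun_diff S psi x v| <= L * k * ip_norm (g x) v]; last first.
  by exists (L * k); [exact: mulr_gt0|move=> x v [_]; exact].
have cx : \forall x \near x0, cdom c x by apply: open_nbhs_nbhs; split=> //; exact: cdom_open.
have : \forall x \near x0, (fun u => ccod c u /\ forall v, `|fun_diff S psi (cbwd c u) v| <= L * k * ip_norm (g (cbwd c u)) v) (cfwd c x).
  exact: (cfwd_continuous cx0 near_u).
by apply: filterS2 cx => x cx [_]; rewrite cfwdK.
Qed.

End MetricBounds.

(** * Bump functions *)

Section Bump.
Variable R : realType.

Lemma pos_part_lip (u u' : R) : `|Num.max 0 u - Num.max 0 u'| <= `|u - u'|.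
Proof.
have h1 := ler_norm (u - u'); have := ler_norm (u' - u); rewrite distrC => h2.
have [a|a] := leP 0 u; have [b|b] := leP 0 u'; rewrite ler_norml; lra.
Qed.

Lemma strict_diff_cst (V W : normedModType R) (w : W) (x : V) : strict_diff (fun _ => w) x.
Proof.
pose L : {linear V -> W} := \0.
have Lc : continuous L by move=> y; exact: cvg_cst.
have [|//] := @strict_diffI R V W (fun _ => w) x L Lc.
by move=> e e0; exists 1 => // u u' _ _; rewrite /= !subrr normr0 mulr_ge0// ltW.
Qed.

(** The square makes the positive part differentiable at 0, so that
bumps can be polynomial inside their support. *)
Lemma strict_diff_sqpos (t0 : R) :
  strict_diff (fun t : R => (Num.max 0 t) ^+ 2) t0 /\
  forall v, 'd (fun t : R => (Num.max 0 t) ^+ 2) t0 v = 2 * Num.max 0 t0 * v.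
Proof.
pose k := 2 * Num.max 0 t0.
have k_lin : linear (fun v : R => k * v : R).
  by move=> a y z; rewrite mulrDr /GRing.scale /= mulrCA.
pose kM := GRing.isLinear.Build _ _ _ _ _ k_lin.
pose kL : {linear R -> R} := HB.pack (fun v : R => k * v : R) kM.
have kc : continuous kL by move=> x; exact: mulrl_continuous.
suff H : strict_estimate (fun t : R => (Num.max 0 t) ^+ 2) t0 kL.
  have [s1 d1] := strict_diffI kc H; split=> // v.
  exact: (congr1 (@^~ v) d1).
move=> e e0; have [t00|t00] := ltP 0 t0.
  exists (Num.min t0 (e / 2)); first by rewrite lt_min t00 divr_gt0.
  move=> u u'; rewrite !lt_min => /andP[u1 u2] /andP[u'1 u'2].
  have up : 0 < u by move: u1; rewrite ltr_norml; lra.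
  have u'p : 0 < u' by move: u'1; rewrite ltr_norml; lra.
  rewrite /kL/= /k !max_r ?(ltW up) ?(ltW u'p) ?(ltW t00)//.
  have -> : u ^+ 2 - u' ^+ 2 - 2 * t0 * (u - u') = ((u - t0) + (u' - t0)) * (u - u') by ring.
  rewrite normrM ler_wpM2r//; move: u2 u'2; rewrite !ltr_norml ler_norml; lra.
exists (e / 2); first by rewrite divr_gt0.
move=> u u' u2 u'2; rewrite /kL/= /k (max_l t00) mulr0 mul0r subr0 subr_sqr.
have pos w : `|w - t0| < e / 2 -> 0 <= Num.max 0 w <= e / 2.
  rewrite ltr_norml => /andP[_ w2]; rewrite le_max lexx /= ge_max; lra.
have /andP[p1 p2] := pos _ u2; have /andP[p3 p4] := pos _ u'2.
rewrite normrM mulrC; apply: ler_pM => //.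
  by rewrite ger0_norm ?addr_ge0//; lra.
exact: pos_part_lip.
Qed.

Variable m : nat.
Implicit Types a u : 'rV[R]_m.

(** The norm of row vectors is the sup norm, which is not differentiable; its
Euclidean counterpart is. *)
Definition qdist a u : R := \sum_i (u 0 i - a 0 i) ^+ 2.

Lemma strict_diff_qdist a x : strict_diff (qdist a) x /\
  forall v, 'd (qdist a) x v = \sum_i 2 * (x 0 i - a 0 i) * v 0 i.
Proof.
pose L0 (v : 'rV[R]_m) : R := \sum_i 2 * (x 0 i - a 0 i) * v 0 i.
have k_lin : linear L0.
  move=> k y z; rewrite /L0 /GRing.scale /= mulr_sumr -big_split/=; apply: eq_bigr => i _.
  by rewrite !mxE mulrDr mulrCA.
pose kM := GRing.isLinear.Build _ _ _ _ _ k_lin.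
pose kL : {linear 'rV[R]_m -> R} := HB.pack L0 kM.
have kc : continuous kL.
  move=> v; apply: continuous_at_sum => i.
  by apply: continuousM; [exact: cst_continuous|exact: coord_continuous].
suff H : strict_estimate (qdist a) x kL.
  have [s1 d1] := strict_diffI kc H; split=> // v.
  exact: (congr1 (@^~ v) d1).
move=> e e0; pose r := e / (2 * (m%:R + 1)).
have m1 : 0 < 2 * (m%:R + 1) :> R by rewrite mulr_gt0// ltr_wpDl.
exists r; first by rewrite divr_gt0.
move=> u u' ur u'r.
have -> : qdist a u - qdist a u' - kL (u - u') =
    \sum_i ((u - x) 0 i + (u' - x) 0 i) * (u - u') 0 i.
  rewrite /qdist /kL/= /L0 -!sumrB; apply: eq_bigr => i _; rewrite !mxE; ring.
rewrite (le_trans (ler_norm_sum _ _ _))//.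
apply: (@le_trans _ _ (\sum_(i < m) (2 * r) * `|u - u'|)).
  apply: ler_sum => i _; rewrite normrM; apply: ler_pM => //; last exact: rv_coord_le.
  rewrite (le_trans (ler_normD _ _))// mulr_natl mulr2n.
  by rewrite lerD// ltW//; apply: le_lt_trans (rv_coord_le _ _) _.
rewrite sumr_const card_ord -[leLHS]mulr_natl mulrA ler_wpM2r//.
have -> : e = (m%:R + 1) * (2 * r) by rewrite /r; field; rewrite gt_eqF// ltr_wpDl.
by rewrite ler_wpM2r ?lerDl// mulr_ge0// ltW// divr_gt0.
Qed.

Definition bump a (rho : R) u : R := (Num.max 0 (rho ^+ 2 - qdist a u)) ^+ 2.

Lemma strict_diff_bump a rho x : strict_diff (bump a rho) x /\
  forall v, 'd (bump a rho) x v =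
   - (2 * Num.max 0 (rho ^+ 2 - qdist a x) * \sum_i 2 * (x 0 i - a 0 i) * v 0 i).
Proof.
have [sq dq] := strict_diff_qdist a x.
pose p u := rho ^+ 2 - qdist a u.
have [sp dp] : strict_diff p x /\ 'd p x = (\- 'd (qdist a) x) :> ('rV[R]_m -> R).
  pose nL : {linear 'rV[R]_m -> R} := (\- ('d (qdist a) x : {linear 'rV[R]_m -> R})).
  apply: (@strict_diffI _ _ _ p x nL).
    move=> v; apply: continuousN; exact: (diff_continuous sq.1).
  move=> e e0; have [r r0 hr] := sq.2 _ e0; exists r => // u u' ur u'r.
  have := hr _ _ ur u'r; rewrite -normrN; congr (`| _ | <= _).
  rewrite /p /nL /=; ring.
have [sc dc] := strict_diff_comp sp (strict_diff_sqpos (p x)).1.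
split=> // v.
apply: etrans (congr1 (@^~ v) dc) _.
rewrite [LHS]/= (strict_diff_sqpos (p x)).2.
rewrite [X in _ * X](_ : _ = - \sum_i 2 * (x 0 i - a 0 i) * v 0 i) ?mulrN//.
by apply: etrans (congr1 (@^~ v) dp) _; congr (- _); exact: dq.
Qed.

Lemma bump_supp a rho u : 0 < rho -> bump a rho u != 0 -> `|u - a| < rho.
Proof.
move=> rho0; rewrite /bump sqrf_eq0; have [|qr] := leP (rho ^+ 2) (qdist a u).
  by rewrite -subr_le0 => /max_l ->; rewrite eqxx.
move=> _; have q0 : 0 <= qdist a u by apply: sumr_ge0 => i _; exact: sqr_ge0.
apply: (@le_lt_trans _ _ (Num.sqrt (qdist a u))).
  apply: rv_norm_le => [|i]; first exact: sqrtr_ge0.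
  rewrite -sqrtr_sqr; apply: ler_wsqrtr; rewrite !mxE /qdist (bigD1 i)//= lerDl.
  by apply: sumr_ge0 => j _; exact: sqr_ge0.
by rewrite -(ltr_sqrt _ (exprn_gt0 2 rho0)) sqrtr_sqr gtr0_norm// in qr.
Qed.

Lemma bump_ge0 a rho u : 0 <= bump a rho u. Proof. exact: sqr_ge0. Qed.

Lemma bump_le a rho u : bump a rho u <= rho ^+ 4.
Proof.
rewrite /bump -[4%N]/(2 * 2)%N exprM ler_sqr ?nnegrE ?sqr_ge0 ?le_max ?lexx//.
rewrite ge_max sqr_ge0/= lerBlDr lerDl; apply: sumr_ge0 => i _; exact: sqr_ge0.
Qed.

Lemma bump_center a rho : 0 < rho -> 0 < bump a rho a.
Proof.
move=> rho0; rewrite /bump /qdist big1 ?subr0; last by move=> i _; rewrite subrr expr2 mulr0.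
by rewrite max_r ?sqr_ge0// exprn_gt0// exprn_gt0.
Qed.

End Bump.

Section BumpM.
Variables (R : realType) (M : topologicalType) (m : nat).
Variable S : smooth_structure R M m.
Hypothesis hM : hausdorff_space M.

Definition manifold_bump (c : chart R M m) (a : 'rV[R]_m) (rho : R) (y : M) : R :=
  if `[< cdom c y >] then bump a rho (cfwd c y) else 0.

Lemma manifold_bump_cbwd c a rho u : ccod c u -> manifold_bump c a rho (cbwd c u) = bump a rho u.
Proof. by move=> cu; rewrite /manifold_bump asboolT ?cbwdK//; exact: cbwd_dom. Qed.

Lemma manifold_bump_supp c a rho y : 0 < rho -> manifold_bump c a rho y != 0 ->
  cdom c y /\ `|cfwd c y - a| < rho.
Proof.
move=> rho0; rewrite /manifold_bump; case: asboolP => [cy|_]; last by rewrite eqxx.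
by move/(bump_supp rho0).
Qed.

(** The image in [M] of the closed ball is compact, hence
closed because [M] is Hausdorff, so the extension by 0 vanishes near the points
outside of the domain of [c]. *)
Lemma strict_fun_manifold_bump c a rho : atlas S c -> 0 < rho ->
  (forall u, `|u - a| <= rho -> ccod c u) -> strict_fun S (manifold_bump c a rho).
Proof.
move=> cS rho0 ball_cod x.
pose c' := chart_at S x.
have c'S : atlas S c' by exact: chart_at_atlas.
have c'x : cdom c' x by exact: chart_at_dom.
have c'u : ccod c' (cfwd c' x) by exact: cfwd_cod.
have E : cbwd c' (cfwd c' x) = x by exact: cfwdK.
have bc : {for cfwd c' x, continuous (cbwd c')} by exact: cbwd_continuous.
have [cx|ncx] := pselect (cdom c x).
  have s1 : strict_diff (cfwd c \o cbwd c') (cfwd c' x).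
    by apply: ((strict_map_id S).2 _ _ c'S cS _ c'u); rewrite E.
  have [s2 _] := strict_diff_comp s1 (strict_diff_bump a rho _).1.
  have N : \forall u \near cfwd c' x, (bump a rho \o (cfwd c \o cbwd c')) u = (manifold_bump c a rho \o cbwd c') u.
    have : \forall u \near cfwd c' x, cdom c (cbwd c' u).
      by apply: (near_in_chart bc); rewrite E.
    by apply: filterS => u cu /=; rewrite /manifold_bump asboolT.
  by have [] := strict_diff_near N s2.
pose K := cbwd c @` [set u | `|u - a| <= rho].
have Kcl : closed K.
  apply: (compact_closed hM); apply: continuous_compact.
    apply: continuous_in_subspaceT => u; rewrite inE /= => ua.
    by apply: cbwd_continuous; exact: ball_cod.
  apply: bounded_closed_compact.
    exists (rho + `|a|); split; first exact: num_real.
    move=> k kr u /= ua; apply: ltW; apply: le_lt_trans kr.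
    by rewrite -[u](subrK a) (le_trans (ler_normD _ _))// lerD2r.
  rewrite (_ : [set u | _] = (fun u : 'rV[R]_m => `|u - a|) @^-1` [set t | t <= rho])//.
  apply: closed_comp => [u _|]; last exact: closed_le.
  apply: (@continuous_comp _ _ _ (fun u : 'rV[R]_m => u - a) (fun v : 'rV[R]_m => `|v|)).
    by apply: continuousB; [exact: cvg_id|exact: cst_continuous].
  exact: norm_continuous.
have xK : ~ K x.
  by move=> [u /= ua ux]; apply: ncx; rewrite -ux; apply: cbwd_dom; exact: ball_cod.
have N : \forall u \near cfwd c' x, (fun _ => 0 : R) u = (manifold_bump c a rho \o cbwd c') u.
  have : \forall u \near cfwd c' x, ~ K (cbwd c' u).
    have xN : nbhs (cbwd c' (cfwd c' x)) (~` K).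
      by rewrite E; apply: open_nbhs_nbhs; split=> //; exact: closed_openC.
    exact: (bc _ xN).
  apply: filterS => u uK /=; apply/esym/eqP; apply: contra_notT uK => /(manifold_bump_supp rho0)[cu ur].
  by exists (cfwd c (cbwd c' u)) => /=; [exact: ltW|exact: cfwdK].
have s0 : strict_diff (fun _ : 'rV[R]_m => 0 : R) (cfwd c' x).
  exact: strict_diff_cst.
by have [] := strict_diff_near N s0.
Qed.

End BumpM.

(** * Separating families and Lipschitz functions *)

Section Radius.
Variable R : realType.
Lemma common_radius (I : finType) (P : I -> R -> Prop) :
  (forall i r r', P i r -> r' <= r -> P i r') ->
  (forall i, exists2 r : R, 0 < r & P i r) ->
  exists2 r : R, 0 < r & forall i, P i r.
Proof.
move=> Pmono Pex; have Pex' i : exists s, 0 < s /\ P i s by have [s s0 Ps] := Pex i; exists s.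
have [r hr] := choice Pex'.
exists (\big[Num.min/1]_i r i).
  apply: (big_ind (fun a : R => 0 < a)) => [|a b a0 b0|i _].
  - exact: ltr01.
  - by rewrite lt_min a0.
  - exact: (hr i).1.
move=> i; apply: Pmono (hr i).2 _; exact: bigmin_le.
Qed.

(** The increment of [h i] along [t *: v] is [t] times its differential, up
to an error small with respect to [t]. *)
Lemma diff_lower (V : normedModType R) (I : finType) (h : I -> V -> R) u C r :
  0 <= C -> 0 < r -> (forall i, strict_diff (h i) u) ->
  (forall w, `|w - u| < r -> `|w - u| <= C * \sum_i `|h i w - h i u|) ->
  forall v, `|v| <= C * \sum_i `|'d (h i) u v|.
Proof.
move=> C0 r0 hs hC v; apply/ler_addgt0Pr => e e0.
pose n : R := #|I|%:R.
have n0 : 0 <= n by exact: ler0n.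
pose e1 := e / ((C + 1) * (n + 1) * (`|v| + 1)).
have den0 : 0 < (C + 1) * (n + 1) * (`|v| + 1).
  by rewrite !mulr_gt0// ltr_wpDl.
have e10 : 0 < e1 by rewrite divr_gt0.
have [s s0 hr] : exists2 s, 0 < s & forall i, forall w, `|w - u| < s ->
    `|h i w - h i u - 'd (h i) u (w - u)| <= e1 * `|w - u|.
  apply: common_radius.
    by move=> i a b Pa ba w wb; apply: Pa; exact: lt_le_trans ba.
  move=> i; have [s s0 hi] := (hs i).2 _ e10; exists s => // w ws.
  by apply: hi => //; rewrite subrr normr0.
pose t := Num.min r s / 2 / (`|v| + 1).
have v1 : 0 < `|v| + 1 by rewrite ltr_wpDl.
have t0 : 0 < t by rewrite !divr_gt0// lt_min r0.
have tvE (W' : normedModType R) (w : W') : `|t *: w| = t * `|w|.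
  by rewrite normrZ gtr0_norm.
have tv : `|t *: v| < Num.min r s.
  rewrite tvE /t mulrAC -mulrA; have minp : 0 < Num.min r s by rewrite lt_min r0.
  apply: (@le_lt_trans _ _ (Num.min r s / 2 * 1)).
    rewrite -mulrA [X in _ <= X]mulrA ler_wpM2l ?divr_ge0 ?(ltW minp)//.
    by rewrite ler_pdivrMr// mul1r lerDl.
  by rewrite mulr1 ltr_pdivrMr// ltr_pMr ?ltr1n.
have [tr ts] : `|t *: v| < r /\ `|t *: v| < s by move: tv; rewrite lt_min => /andP.
have E : u + t *: v - u = t *: v by rewrite addrAC subrr add0r.
have := hC (u + t *: v); rewrite E => /(_ tr) H.
have Hi i : `|h i (u + t *: v) - h i u| <= t * (`|'d (h i) u v| + e1 * `|v|).
  have := hr i (u + t *: v); rewrite E => /(_ ts) Hi.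
  have E2 : 'd (h i) u (t *: v) = t *: 'd (h i) u v by exact: linearZ.
  rewrite tvE E2 in Hi.
  rewrite -[h i _ - _](subrK (t *: 'd (h i) u v)) (le_trans (ler_normD _ _))// tvE.
  by rewrite mulrDr addrC lerD// mulrCA.
rewrite -(ler_pM2l t0) -tvE; apply: (le_trans H).
apply: (@le_trans _ _ (C * \sum_i t * (`|'d (h i) u v| + e1 * `|v|))).
  by rewrite ler_wpM2l//; apply: ler_sum => i _.
rewrite -mulr_sumr mulrCA ler_pM2l// big_split/= mulrDr lerD2l.
rewrite sumr_const -[_ *+ _]mulr_natl -/n.
have -> : C * (n * (e1 * `|v|)) = e * (C * n * `|v| / ((C + 1) * (n + 1) * (`|v| + 1))).
  by rewrite /e1; field; rewrite !gt_eqF// ltr_wpDl.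
rewrite ger_pMr// ler_pdivrMr// mul1r.
by apply: ler_pM; rewrite ?mulr_ge0//; [apply: ler_pM => //; rewrite lerDl|rewrite lerDl].
Qed.
End Radius.

Section Separating.
Variables (R : realType) (M : topologicalType) (m : nat).
Variable S : smooth_structure R M m.
Variable g : riemannian_metric S.
Hypotheses (hM : hausdorff_space M) (cM : compact [set: M]).

(** For a separating family this is a distance at small scales, which replaces
the Riemannian distance in the proof of expansivity; [sep_norm] is its
infinitesimal form. *)
Definition sep_dist (I : finType) (Psi : I -> M -> R) x y :=
  \sum_i `|Psi i x - Psi i y|.
Definition sep_norm (I : finType) (Psi : I -> M -> R) x v :=
  \sum_i `|fun_diff S (Psi i) x v|.

Lemma chart_ball (c : chart R M m) u0 : ccod c u0 ->
  exists2 s : R, 0 < s & forall u, `|u - u0| <= s -> ccod c u.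
Proof.
move=> cu0; have : nbhs u0 (ccod c).
  by apply: open_nbhs_nbhs; split=> //; exact: ccod_open.
move/nbhs_ballP => [s /= s0 hs]; exists (s / 2); first by rewrite divr_gt0.
move=> u us; apply: hs; rewrite -ball_normE /= distrC (le_lt_trans us)//.
by rewrite ltr_pdivrMr// ltr_pMr ?ltr1n.
Qed.

(** At [u0] the differential of the bump centred at [u0 + s e_j] is a fixed
multiple of the [j]-th coordinate form.  By strict differentiability the
increments of these [m] bumps control all the coordinates near [u0]. *)
Lemma sep_chart c u0 : atlas S c -> ccod c u0 ->
  exists (Psi : 'I_m -> M -> R) (C r : R),
  [/\ 0 < C, 0 < r, forall i, strict_fun S (Psi i),
      forall u, `|u - u0| < r -> ccod c u &
      forall u u', `|u - u0| < r -> `|u' - u0| < r ->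
        `|u - u'| <= C * sep_dist Psi (cbwd c u) (cbwd c u')].
Proof.
move=> cS cu0; have [s4 s40 hs4] := chart_ball cu0.
pose s := s4 / 4; have s0 : 0 < s by rewrite divr_gt0.
have s4E : s4 = 4 * s by rewrite /s; field.
pose a j : 'rV[R]_m := u0 + s *: delta_mx 0 j.
pose Psi j := manifold_bump c (a j) (2 * s).
(* the derivative of the [j]-th bump at [u0] in the direction [e_j]: the value of
   the positive part there is [(2 s)^2 - s^2] *)
pose k := 12 * s ^+ 3.
have k0 : 0 < k by rewrite mulr_gt0// exprn_gt0.
have aE j i : u0 0 i - a j 0 i = - s * (i == j)%:R.
  by rewrite /a !mxE eqxx /= opprD addrA subrr add0r mulNr.
have qE j : qdist (a j) u0 = s ^+ 2.
  rewrite /qdist (bigD1 j)//= aE eqxx mulr1 sqrrN big1 ?addr0// => i ij.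
  by rewrite aE (negbTE ij) mulr0 expr2 mulr0.
have dE j v : 'd (bump (a j) (2 * s)) u0 v = k * v 0 j.
  rewrite (strict_diff_bump _ _ _).2 qE max_r; last first.
    by rewrite exprMn -subr_ge0 subr0; have := sqr_ge0 s; lra.
  rewrite (bigD1 j)//= aE eqxx mulr1 big1 ?addr0 => [|i ij].
    rewrite /k; ring.
  by rewrite aE (negbTE ij) mulr0 mulr0 mul0r.
have k2 : 0 < k / 2 by rewrite divr_gt0.
have [r r0 hr] : exists2 r : R, 0 < r & forall j, forall u u', `|u - u0| < r -> `|u' - u0| < r ->
   `|bump (a j) (2 * s) u - bump (a j) (2 * s) u' - k * (u - u') 0 j| <= k / 2 * `|u - u'|.
  apply: common_radius.
    by move=> i p q Pp qp w w' wq w'q; apply: Pp; exact: lt_le_trans qp.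
  move=> j; have [p p0 hp] := (strict_diff_bump (a j) (2 * s) u0).1.2 _ k2.
  by exists p => // u u' up u'p; rewrite -dE; exact: hp.
have e_norm j : `|delta_mx 0 j : 'rV[R]_m| <= 1.
  by apply: rv_norm_le => // i; rewrite mxE; case: (_ && _); rewrite ?normr1 ?normr0.
have cods u : `|u - u0| < Num.min r s4 -> ccod c u.
  by rewrite lt_min => /andP[_ /ltW]; exact: hs4.
exists Psi, (2 / k), (Num.min r s4); split=> //.
- by rewrite divr_gt0.
- by rewrite lt_min r0.
- move=> j; apply: (strict_fun_manifold_bump hM) => //; first by rewrite mulr_gt0.
  move=> u ua; apply: hs4; rewrite s4E -[u](subrK (a j)) -addrA (le_trans (ler_normD _ _))//.
  have -> : a j - u0 = s *: delta_mx 0 j by rewrite /a addrAC subrr add0r.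
  rewrite normrZ (gtr0_norm s0); have := e_norm j; rewrite -(ler_pM2l s0) mulr1.
  by move: ua; lra.
move=> u u' us u's.
have cu := cods _ us; have cu' := cods _ u's.
move: us u's; rewrite !lt_min => /andP[us _] /andP[u's _].
set D := sep_dist _ _ _.
suff H : k * `|u - u'| <= D + k / 2 * `|u - u'|.
  by rewrite mulrAC ler_pdivlMr// mulrC; lra.
have D0 : 0 <= D by apply: sumr_ge0.
have P0 : 0 <= D + k / 2 * `|u - u'| by rewrite addr_ge0// mulr_ge0// ltW.
rewrite mulrC -ler_pdivlMr//; apply: rv_norm_le => [|j].
  by rewrite divr_ge0// ltW.
rewrite ler_pdivlMr// mulrC -[k in leLHS](gtr0_norm k0) -normrM.
have := hr j _ _ us u's; rewrite distrC => H.
rewrite -[X in `|X| <= _](subrK (bump (a j) (2 * s) u - bump (a j) (2 * s) u')).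
rewrite (le_trans (ler_normD _ _))// addrC lerD//.
rewrite /D /sep_dist (bigD1 j)//= /Psi !manifold_bump_cbwd// lerDl.
exact: sumr_ge0.
Qed.

(** Taking the union of two families adds their separation quantities, so
that the local families of [sep_chart] add up to a global one by
[compact_ind]. *)
Lemma sep_family : exists (I : finType) (Psi : I -> M -> R),
  [/\ forall i, strict_fun S (Psi i),
      exists2 C : R, 0 < C & forall x v, ip_norm (g x) v <= C * sep_norm Psi x v &
      forall x, exists2 U, nbhs (x : M) U &
        forall y y', U y -> U y' -> sep_dist Psi y y' = 0 -> y = y'].
Proof.
pose P (A : set M) := exists (I : finType) (Psi : I -> M -> R),
  [/\ forall i, strict_fun S (Psi i),
      exists2 C : R, 0 < C & forall x v, A x -> ip_norm (g x) v <= C * sep_norm Psi x v &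
      forall x, A x -> exists2 U, nbhs (x : M) U &
        forall y y', U y -> U y' -> sep_dist Psi y y' = 0 -> y = y'].
suff [I [Psi [H1 [C C0 H2] H3]]] : P setT.
  exists I, Psi; split=> //; first by exists C => // x v; exact: H2.
  by move=> x; exact: H3.
apply: compact_ind => //.
- move=> A B AB [I [Psi [H1 [C C0 H2] H3]]]; exists I, Psi; split=> //.
    by exists C => // x v /AB; exact: H2.
  by move=> x /AB; exact: H3.
- by exists void, (fun _ _ => 0); split=> //; exists 1.
- move=> A B [I [Psi [H1 [C C0 H2] H3]]] [J [Phi [K1 [L L0 K2] K3]]].
  pose Th (k : I + J) := match k with inl i => Psi i | inr j => Phi j end.
  have NE x v : sep_norm Th x v = sep_norm Psi x v + sep_norm Phi x v.
    by rewrite /sep_norm big_sumType.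
  have DE x v : sep_dist Th x v = sep_dist Psi x v + sep_dist Phi x v.
    by rewrite /sep_dist big_sumType.
  have Dge (I' : finType) (Ps : I' -> M -> R) x y : 0 <= sep_dist Ps x y.
    by apply: sumr_ge0.
  have Nge (I' : finType) (Ps : I' -> M -> R) x y : 0 <= sep_norm Ps x y.
    by apply: sumr_ge0.
  exists (I + J)%type, Th; split.
  + by case=> [i|j]; [exact: H1|exact: K1].
  + exists (C + L); first exact: addr_gt0.
    move=> x v ABx; rewrite NE mulrDl !mulrDr.
    have h1 := mulr_ge0 (ltW C0) (Nge _ Psi x v).
    have h2 := mulr_ge0 (ltW C0) (Nge _ Phi x v).
    have h3 := mulr_ge0 (ltW L0) (Nge _ Psi x v).
    have h4 := mulr_ge0 (ltW L0) (Nge _ Phi x v).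
    by case: ABx => [/H2|/K2] /(_ v); lra.
  + move=> x [/H3|/K3] [U xU hU]; exists U => // y y' Uy Uy'; rewrite DE => /eqP;
    by rewrite paddr_eq0// => /andP[/eqP h1 /eqP h2]; exact: hU.
move=> x0; pose c := chart_at S x0; pose u0 := cfwd c x0.
have cS : atlas S c by exact: chart_at_atlas.
have cx0 : cdom c x0 by exact: chart_at_dom.
have cu0 : ccod c u0 by exact: cfwd_cod.
have [k [k0 hk]] := metric_local g cS cu0.
have [Psi [C [r [C0 r0 Ps cod sep]]]] := sep_chart cS cu0.
pose U := [set x | cdom c x /\ `|cfwd c x - u0| < r /\ forall v, ip_norm (g x) v <= k * C * sep_norm Psi x v].
exists U.
  have near_u : \forall u \near u0, `|u - u0| < r /\ forall v, ip_norm (g (cbwd c u)) v <= k * C * sep_norm Psi (cbwd c u) v.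
    have : \forall u \near u0, `|u - u0| < r by exact: near_norm.
    apply: filterS2 hk => u [cu hu] ur; split=> // v'.
    have [v ->] := chart_vec_surj v' cS cu.
    apply: (le_trans (hu v).2); rewrite -mulrA ler_pM2l//.
    have -> : sep_norm Psi (cbwd c u) (chart_vec S c u v) = \sum_i `|'d (Psi i \o cbwd c) u v|.
      by apply: eq_bigr => i _; rewrite -(strict_fun_chart (Ps i) cS cu).2.
    apply: (@diff_lower _ _ _ (fun i => Psi i \o cbwd c) u C (r - `|u - u0|)) => //.
    - exact: ltW.
    - by rewrite subr_gt0.
    - by move=> i; exact: (strict_fun_chart (Ps i) cS cu).1.
    move=> w wr; apply: sep => //.
    rewrite -[w](subrK u) -addrA (le_lt_trans (ler_normD _ _))//.
    by rewrite -ltrBrDr.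
  have cx : \forall x \near x0, cdom c x by apply: open_nbhs_nbhs; split=> //; exact: cdom_open.
  have near_x : \forall x \near x0, (fun u => `|u - u0| < r /\ forall v, ip_norm (g (cbwd c u)) v <= k * C * sep_norm Psi (cbwd c u) v) (cfwd c x).
    exact: (cfwd_continuous cx0 near_u).
  apply: filterS (filterI cx near_x) => x [cx' h].
  by rewrite /= (cfwdK cx') in h; exact: (conj cx' h).
exists 'I_m, Psi; split=> //.
  by exists (k * C); [exact: mulr_gt0|move=> x v [_ [_]]; exact].
move=> x Ux; exists [set y | cdom c y /\ `|cfwd c y - u0| < r].
  have [cx [xr _]] := Ux.
  have near_u : \forall u \near cfwd c x, `|u - u0| < r.
    have : 0 < r - `|cfwd c x - u0| by rewrite subr_gt0.
    move=> /(near_norm (cfwd c x)); apply: filterS => u ur.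
    rewrite -[u](subrK (cfwd c x)) -addrA (le_lt_trans (ler_normD _ _))//.
    by rewrite -ltrBrDr.
  have cx' : \forall y \near x, cdom c y by apply: open_nbhs_nbhs; split=> //; exact: cdom_open.
  have near_y : \forall y \near x, `|cfwd c y - u0| < r.
    exact: (cfwd_continuous cx near_u).
  exact: (filterI cx' near_y).
move=> y y' [cy yr] [cy' y'r] D0.
have := sep _ _ yr y'r; rewrite !cfwdK// D0 mulr0 normr_le0 subr_eq0 => /eqP E.
by rewrite -(cfwdK cy) E cfwdK.
Qed.

Lemma bump_at z (V : set M) : nbhs z V -> exists phi : M -> R,
  [/\ strict_fun S phi, exists B, forall x, 0 <= phi x <= B, 0 < phi z &
      forall x, phi x != 0 -> V x].
Proof.
move=> zV; pose c := chart_at S z; pose u0 := cfwd c z.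
have cS : atlas S c by exact: chart_at_atlas.
have cz : cdom c z by exact: chart_at_dom.
have cu0 : ccod c u0 by exact: cfwd_cod.
have [s s0 hs] := chart_ball cu0.
have : nbhs u0 (cbwd c @^-1` V).
  by apply: (cbwd_continuous cu0); rewrite [cbwd c u0]cfwdK.
move/nbhs_ballP => [t /= t0 ht].
pose r := Num.min s t; have r0 : 0 < r by rewrite lt_min s0.
exists (manifold_bump c u0 r); split.
- by apply: (strict_fun_manifold_bump hM) => // u ur; apply: hs; rewrite (le_trans ur)// ge_min lexx.
- exists (r ^+ 4) => x; rewrite /manifold_bump; case: asboolP => _; first by rewrite bump_ge0 bump_le.
  by rewrite lexx exprn_ge0// ltW.
- by rewrite /manifold_bump asboolT//; exact: bump_center.
move=> x /(manifold_bump_supp r0)[cx xr]; rewrite -(cfwdK cx); apply: ht.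
by rewrite -ball_normE /= distrC (lt_le_trans xr)// ge_min lexx orbT.
Qed.

(** Along a curve, [psi] changes by at most the integral of
[K] times the speed. *)
Lemma strict_fun_lipschitz psi : strict_fun S psi -> exists2 K : R, 0 < K &
  forall x y, (`|psi x - psi y|%:E <= K%:E * riemannian_dist g x y)%E.
Proof.
move=> ps; have [K K0 hK] := fun_diff_bound g cM ps; exists K => // x y.
rewrite muleC -lee_pdivrMr//; apply/ereal_infP => _ [gam [gC g0 g1] <-].
pose h := psi \o gam.
have hs t : strict_diff h t by exact: (curve_deriv t ps gC).1.
have hd t : derive1 h t = fun_diff S psi (gam t) (velocity S gam t) by exact: (curve_deriv t ps gC).2.
have dc : continuous (derive1 h) by move=> t; exact: strict_diff_derive1_continuous.
have ftc : (\int[lebesgue_measure]_(t in `[0%R, 1%R]) (derive1 h t)%:E = (h 1)%:E - (h 0)%:E)%E.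
  apply: continuous_FTC2 => //.
  - exact: continuous_subspaceT.
  - split.
    + by move=> t _; apply/derivable1_diffP; exact: (hs t).1.
    + apply: cvg_at_right_filter; exact: differentiable_continuous (hs 0).1.
    + apply: cvg_at_left_filter; exact: differentiable_continuous (hs 1).1.
pose I01 : set R := `[0, 1]%classic.
have mI : measurable I01 by exact: measurable_itv.
pose dh : R -> R := derive1 h.
have md : measurable_fun I01 (dh).
  by apply: measurable_funTS; exact: measurable_realfun.continuous_measurable_fun.
have md' : measurable_fun I01 ((fun t => (dh t)%:E)) by exact/measurable_EFinP.
have mn : measurable_fun I01 (fun t => `|dh t|%:E).
  by apply/measurable_EFinP; exact: measurableT_comp.
have : (`|(h 1)%:E - (h 0)%:E| <= \int[lebesgue_measure]_(t in I01) (`|dh t|%:E))%E.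
  by rewrite -ftc; exact: (le_abse_integral lebesgue_measure mI md').
rewrite -EFinB abse_EFin /h /= g0 g1 distrC => H.
apply: (@le_trans _ _ ((K^-1)%:E * \int[lebesgue_measure]_(t in I01) (`|dh t|%:E))%E).
  by rewrite muleC lee_wpmul2l// lee_fin invr_ge0 ltW.
rewrite -ge0_integralZl_EFin ?invr_ge0 ?(ltW K0)//.
(* The two integrals are compared as suprema over simple functions below the
   integrands, which does not require the speed to be measurable. *)
rewrite /curve_length ge0_integralE; last by move=> t _; rewrite -EFinM lee_fin mulr_ge0// invr_ge0 ltW.
rewrite [leRHS]ge0_integralE; last by move=> t _; rewrite lee_fin ip_norm_ge0.
apply: le_ereal_sup => _ [f hf <-]; exists f => // t.
apply: (le_trans (hf t)); rewrite /patch; case: ifP => // _.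
by rewrite -EFinM lee_fin mulrC ler_pdivrMr// mulrC /dh hd.
Qed.
End Separating.

(** The factor 1/4 for tangent vectors degrades to 1/2 for distances
when these agree with the norms up to an error [N / 8]. *)
(** * Expansivity of Anosov diffeomorphisms *)

Lemma expansive_arith (R : realType) (N NF NG D DF DG : R) :
  N <= 1 / 4 * Num.max NF NG -> `|D - N| <= 1 / 8 * N ->
  `|DF - NF| <= 1 / 8 * N -> `|DG - NG| <= 1 / 8 * N ->
  D <= 1 / 2 * Num.max DF DG.
Proof.
rewrite !ler_norml => h /andP[a1 a2] /andP[b1 b2] /andP[c1 c2]; move: h.
by have [h|h] := leP NF NG; have [h'|h'] := leP DF DG; lra.
Qed.

Lemma max_ge2 (R : realType) (a b : R) : a <= Num.max a b /\ b <= Num.max a b.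
Proof. by rewrite !le_max !lexx orbT. Qed.

Lemma hyper_arith (R : realType) (mu X a b v : R) : 0 <= mu -> mu <= 1 / 2 ->
  0 <= X -> 0 <= a -> 0 <= b -> b <= mu * (X + mu * a) -> a <= mu * (X + mu * b) ->
  v <= a + b -> v <= 4 * mu * X.
Proof.
move=> mu0 mu1 X0 a0 b0; rewrite !mulrDr !mulrA => hu hs h.
have mm : mu * mu <= 1 / 4 by nra.
have h1 := ler_wpM2r a0 mm; have h2 := ler_wpM2r b0 mm.
have muX := mulr_ge0 mu0 X0; lra.
Qed.

Lemma norm_transfer (R : realType) (a b mu N NF NG n nF nG : R) :
  0 <= a -> 0 <= b -> 0 <= mu -> 4 * mu * (a * b) <= 1 / 4 ->
  0 <= NF -> 0 <= NG -> N <= b * n -> nF <= a * NF -> nG <= a * NG ->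
  n <= 4 * mu * Num.max nF nG -> N <= 1 / 4 * Num.max NF NG.
Proof.
move=> a0 b0 mu0 mub NF0 NG0 h1 h2 h3 h4.
have M0 : 0 <= Num.max NF NG by rewrite le_max NF0.
have h5 : Num.max nF nG <= a * Num.max NF NG.
  rewrite ge_max (le_trans h2) ?(le_trans h3)// ler_wpM2l// le_max lexx ?orbT//.
apply: (le_trans h1); apply: (@le_trans _ _ (b * (4 * mu * (a * Num.max NF NG)))).
  by rewrite ler_wpM2l// (le_trans h4)// ler_wpM2l// mulr_ge0.
have -> : b * (4 * mu * (a * Num.max NF NG)) = 4 * mu * (a * b) * Num.max NF NG by ring.
by rewrite ler_wpM2r.
Qed.

Lemma half_in01 (R : realType) : 0 < (1 / 2 : R) < 1.
Proof. by apply/andP; split; lra. Qed.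

Section Hyperbolic.
Variables (R : realType) (M : topologicalType) (m : nat).
Variable S : smooth_structure R M m.
Variable g : riemannian_metric S.
Hypotheses (hM : hausdorff_space M) (cM : compact [set: M]).
Variable f : diffeo S.
Let finv := diffeo_inv f.

Lemma strict_map_f : strict_map S f. Proof. exact/C1_map_strict_map/diffeo_C1. Qed.
Lemma strict_map_finv : strict_map S finv. Proof. exact/C1_map_strict_map/diffeo_inv_C1. Qed.

Lemma iter_diffeoK n x : iter n finv (iter n f x) = x.
Proof.
elim: n x => // n IH x; rewrite iterSr [iter n.+1 f x]iterS.
by rewrite /finv diffeoK IH.
Qed.

Lemma iter_diffeo_invK n x : iter n f (iter n finv x) = x.
Proof.
elim: n x => // n IH x; rewrite iterSr [iter n.+1 finv x]iterS.
by rewrite /finv diffeo_invK IH.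
Qed.

Lemma tangent_cancel (h k : M -> M) x v : strict_map S h -> strict_map S k ->
  (forall y, k (h y) = y) ->
  tangent_map S k (h x) (tangent_map S h x v) = v.
Proof.
move=> hs ks kh; rewrite -tangent_comp//.
rewrite (_ : k \o h = id); first exact: tangent_id.
by apply/funext.
Qed.

Lemma tangentD h x v w :
  tangent_map S h x (v + w) = tangent_map S h x v + tangent_map S h x w.
Proof. exact: linearD. Qed.

Lemma invariant_iter (E : M -> {vspace 'rV[R]_m}) n x v :
  (forall x, [set tangent_map S f x v | v in [set v | v \in E x]] =
          [set w | w \in E (f x)]) ->
  v \in E x -> tangent_map S (iter n f) x v \in E (iter n f x).
Proof.
move=> Einv vE; elim: n => [|n IH].
  by rewrite (_ : iter 0 f = id) // tangent_id.
rewrite tangent_iterS; last exact: strict_map_f.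
suff : [set w | w \in E (f (iter n f x))] (tangent_map S f (iter n f x) (tangent_map S (iter n f) x v)) by [].
by rewrite -Einv; exists (tangent_map S (iter n f) x v).
Qed.

Lemma invariant_iter_inv (E : M -> {vspace 'rV[R]_m}) n x v :
  (forall x, [set tangent_map S f x v | v in [set v | v \in E x]] =
          [set w | w \in E (f x)]) ->
  v \in E x -> tangent_map S (iter n finv) x v \in E (iter n finv x).
Proof.
move=> Einv vE; elim: n => [|n IH].
  by rewrite (_ : iter 0 finv = id) // tangent_id.
rewrite tangent_iterS; last exact: strict_map_finv.
set y := iter n finv x in IH *; set w := tangent_map S (iter n finv) x v in IH *.
have fy : f (finv y) = y by rewrite /finv diffeo_invK.
have : [set w | w \in E (f (finv y))] w by rewrite /= fy.
rewrite -Einv => -[v' /= v'E <-].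
have := tangent_cancel (finv y) v' strict_map_f strict_map_finv (diffeoK f).
by rewrite fy => ->.
Qed.

(** Write [v = vs + vu].  The image of [vu] under [f^n] has norm at
most [X + mu |vs|], because [vs] is contracted; it is contracted back to [vu]
by the inverse.  So [|vu| <= mu (X + mu |vs|)], symmetrically for [vs], and the
two inequalities bound [|vs| + |vu|]. *)
Lemma hyperbolic_bound (mu : R) n (Es Eu : M -> {vspace 'rV[R]_m}) x v :
  0 <= mu <= 1 / 2 ->
  (forall x, (Es x + Eu x)%VS = fullv) ->
  (forall x, [set tangent_map S f x v | v in [set v | v \in Es x]] =
          [set w | w \in Es (f x)]) ->
  (forall x, [set tangent_map S f x v | v in [set v | v \in Eu x]] =
          [set w | w \in Eu (f x)]) ->
  (forall x v, v \in Es x ->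
     ip_norm (g (iter n f x)) (tangent_map S (iter n f) x v) <= mu * ip_norm (g x) v) ->
  (forall x v, v \in Eu x ->
     ip_norm (g (iter n finv x)) (tangent_map S (iter n finv) x v) <= mu * ip_norm (g x) v) ->
  ip_norm (g x) v <= 4 * mu * Num.max
    (ip_norm (g (iter n f x)) (tangent_map S (iter n f) x v))
    (ip_norm (g (iter n finv x)) (tangent_map S (iter n finv) x v)).
Proof.
move=> /andP[mu0 mu1] Efull Esinv Euinv hEs hEu.
have : v \in (Es x + Eu x)%VS by rewrite Efull memvf.
case/memv_addP => vs vsE [vu vuE vE].
set X := Num.max _ _.
have [X1 X2] := max_ge2 (ip_norm (g (iter n f x)) (tangent_map S (iter n f) x v))
  (ip_norm (g (iter n finv x)) (tangent_map S (iter n finv) x v)).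
rewrite -/X in X1 X2.
have ig y := rmetric_ip g y.
have sF : strict_map S (iter n f) by apply: strict_map_iter; exact: strict_map_f.
have sG : strict_map S (iter n finv) by apply: strict_map_iter; exact: strict_map_finv.
have hu : ip_norm (g x) vu <= mu * (X + mu * ip_norm (g x) vs).
  have wE := invariant_iter n Euinv vuE.
  have := hEu _ _ wE; rewrite iter_diffeoK (tangent_cancel _ _ sF sG (iter_diffeoK n)).
  move=> h; apply: (le_trans h); rewrite ler_wpM2l//.
  have := ip_normB (ig (iter n f x)) (tangent_map S (iter n f) x vu) (tangent_map S (iter n f) x vs).
  rewrite -tangentD [vu + vs]addrC -vE lerBlDr => h2; apply: (le_trans h2).
  exact: (lerD X1 (hEs x vs vsE)).
have hs : ip_norm (g x) vs <= mu * (X + mu * ip_norm (g x) vu).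
  have wE := invariant_iter_inv n Esinv vsE.
  have := hEs _ _ wE; rewrite iter_diffeo_invK (tangent_cancel _ _ sG sF (iter_diffeo_invK n)).
  move=> h; apply: (le_trans h); rewrite ler_wpM2l//.
  have := ip_normB (ig (iter n finv x)) (tangent_map S (iter n finv) x vs) (tangent_map S (iter n finv) x vu).
  rewrite -tangentD -vE lerBlDr => h2; apply: (le_trans h2).
  exact: (lerD X2 (hEu x vu vuE)).
have := ip_normD (ig x) vs vu; rewrite -vE => h.
have a0 := ip_norm_ge0 (g x) vs; have b0 := ip_norm_ge0 (g x) vu.
have X0 : 0 <= X by apply: le_trans X1; exact: ip_norm_ge0.
exact: hyper_arith mu0 mu1 X0 a0 b0 hu hs h.
Qed.

Lemma strict_fun_bounded psi : strict_fun S psi -> exists B : R, forall x, `|psi x| <= B.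
Proof.
move=> ps; pose P (A : set M) := exists B : R, forall x, A x -> `|psi x| <= B.
suff [B hB] : P setT by exists B => x; exact: hB.
apply: compact_ind => //.
- by move=> A B AB [b hb]; exists b => x /AB; exact: hb.
- by exists 0.
- move=> A B [b hb] [d hd]; exists (Num.max b d) => x [/hb|/hd] h.
    by rewrite le_max h.
  by rewrite le_max h orbT.
move=> x0; pose c := chart_at S x0; pose u0 := cfwd c x0.
have cx0 : cdom c x0 by exact: chart_at_dom.
have [k [r [k0 r0 hk]]] := strict_diff_lip (ps x0).
exists [set x | cdom c x /\ `|cfwd c x - u0| < r].
  have cx' : \forall y \near x0, cdom c y by apply: open_nbhs_nbhs; split=> //; exact: cdom_open.
  have near_y : \forall y \near x0, `|cfwd c y - u0| < r.
    exact: (cfwd_continuous cx0 (near_norm u0 r0)).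
  exact: (filterI cx' near_y).
exists (k * r + `|psi x0|) => x [cx xr].
have E : cbwd c (cfwd c x) = x by exact: cfwdK.
have E0 : cbwd c u0 = x0 by exact: cfwdK.
have h : `|psi (cbwd c (cfwd c x)) - psi (cbwd c u0)| <= k * `|cfwd c x - u0|.
  by apply: hk => //; rewrite subrr normr0.
rewrite E E0 in h.
rewrite -[psi x](subrK (psi x0)) (le_trans (ler_normD _ _))// lerD2r.
by apply: (le_trans h); rewrite ler_pM2l// ltW.
Qed.

(** Between points close to [x0], the increments of [psi_i],
[psi_i \o F] and [psi_i \o G] are the differentials at [x0] of the coordinate
difference, up to a small multiple of its norm. *)
Lemma expansive_local (I : finType) (Psi : I -> M -> R) (F G : M -> M) (C : R) :
  (forall i, strict_fun S (Psi i)) -> strict_map S F -> strict_map S G -> 0 < C ->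
  (forall x v, ip_norm (g x) v <= C * sep_norm S Psi x v) ->
  (forall x v, sep_norm S Psi x v <= 1 / 4 * Num.max
     (sep_norm S Psi (F x) (tangent_map S F x v)) (sep_norm S Psi (G x) (tangent_map S G x v))) ->
  forall x0, exists2 U, nbhs (x0 : M) U & forall y y', U y -> U y' ->
    sep_dist Psi y y' <= 1 / 2 * Num.max (sep_dist Psi (F y) (F y')) (sep_dist Psi (G y) (G y')).
Proof.
move=> Ps sF sG C0 hC hN x0; pose c := chart_at S x0; pose u0 := cfwd c x0.
have cx0 : cdom c x0 by exact: chart_at_dom.
have [k k0 hk] := ip_lower (rmetric_ip g x0).
pose K := Num.sqrt (2 / (k * 2)).
have hK v : `|v| <= K * C * sep_norm S Psi x0 v.
  rewrite -mulrA; apply: (@le_trans _ _ (K * ip_norm (g x0) v)); last first.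
    by rewrite ler_wpM2l ?sqrtr_ge0.
  apply: sqrt_lower => //; first by rewrite mulr_gt0.
  by rewrite mulfK.
pose n : R := #|I|%:R.
have n0 : 0 <= n by exact: ler0n.
have K0 : 0 < K by rewrite sqrtr_gt0 !divr_gt0// mulr_gt0.
pose e := 1 / (8 * (K * C) * (n + 1)).
have e0 : 0 < e by rewrite divr_gt0// !mulr_gt0// ltr_wpDl.
have eE v : n * (e * `|v|) <= 1 / 8 * sep_norm S Psi x0 v.
  have N0 : 0 <= sep_norm S Psi x0 v by apply: sumr_ge0.
  apply: (@le_trans _ _ (n * (e * (K * C * sep_norm S Psi x0 v)))).
    by rewrite !ler_wpM2l// ltW.
  rewrite /e.
  have -> : n * (1 / (8 * (K * C) * (n + 1)) * (K * C * sep_norm S Psi x0 v)) = (n / (n + 1)) * (1 / 8 * sep_norm S Psi x0 v).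
    by field; rewrite !gt_eqF// ltr_wpDl.
  by rewrite ler_piMl ?mulr_ge0 ?divr_ge0// ler_pdivrMr ?ltr_wpDl// mul1r lerDl.
have est (H : M -> M) : strict_map S H -> exists2 r, 0 < r & forall u u', `|u - u0| < r -> `|u' - u0| < r ->
   `|sep_dist Psi (H (cbwd c u)) (H (cbwd c u')) - sep_norm S Psi (H x0) (tangent_map S H x0 (u - u'))| <= 1 / 8 * sep_norm S Psi x0 (u - u').
  move=> sH.
  have [r r0 hr] : exists2 r, 0 < r & forall i, forall u u', `|u - u0| < r -> `|u' - u0| < r ->
      `|(Psi i \o H \o cbwd c) u - (Psi i \o H \o cbwd c) u' - fun_diff S (Psi i) (H x0) (tangent_map S H x0 (u - u'))| <= e * `|u - u'|.
    apply: common_radius.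
      by move=> i p q Pp qp w w' wq w'q; apply: Pp; exact: lt_le_trans qp.
    move=> i; have [sc dc] := strict_fun_comp (Ps i) sH.
    have [p p0 hp] := (sc x0).2 _ e0; exists p => // u u' up u'p.
    rewrite -dc; exact: hp.
  exists r => // u u' ur u'r; apply: le_trans (eE _).
  rewrite /sep_dist /sep_norm -sumrB (le_trans (ler_norm_sum _ _ _))//.
  have -> : n * (e * `|u - u'|) = \sum_(i : I) e * `|u - u'|.
    by rewrite sumr_const mulr_natl.
  apply: ler_sum => i _; apply: le_trans (hr i _ _ ur u'r).
  exact: ler_dist_dist.
have [r0 r00 hr0] := est _ (strict_map_id S).
have [r1 r10 hr1] := est _ sF.
have [r2 r20 hr2] := est _ sG.
pose r := Num.min r0 (Num.min r1 r2).
have rp : 0 < r by rewrite !lt_min r00 r10.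
exists [set x | cdom c x /\ `|cfwd c x - u0| < r].
  have cx' : \forall y \near x0, cdom c y by apply: open_nbhs_nbhs; split=> //; exact: cdom_open.
  have near_y : \forall y \near x0, `|cfwd c y - u0| < r.
    exact: (cfwd_continuous cx0 (near_norm u0 rp)).
  exact: (filterI cx' near_y).
move=> y y' [cy]; rewrite !lt_min => /and3P[y0 y1 y2] [cy']; rewrite !lt_min => /and3P[y'0 y'1 y'2].
have := hr0 _ _ y0 y'0; have := hr1 _ _ y1 y'1; have := hr2 _ _ y2 y'2.
rewrite (cfwdK cy) (cfwdK cy') tangent_id.
move=> h2 h1 h0; exact: expansive_arith (hN x0 _) h0 h1 h2.
Qed.

Lemma geometric_small (C lam e : R) (q : nat) : 0 < C -> 0 < lam < 1 -> 0 < e ->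
  (0 < q)%N -> exists2 n, (0 < n)%N & (q %| n)%N /\ C * lam ^+ n <= e.
Proof.
move=> C0 /andP[l0 l1] e0 q0.
have eC : 0 < e / C by rewrite divr_gt0.
have nl : `|lam| < 1 by rewrite gtr0_norm.
have /cvgrPdist_le/(_ _ eC)[N _ hN] := cvg_expr nl.
exists (q * N.+1)%N; first by rewrite muln_gt0 q0.
split; first exact: dvdn_mulr.
have qN : (N <= q * N.+1)%N by apply: (@leq_trans N.+1) => //; rewrite leq_pmull.
have := hN _ qN.
by rewrite /= sub0r normrN normrX (gtr0_norm l0) => h; rewrite mulrC -ler_pdivlMr.
Qed.

(** Take [n] so large that the contraction rate of [f^n] compensates
the constants that relate the Riemannian norm to a separating norm, and a cover
by sets on which [expansive_local] holds.  If the orbits of [x] and [y] remain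
in common elements of the cover, their distance at each time is at most half of
the distance just before or just after, so a bound valid at all times can be
halved indefinitely. *)
Lemma anosov_generator (q : nat) : anosov g f -> (0 < q)%N ->
  exists n, [/\ (0 < n)%N, (q %| n)%N &
    exists (I : finType) (Ov : I -> set M),
    [/\ forall i, open (Ov i), forall x, exists i, Ov i x &
      forall x y,
       (forall k, exists i, Ov i (iter k (iter n f) x) /\ Ov i (iter k (iter n f) y)) ->
       (forall k, exists i, Ov i (iter k (iter n finv) x) /\ Ov i (iter k (iter n finv) y)) ->
       x = y]].
Proof.
move=> [Es [Eu [C [lam [C0 lam01 Esum Einv hE]]]]] q0.
have [I [Psi [Ps [a a0 ha] hsep]]] := sep_family g hM cM.
have [b b0 hb] : exists2 b : R, 0 < b & forall x v, sep_norm S Psi x v <= b * ip_norm (g x) v.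
  have hK i : exists K : R, 0 < K /\ forall x v, `|fun_diff S (Psi i) x v| <= K * ip_norm (g x) v.
    by have [K K0 hK] := fun_diff_bound g cM (Ps i); exists K.
  have [K hK'] := choice hK.
  exists (\sum_i K i + 1).
    by rewrite ltr_wpDl// sumr_ge0// => i _; exact: ltW (hK' i).1.
  move=> x v; rewrite mulrDl mul1r ler_wpDr ?ip_norm_ge0// mulr_suml.
  by apply: ler_sum => i _; exact: (hK' i).2.
pose e := Num.min (1 / 2) (1 / (16 * a * b)).
have e0 : 0 < e by rewrite lt_min !divr_gt0// !mulr_gt0.
have [n n0 [qn muE]] := geometric_small C0 lam01 e0 q0.
exists n; split=> //.
set mu := C * lam ^+ n in muE.
have mu0 : 0 <= mu by rewrite mulr_ge0 ?exprn_ge0 ?(ltW C0)// ltW//; case/andP: lam01.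
have mu12 : 0 <= mu <= 1 / 2.
  by rewrite mu0 (le_trans muE)// ge_min lexx.
have mub : 4 * mu * (a * b) <= 1 / 4.
  have : mu <= 1 / (16 * a * b) by rewrite (le_trans muE)// ge_min lexx orbT.
  by rewrite ler_pdivlMr ?mulr_gt0//; lra.
pose F := iter n f; pose G := iter n finv.
have sF : strict_map S F by apply: strict_map_iter; exact: strict_map_f.
have sG : strict_map S G by apply: strict_map_iter; exact: strict_map_finv.
have hN x v : sep_norm S Psi x v <= 1 / 4 * Num.max
     (sep_norm S Psi (F x) (tangent_map S F x v)) (sep_norm S Psi (G x) (tangent_map S G x v)).
  have Nge y w : 0 <= sep_norm S Psi y w by apply: sumr_ge0.
  have h1 := @hyperbolic_bound mu n Es Eu x v mu12 (fun x => (Esum x).1)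
    (fun x => (Einv x).1) (fun x => (Einv x).2) (fun x v => (hE x n v).1)
    (fun x v => (hE x n v).2).
  exact: norm_transfer (ltW a0) (ltW b0) mu0 mub (Nge _ _) (Nge _ _) (hb x v)
    (ha (F x) (tangent_map S F x v)) (ha (G x) (tangent_map S G x v)) h1.
have hexp := expansive_local Ps sF sG a0 ha hN.
pose good (A : set M) := forall y y', A y -> A y' ->
   sep_dist Psi y y' <= 1 / 2 * Num.max (sep_dist Psi (F y) (F y')) (sep_dist Psi (G y) (G y')) /\
   (sep_dist Psi y y' = 0 -> y = y').
pose P (A : set M) := exists (J : finType) (Ov : J -> set M),
  [/\ forall i, open (Ov i), forall x, A x -> exists i, Ov i x & forall i, good (Ov i)].
have [J [Ov [Oo Ocov Ogood]]] : P setT.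
  apply: compact_ind => //.
  - move=> A B AB [J [Ov [h1 h2 h3]]]; exists J, Ov; split=> // x /AB; exact: h2.
  - by exists void, (fun _ => set0); split.
  - move=> A B [J [Ov [h1 h2 h3]]] [J' [Ov' [h1' h2' h3']]].
    exists (J + J')%type, (fun k => match k with inl i => Ov i | inr j => Ov' j end).
    split; [by case| |by case].
    by move=> x []; [move=> /h2 [i xi]; exists (inl i)|move=> /h2' [j xj]; exists (inr j)].
  move=> x0; have [U xU hU] := hexp x0; have [V xV hV] := hsep x0.
  exists (U `&` V)^°; first by apply: nbhs_interior; exact: filterI.
  exists unit, (fun _ => (U `&` V)^°); split=> //.
  - by move=> _; exact: open_interior.
  - move=> _ y y' yI y'I.
    have [yU yV] := nbhs_singleton yI; have [y'U y'V] := nbhs_singleton y'I.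
    by split; [exact: hU|exact: hV].
exists J, Ov; split=> //.
  by move=> x; exact: Ocov.
move=> x y hF hG.
have [B hB] : exists B : R, forall z w, sep_dist Psi z w <= B.
  have [B hB] := choice (fun i => strict_fun_bounded (Ps i)).
  exists (\sum_i (B i + B i)) => z w; apply: ler_sum => i _.
  by rewrite (le_trans (ler_normB _ _))// lerD.
pose p k := sep_dist Psi (iter k F x) (iter k F y).
pose p' k := sep_dist Psi (iter k G x) (iter k G y).
have GF z : G (F z) = z by exact: iter_diffeoK.
have FG z : F (G z) = z by exact: iter_diffeo_invK.
have D0 : forall j, (forall k, p k <= B / 2 ^+ j) /\ (forall k, p' k <= B / 2 ^+ j).
  elim=> [|j [IH IH']]; first by rewrite expr0 divr1; split=> k; exact: hB.
  have hmax u w z : z <= 1 / 2 * Num.max u w -> u <= B / 2 ^+ j -> w <= B / 2 ^+ j ->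
      z <= B / 2 ^+ j.+1.
    move=> zuw u1 w1; apply: (le_trans zuw); rewrite exprS invfM mulrCA div1r.
    by rewrite ler_wpM2l ?invr_ge0// ge_max u1.
  split=> -[|k].
  - have [i [xi yi]] := hF 0%N; have [h _] := Ogood i _ _ xi yi.
    by apply: (hmax _ _ _ h); [exact: (IH 1%N)|exact: (IH' 1%N)].
  - have [i [xi yi]] := hF k.+1; have [h _] := Ogood i _ _ xi yi.
    apply: (hmax _ _ _ h); first exact: (IH k.+2).
    by rewrite /= !GF; exact: IH.
  - have [i [xi yi]] := hF 0%N; have [h _] := Ogood i _ _ xi yi.
    by apply: (hmax _ _ _ h); [exact: (IH 1%N)|exact: (IH' 1%N)].
  - have [i [xi yi]] := hG k.+1; have [h _] := Ogood i _ _ xi yi.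
    apply: (hmax _ _ _ h); last exact: (IH' k.+2).
    by rewrite /= !FG; exact: IH'.
have [i [xi yi]] := hF 0%N; have [_ h] := Ogood i _ _ xi yi; apply: h.
apply/eqP; rewrite eq_le; apply/andP; split; last by apply: sumr_ge0.
apply/ler_addgt0Pr => t t0; rewrite add0r.
have B1 : 0 < `|B| + 1 by rewrite ltr_wpDl.
have [j _ [_ hj]] := geometric_small B1 (half_in01 R) t0 (ltn0Sn 0).
apply: (le_trans ((D0 j).1 0%N)); apply: le_trans hj.
rewrite expr_div_n expr1n div1r ler_wpM2r ?invr_ge0//.
by rewrite (le_trans (ler_norm _))// lerDl.
Qed.

End Hyperbolic.

(** * Recurrence to points that are not fixed *)

Section Generator.
Variable T : topologicalType.
Hypotheses (cT : compact [set: T]) (hT : hausdorff_space T).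

(** Its cluster points are the limit points of the orbit. *)
Definition orbit_filter (F : T -> T) (x : T) : set_system T :=
  (fun k => iter k F x) @ \oo.

(** The points [q i] may repeat, as when several elements of a cover
contain the same fixed point. *)
Lemma separated_nbhds (I : finType) (q : I -> T) :
  exists N : I -> set T, (forall i, nbhs (q i) (N i)) /\
    forall i j y, N i y -> N j y -> q i = q j.
Proof.
have sep (ij : I * I) : exists AB : set T * set T, q ij.1 <> q ij.2 ->
    [/\ nbhs (q ij.1) AB.1, nbhs (q ij.2) AB.2 & forall y, AB.1 y -> ~ AB.2 y].
  have [e|ne] := pselect (q ij.1 = q ij.2); first by exists (set0, set0).
  have /eqP ne' := ne.
  have := hT; rewrite open_hausdorff => /(_ _ _ ne')[AB [a b] [oA oB /eqP dAB]].
  exists AB => _; split.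
  - by apply: open_nbhs_nbhs; split=> //; exact: set_mem.
  - by apply: open_nbhs_nbhs; split=> //; exact: set_mem.
  - by move=> y Ay By; have : (AB.1 `&` AB.2) y by []; rewrite dAB.
have [AB hAB] := choice sep.
exists (fun i => [set y | forall j, q i <> q j -> (AB (i, j)).1 y /\ (AB (j, i)).2 y]); split.
  move=> i; apply: filter_forall => j.
  have [e|ne] := pselect (q i = q j); first by apply: filterS filterT => y _.
  have [a _ _] := hAB (i, j) ne; have [_ b _] := hAB (j, i) (fun e => ne (esym e)).
  by apply: filterS (filterI a b).
move=> i j y Ni Nj; apply: contrapT => ne.
have [_ _ dis] := hAB (i, j) ne.
exact: (dis y (Ni j ne).1 (Nj i (fun e => ne (esym e))).2).
Qed.

Definition same_itinerary (I : Type) (Ov : I -> set T) (F : T -> T) x y :=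
  forall k, exists i, Ov i (iter k F x) /\ Ov i (iter k F y).

(** An element of the cover contains at most one fixed point, by
[gen], so there are finitely many of them.  By compactness the orbit is
eventually in the union of small neighbourhoods of the fixed points; as [F]
moves points near a fixed point very little, the orbit cannot jump from one
neighbourhood to another. *)
Lemma eventually_constant (F G : T -> T) (I : finType) (Ov : I -> set T) x :
  continuous F -> cancel F G ->
  (forall i, open (Ov i)) -> (forall x, exists i, Ov i x) ->
  (forall x y, same_itinerary Ov F x y -> same_itinerary Ov G x y -> x = y) ->
  (forall z, cluster (orbit_filter F x) z -> F z = z) ->
  exists i K, forall k, (K <= k)%N -> Ov i (iter k F x).
Proof.
move=> cF FK Oo Ocov gen hx.
(* [q i] is the fixed point in [Ov i], when there is one *)
pose P i := exists2 p, F p = p & Ov i p.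
have hP i : exists p, P i -> F p = p /\ Ov i p.
  have [[p Fp ip]|nP] := pselect (P i); first by exists p.
  by exists x.
have [q hq] := choice hP.
have quniq i p : F p = p -> Ov i p -> q i = p.
  move=> Fp ip; have [Fq iq] := hq i (ex_intro2 _ _ p Fp ip).
  have Gp : G p = p by rewrite -{1}Fp FK.
  have Gq : G (q i) = q i by rewrite -{1}Fq FK.
  by apply: gen => k; exists i; rewrite !iter_fix.
have [N [Nn Ndis]] := separated_nbhds q.
(* a neighbourhood of [q i], inside all the elements of the cover around [q i], from
   which one step of [F] cannot reach the neighbourhood of another fixed point *)
pose W i := [set y | N i y /\ N i (F y) /\ forall j, P j -> q j = q i -> Ov j y].
have Wn i : P i -> nbhs (q i) (W i).
  move=> Pi; have [Fq iq] := hq i Pi.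
  apply: filterI; first exact: Nn.
  apply: filterI; first by apply: cF; rewrite Fq; exact: Nn.
  apply: filter_forall => j.
  have [Pj|nPj] := pselect (P j); last by apply: filterS filterT.
  have [e|ne] := pselect (q j = q i); last by apply: filterS filterT.
  rewrite -e; have : nbhs (q j) (Ov j).
    by apply: open_nbhs_nbhs; split; [exact: Oo|exact: (hq j Pj).2].
  by apply: filterS => y yj _ _.
have [K hK] : exists K, forall k, (K <= k)%N -> exists2 i, P i & W i (iter k F x).
  apply: contrapT => nK.
  pose bad k := forall i, P i -> ~ W i (iter k F x).
  have badk K : exists2 k, (K <= k)%N & bad k.
    apply: contrapT => nb; apply: nK; exists K => k Kk.
    apply: contrapT => nW; apply: nb; exists k => // i Pi Wi; apply: nW.
    by exists i.
  (* the times at which the orbit is away from all the fixed points would accumulate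
   somewhere, at a point fixed by hypothesis *)
pose Fm : set_system T := [set A | exists K, forall k, (K <= k)%N -> bad k -> A (iter k F x)].
  have FmF : ProperFilter Fm.
    split.
      by move=> [K hK]; have [k Kk bk] := badk K; exact: (hK k Kk bk).
    split.
    - by exists 0%N.
    - move=> A B [K hK] [L hL]; exists (maxn K L) => k; rewrite geq_max => /andP[Kk Lk] bk.
      by split; [exact: hK|exact: hL].
    - by move=> A B AB [K hK]; exists K => k Kk bk; apply: AB; exact: hK.
  have [|z [_ clz]] := cT FmF; first by exists 0%N.
  have Fz : F z = z.
    apply: hx => A B [K _ hK] zB; apply: clz => //.
    by exists K => k Kk _; exact: hK.
  have [i iz] := Ocov z.
  have Pi : P i by exists z.
  have qi := quniq i z Fz iz.
  have zW : nbhs z (W i) by rewrite -qi; exact: Wn.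
  have [|y [ny yW]] := clz (~` (W i)) (W i) _ zW.
    by exists 0%N => k _ bk; exact: bk.
  exact: ny.
have [i Pi WK] := hK K (leqnn K).
have stay d : exists j, [/\ P j, W j (iter (K + d) F x) & q j = q i].
  elim: d => [|d [j [Pj Wj qj]]]; first by rewrite addn0; exists i.
  have [j' Pj' Wj'] := hK (K + d.+1)%N (leq_addr _ _).
  exists j'; split=> //; rewrite -qj; apply: Ndis Wj'.1 _.
  by rewrite addnS; exact: Wj.2.1.
exists i, K => k /subnKC <-; have [j [Pj Wj qj]] := stay (k - K)%N.
exact: (Wj.2.2 i Pi (esym qj)).
Qed.

(** Otherwise each point is determined by two eventually constant
sequences of elements of the cover, and there are countably many such pairs. *)
Lemma recurrent_point (F G : T -> T) (I : finType) (Ov : I -> set T) :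
  continuous F -> continuous G -> cancel F G -> cancel G F ->
  (forall i, open (Ov i)) -> (forall x, exists i, Ov i x) ->
  (forall x y, same_itinerary Ov F x y -> same_itinerary Ov G x y -> x = y) ->
  ~ countable [set: T] ->
  exists x z, F z <> z /\
    (cluster (orbit_filter F x) z \/ cluster (orbit_filter G x) z).
Proof.
move=> cF cG FK GK Oo Ocov gen nct; apply: contrapT => no.
have hF x z : cluster (orbit_filter F x) z -> F z = z.
  by move=> cl; apply: contrapT => Fz; apply: no; exists x, z; split=> //; left.
have hG x z : cluster (orbit_filter G x) z -> G z = z.
  move=> cl; apply: contrapT => Gz; apply: no; exists x, z; split; last by right.
  by move=> Fz; apply: Gz; rewrite -{1}Fz FK.
(* a code: a time, the constant symbols from this time on of the forward and of the
   backward itinerary, and their symbols before this time *)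
pose code := (nat * I * I * seq I * seq I)%type.
pose good (x : T) (c : code) := let: (K, ip, im, w, w') := c in
  forall k, (if (K <= k)%N then Ov ip (iter k F x) else Ov (nth ip w k) (iter k F x)) /\
            (if (K <= k)%N then Ov im (iter k G x) else Ov (nth im w' k) (iter k G x)).
have goodex x : exists c, good x c.
  have [ip [K hK]] := eventually_constant cF FK Oo Ocov gen (hF x).
  have [im [L hL]] := eventually_constant cG GK Oo Ocov (fun x y a b => gen x y b a) (hG x).
  have [w hw] := choice (fun k => Ocov (iter k F x)).
  have [w' hw'] := choice (fun k => Ocov (iter k G x)).
  exists (maxn K L, ip, im, mkseq w (maxn K L), mkseq w' (maxn K L)) => k.
  case: ifPn; first by rewrite geq_max => /andP[a b]; split; [exact: hK|exact: hL].
  by rewrite -ltnNge => kK; rewrite !nth_mkseq.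
have [c hc] := choice goodex.
have cinj x y : c x = c y -> x = y.
  move=> cxy; have := hc x; have := hc y; rewrite -cxy.
  case: (c x) => [[[[K ip] im] w] w'] /= hy hx; apply: gen => k.
    by have := (hx k).1; have := (hy k).1; case: ifP => _ a b; [exists ip|exists (nth ip w k)].
  by have := (hx k).2; have := (hy k).2; case: ifP => _ a b; [exists im|exists (nth im w' k)].
apply: nct; apply/countable_injP; exists (fun x => pickle (c x : (nat * I * I * seq I * seq I)%type)).
by move=> x y _ _ /(pcan_inj pickleK); exact: cinj.
Qed.
End Generator.

Lemma half_close (R : realType) (a b : R) : `|a - b| <= a / 2 -> a / 2 <= b.
Proof. rewrite ler_norml; lra. Qed.

Section Visits.
Variables (R : realType) (M : topologicalType) (m : nat).
Variable S : smooth_structure R M m.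
Variable g : riemannian_metric S.
Hypotheses (hM : hausdorff_space M) (cM : compact [set: M]).
Variable f : diffeo S.
Let finv := diffeo_inv f.

(** A segment in a chart would be countable, hence of measure
zero. *)
Lemma manifold_uncountable : (0 < m)%N -> [set: M] !=set0 -> ~ countable [set: M].
Proof.
move=> m0 [x0 _] ctM; pose c := chart_at S x0; pose u0 := cfwd c x0.
have cx0 : cdom c x0 by exact: chart_at_dom.
have cu0 : ccod c u0 by exact: cfwd_cod.
have [s s0 hs] := chart_ball cu0.
pose j0 : 'I_m := Ordinal m0.
pose p (t : R) : M := cbwd c (u0 + t *: delta_mx 0 j0).
pose I0s : set R := `[0, s]%classic.
have pinj : {in I0s &, injective p}.
  move=> a b; rewrite !inE /I0s /= !in_itv /= => /andP[a0 a1] /andP[b0 b1] pab.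
  have cod t : 0 <= t <= s -> ccod c (u0 + t *: delta_mx 0 j0).
    move=> /andP[t0 t1]; apply: hs; rewrite addrAC subrr add0r.
    apply: rv_norm_le => [|i]; first exact: ltW.
    rewrite !mxE /=; case: (i == j0); rewrite ?mulr1 ?mulr0 ?normr0 ?(ltW s0)//.
    by rewrite ger0_norm.
  have ca : 0 <= a <= s by rewrite a0.
  have cb : 0 <= b <= s by rewrite b0.
  have := congr1 (cfwd c) pab; rewrite /p (cbwdK (cod _ ca)) (cbwdK (cod _ cb)).
  move=> /addrI /(congr1 (fun v : 'rV[R]_m => v 0 j0)).
  by rewrite !mxE !eqxx !mulr1.
have [e einj] : exists e : M -> nat, {in [set: M] &, injective e}.
  by apply/countable_injP.
have ctI : countable I0s.
  apply/countable_injP; exists (e \o p) => a b aI bI /= eab; apply: pinj => //.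
  by apply: einj => //; rewrite inE.
have := countable_lebesgue_measure0 ctI.
rewrite /I0s lebesgue_measure_itv /= lte_fin s0 sube0 => /eqP.
by rewrite eqe gt_eqF.
Qed.

Lemma strict_fun_continuous psi : strict_fun S psi -> continuous psi.
Proof.
move=> ps x; have cx : cdom (chart_at S x) x by exact: chart_at_dom.
have N : \forall y \near x, (psi \o cbwd (chart_at S x)) (cfwd (chart_at S x) y) = psi y.
  have : \forall y \near x, cdom (chart_at S x) y by apply: open_nbhs_nbhs; split=> //; exact: cdom_open.
  by apply: filterS => y cy /=; rewrite cfwdK.
have C : {for x, continuous ((psi \o cbwd (chart_at S x)) \o cfwd (chart_at S x))}.
  apply: continuous_comp; first exact: cfwd_continuous.
  exact: differentiable_continuous (ps x).1.
have := C; rewrite /prop_for /continuous_at [X in _ --> X](nbhs_singleton N) => C'.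
exact: (cvg_trans (near_eq_cvg N) C').
Qed.

Lemma many_visits (h : M -> M) (phi : M -> R) c x : 0 < c ->
  (forall K, exists2 k, (K <= k)%N & c <= phi (iter k h x)) ->
  forall B : R, exists n, B <= \sum_(k < n) phi (iter k h x) ^+ 2.
Proof.
move=> c0 vis B.
have H (N : nat) : exists n, N%:R * c ^+ 2 <= \sum_(k < n) phi (iter k h x) ^+ 2.
  elim: N => [|N [n hn]]; first by exists 0%N; rewrite mul0r big_ord0.
  have [k nk hk] := vis n; exists k.+1.
  rewrite big_ord_recr/= -addn1 natrD mulrDl mul1r lerD//; last first.
    by rewrite ler_sqr ?nnegrE ?(ltW c0) ?(le_trans (ltW c0) hk).
  apply: (le_trans hn); rewrite -(subnKC nk) big_split_ord /= lerDl.
  by apply: sumr_ge0 => i _; exact: sqr_ge0.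
have c2 : 0 < c ^+ 2 by rewrite exprn_gt0.
have [N hN] : exists N : nat, B / c ^+ 2 <= N%:R.
  exists (Num.truncn `|B / c ^+ 2|).+1; apply: ltW; apply: le_lt_trans (ler_norm _) _.
  exact: truncnS_gt.
have [n hn] := H N; exists n; apply: le_trans hn.
by rewrite -ler_pdivrMr.
Qed.

(** The point [z] of [recurrent_point] for an iterate whose exponent is
a multiple of [L!] is not fixed by [f], ..., [f^L].  If it is the backward orbit
that accumulates on [z], read a long piece of it forward from its last point. *)
Lemma recurrent_bump (L : nat) : anosov g f -> (0 < m)%N -> [set: M] !=set0 ->
  exists phi : M -> R,
  [/\ strict_fun S phi, exists B, forall x, 0 <= phi x <= B,
      forall y j, (0 < j <= L)%N -> phi y * phi (iter j f y) = 0 &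
      forall B : R, exists x n, B <= \sum_(k < n) phi (iter k f x) ^+ 2].
Proof.
move=> af m0 M0.
have [n [n0 Ln [I [Ov [Oo Ocov gen]]]]] := anosov_generator hM cM af (fact_gt0 L).
pose F := iter n f; pose G := iter n finv.
have sF : strict_map S F by apply: strict_map_iter; exact: strict_map_f.
have sG : strict_map S G by apply: strict_map_iter; exact: strict_map_finv.
have [x [z [Fz clz]]] := recurrent_point cM hM sF.1 sG.1 (iter_diffeoK f n) (iter_diffeo_invK f n)
  Oo Ocov gen (manifold_uncountable m0 M0).
have fz (j : 'I_L) : z <> iter j.+1 f z.
  move=> e; apply: Fz; rewrite /F.
  have /dvdnP[b ->] : (j.+1 %| n)%N by apply: dvdn_trans Ln; rewrite dvdn_fact//=.
  by rewrite iterM; apply: iter_fix; exact: esym e.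
pose q (k : 'I_L.+1) := iter k f z.
have [N [Nn Ndis]] := separated_nbhds hM q.
have zV : nbhs z [set y | forall k : 'I_L.+1, N k (iter k f y)].
  apply: filter_forall => k.
  have := (strict_map_iter k (strict_map_f f)).1 z (N k) (Nn k).
  by [].
have [phi [ps [B hB] phiz supp]] := bump_at S hM zV.
exists phi; split=> //; first by exists B.
  move=> y j /andP[j0 jL]; apply/eqP; rewrite mulf_eq0; apply/negPn.
  rewrite negb_or; apply/negP => /andP[/supp /= h1 /supp /= h2].
  pose j' : 'I_L.+1 := inord j.
  have jE : j' = j :> nat by rewrite /j' inordK.
  have := Ndis j' ord0 (iter j f y); rewrite -{1}jE => /(_ (h1 j') (h2 ord0)).
  rewrite /q jE /= => e.
  have jL' : (j.-1 < L)%N by rewrite prednK.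
  by apply: (fz (Ordinal jL')); rewrite /= -iterS prednK.
move=> C.
pose c := phi z / 2; have c0 : 0 < c by rewrite divr_gt0.
have zc : nbhs z [set y | c <= phi y].
  have /cvgrPdist_le/(_ _ c0) := strict_fun_continuous ps (x := z).
  by apply: filterS => y /= h; rewrite /c in h *; exact: half_close h.
have vis (H : M -> M) : cluster (orbit_filter H x) z -> forall K, exists2 k, (K <= k)%N & c <= phi (iter k H x).
  move=> cl K; have [|y [[k [Kk <-]] yc]] := cl [set y | exists k, (K <= k)%N /\ iter k H x = y] _ _ zc.
    by exists K => // k Kk; exists k.
  by exists k.
have vis' (h : M -> M) : cluster (orbit_filter (iter n h) x) z -> forall K, exists2 k, (K <= k)%N & c <= phi (iter k h x).
  move=> /vis hv K; have [k Kk hk] := hv K; exists (k * n)%N; last by rewrite iterM.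
  by apply: (leq_trans Kk); rewrite leq_pmulr.
case: clz => /vis' hv.
  by have [k hk] := many_visits c0 hv C; exists x, k.
have [k hk] := many_visits c0 hv C; exists (iter k.-1 finv x), k.
rewrite (reindex_inj rev_ord_inj)/=.
apply: (le_trans hk); rewrite le_eqVlt; apply/orP; left; apply/eqP.
case: k {hk} => [|k]; first by rewrite !big_ord0.
apply: eq_bigr => i _; congr (phi _ ^+ 2).
have ik : (i <= k)%N by rewrite -ltnS.
have E : iter k finv x = iter (k - i) finv (iter i finv x) by rewrite -iterD subnK.
by rewrite subSS [k.+1.-1]/= E iter_diffeo_invK.
Qed.
End Visits.

(** * Mean squares of exponential sums *)

Section Fejer.
Variable R : realType.
Implicit Types (c : nat -> R) (t s : R).

Lemma sin_abs_le s : 0 <= s -> `|sin s| <= s.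
Proof.
move=> s0; have [c _] := @MVT_segment R sin cos 0 s s0 (fun x _ => is_derive_sin x)
  (continuous_subspaceT (@continuous_sin R)).
rewrite sin0 !subr0 => ->; rewrite normrM (ger0_norm s0) ler_piMl//.
by rewrite ler_norml cos_geN1 cos_le1.
Qed.

Lemma sqr_abs_le (a b : R) : `|a| <= b -> a ^+ 2 <= b ^+ 2.
Proof.
move=> ab; rewrite -(real_normK (num_real a)) ler_sqr ?nnegrE//.
exact: le_trans ab.
Qed.

Lemma cos_ge_half s : 0 <= s <= 1 -> 1 / 2 <= cos s.
Proof.
move=> /andP[s0 s1].
have h0 : 0 <= s / 2 by rewrite divr_ge0.
have h1 := sqr_abs_le (sin_abs_le h0).
rewrite {1}(splitr s) cosD -!expr2.
have := cos2Dsin2 (s / 2); have : (s / 2) ^+ 2 <= 1 / 4 by nra.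
move: h1; lra.
Qed.

Lemma sin_ge_half s : 0 <= s <= 1 -> s / 2 <= sin s.
Proof.
move=> /andP[s0 s1].
have [c + E] := @MVT_segment R sin cos 0 s s0 (fun x _ => is_derive_sin x)
  (continuous_subspaceT (@continuous_sin R)).
rewrite in_itv /= => /andP[c0 cs].
have := @cos_ge_half c; rewrite c0 (le_trans cs s1) => /(_ isT) h.
by move: E; rewrite sin0 !subr0 => ->; rewrite mulrC; have := ler_wpM2r s0 h; lra.
Qed.

(** Real and imaginary parts of the exponential sum
[sum_(k < n) c k exp (i k t)]; [trigE] is its square modulus. *)
Definition trigC c n t := \sum_(k < n) c k * cos (k%:R * t).
Definition trigS c n t := \sum_(k < n) c k * sin (k%:R * t).
Definition trigE c n t := trigC c n t ^+ 2 + trigS c n t ^+ 2.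

Lemma trigE_double c n t : trigE c n t =
  \sum_(k < n) \sum_(l < n) c k * c l * cos ((k%:R - l%:R) * t).
Proof.
rewrite /trigE !expr2 /trigC /trigS !big_distrlr /= -big_split /=.
apply: eq_bigr => k _; rewrite -big_split /=; apply: eq_bigr => l _.
by rewrite mulrBl cosB; ring.
Qed.

Lemma half_sq_le1 (x a b : R) : 2 * x = a + b -> -1 <= a <= 1 -> -1 <= b <= 1 ->
  x ^+ 2 <= 1.
Proof.
move=> e /andP[a1 a2] /andP[b1 b2]; rewrite -(expr1n R 2); apply: sqr_abs_le.
by rewrite ler_norml; lra.
Qed.

Definition ones : nat -> R := fun=> 1.

(** Multiplied by [2 sin (t / 2)], the real and the imaginary part of
the geometric sum telescope. *)
Lemma dirichlet_bound K t : 0 < `|t| <= 1 -> trigE ones K t <= 32 / t ^+ 2.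
Proof.
move=> /andP[t0 t1].
have t2 : 0 < t ^+ 2 by rewrite -real_normK ?num_real// exprn_gt0.
pose w := sin (t / 2).
have hw : t ^+ 2 / 16 <= w ^+ 2.
  have h : 0 <= `|t| / 2 <= 1.
    by rewrite divr_ge0//= ler_pdivrMr// mul1r (le_trans t1)// ler1n.
  have := sin_ge_half h.
  have -> : w ^+ 2 = sin (`|t| / 2) ^+ 2.
    rewrite /w; have [t0'|t0'] := leP 0 t; first by rewrite ger0_norm.
    by rewrite ltr0_norm// mulNr sinN sqrrN.
  rewrite -(real_normK (num_real t)); set a := `|t| in h *.
  have a0 : 0 <= a by exact: normr_ge0.
  move=> h2; have a4 : 0 <= a / 2 / 2 by rewrite !divr_ge0.
  have -> : a ^+ 2 / 16 = (a / 2 / 2) ^+ 2 by field.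
  by rewrite ler_sqr ?nnegrE// (le_trans a4).
have hC : 2 * w * trigC ones K t = sin ((K%:R - 2^-1) * t) + w.
  rewrite /trigC; elim: K => [|K IH].
    by rewrite big_ord0 mulr0 sub0r mulNr [2^-1 * t]mulrC sinN addNr.
  rewrite big_ord_recr/= mulrDr IH /ones mul1r.
  have -> : (K.+1%:R - 2^-1) * t = K%:R * t + t / 2 by rewrite -natr1; field.
  have -> : (K%:R - 2^-1) * t = K%:R * t - t / 2 by field.
  by rewrite sinB sinD /w; ring.
have hS : 2 * w * trigS ones K t = cos (t / 2) - cos ((K%:R - 2^-1) * t).
  rewrite /trigS; elim: K {hC} => [|K IH].
    by rewrite big_ord0 mulr0 sub0r mulNr [2^-1 * t]mulrC cosN subrr.
  rewrite big_ord_recr/= mulrDr IH /ones mul1r.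
  have -> : (K.+1%:R - 2^-1) * t = K%:R * t + t / 2 by rewrite -natr1; field.
  have -> : (K%:R - 2^-1) * t = K%:R * t - t / 2 by field.
  by rewrite cosB cosD /w; ring.
have bC : (w * trigC ones K t) ^+ 2 <= 1.
  rewrite -mulrA in hC; apply: half_sq_le1 hC _ _.
    by rewrite sin_geN1 sin_le1.
  by rewrite sin_geN1 sin_le1.
have bS : (w * trigS ones K t) ^+ 2 <= 1.
  rewrite -mulrA in hS; apply: half_sq_le1 hS _ _.
    by rewrite cos_geN1 cos_le1.
  by rewrite lerN2 cos_le1 lerNl cos_geN1.
rewrite ler_pdivlMr//.
have : trigE ones K t * w ^+ 2 <= 2.
  by move: bC bS; rewrite /trigE !exprMn; lra.
have E0 : 0 <= trigE ones K t by rewrite addr_ge0// sqr_ge0.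
have := ler_wpM2l E0 hw; lra.
Qed.

Lemma dirichlet_at0 K : trigE ones K 0 = K%:R ^+ 2.
Proof.
rewrite /trigE /trigC /trigS [X in _ + X ^+ 2]big1 ?expr0n ?addr0; last first.
  by move=> k _; rewrite mulr0 sin0 mulr0.
congr (_ ^+ 2); under eq_bigr do rewrite mulr0 cos0 mulr1.
by rewrite sumr_const card_ord.
Qed.

(** Averaging over the grid of the angles [d0 + (a - b) h] weights the term of
the pair [(k, l)] by the square modulus of a Dirichlet kernel, which is
nonnegative and small when [(k - l) h] is not close to 0: this is a Fejer
kernel.  The sine terms cancel by antisymmetry in [a] and [b]. *)
Lemma grid_sum c n K d0 h :
  \sum_(a < K) \sum_(b < K) trigE c n (d0 + (a%:R - b%:R) * h) =
  \sum_(k < n) \sum_(l < n) c k * c l * cos ((k%:R - l%:R) * d0) *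
     trigE ones K ((k%:R - l%:R) * h).
Proof.
under eq_bigr do under eq_bigr do rewrite trigE_double.
under eq_bigr do rewrite exchange_big/=.
rewrite exchange_big/=; apply: eq_bigr => k _.
under eq_bigr do rewrite exchange_big/=.
rewrite exchange_big/=; apply: eq_bigr => l _.
set r := k%:R - l%:R.
have -> : \sum_(a < K) \sum_(b < K) c k * c l * cos (r * (d0 + (a%:R - b%:R) * h)) =
  c k * c l * (cos (r * d0) * (\sum_(a < K) \sum_(b < K) cos ((a%:R - b%:R) * (r * h))) -
   sin (r * d0) * (\sum_(a < K) \sum_(b < K) sin ((a%:R - b%:R) * (r * h)))).
  rewrite !mulr_sumr -sumrB mulr_sumr; apply: eq_bigr => a _.
  rewrite !mulr_sumr -sumrB mulr_sumr; apply: eq_bigr => b _.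
  by congr (_ * _); rewrite -cosD; congr cos; ring.
have -> : \sum_(a < K) \sum_(b < K) sin ((a%:R - b%:R) * (r * h)) = 0.
  have E : \sum_(a < K) \sum_(b < K) sin ((a%:R - b%:R) * (r * h)) =
     trigS ones K (r * h) * trigC ones K (r * h) - trigC ones K (r * h) * trigS ones K (r * h).
    rewrite /trigS /trigC !big_distrlr/= -sumrB; apply: eq_bigr => a _.
    rewrite -sumrB; apply: eq_bigr => b _.
    by rewrite mulrBl sinB /ones; ring.
  by rewrite E mulrC subrr.
rewrite mulr0 subr0 mulrA; congr (_ * _); rewrite trigE_double.
by apply: eq_bigr => a _; apply: eq_bigr => b _; rewrite /ones !mul1r.
Qed.

(** Telescoping, as [1 / (p + 1)^2 <= 1 / p - 1 / (p + 1)]. *)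
Lemma inv_sq_tail (L p : nat) : (0 < L)%N ->
  \sum_(i < p) (if (L < i)%N then (i%:R ^+ 2)^-1 else 0 : R) <= L%:R^-1.
Proof.
move=> L0.
suff H : \sum_(i < p.+1) (if (L < i)%N then (i%:R ^+ 2)^-1 else 0 : R) <=
   L%:R^-1 - (maxn L p)%:R^-1.
  rewrite big_ord_recr/= in H.
  apply: (@le_trans _ _ (L%:R^-1 - (maxn L p)%:R^-1)); last first.
    by rewrite gerBl invr_ge0.
  apply: le_trans H; rewrite lerDl; case: ifP => // _; by rewrite invr_ge0 sqr_ge0.
elim: p => [|p IH]; first by rewrite big_ord1 ltn0 maxn0 subrr.
rewrite big_ord_recr/=; case: ifPn => [Lp|]; last first.
  rewrite -leqNgt => pL; rewrite addr0; apply: le_trans IH _.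
  by rewrite (maxn_idPl pL) (maxn_idPl (leq_trans (leqnSn p) pL)).
rewrite (maxn_idPr (ltnW Lp)); rewrite (maxn_idPr (Lp : (L <= p)%N)) in IH.
have p0 : 0 < p%:R :> R by rewrite ltr0n (leq_trans L0).
have : ((p.+1%:R : R) ^+ 2)^-1 <= p%:R^-1 - p.+1%:R^-1.
  rewrite -natr1; set x := p%:R in p0 *.
  have -> : x^-1 - (x + 1)^-1 = ((x * (x + 1)))^-1 by field; rewrite !gt_eqF// addr_gt0.
  rewrite lef_pV2 ?posrE ?mulr_gt0 ?exprn_gt0 ?addr_gt0//.
  by rewrite expr2 ler_pM2r ?addr_gt0// lerDl.
by move=> h; apply: le_trans (lerD IH h) _; rewrite addrA subrK.
Qed.

Lemma div_rearr (a d e : R) : a * (32 / e) / d = a * (32 / (d * e)).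
Proof. by rewrite invfM [d^-1 * e^-1]mulrC !mulrA. Qed.

Lemma cross_term (x y z D E : R) : 0 <= x -> 0 <= y -> -1 <= z -> 0 <= D ->
  D <= E -> - ((x ^+ 2 + y ^+ 2) / 2 * E) <= x * y * z * D.
Proof.
move=> x0 y0 z1 D0 DE; have xy := mulr_ge0 x0 y0.
have h1 : x * y * D <= (x ^+ 2 + y ^+ 2) / 2 * E.
  apply: ler_pM => //; have := sqr_ge0 (x - y); rewrite sqrrB; lra.
have h2 : - (x * y * D) <= x * y * z * D.
  rewrite -mulNr ler_wpM2r// -mulrN1 ler_wpM2l//.
by apply: le_trans h2; rewrite lerN2.
Qed.

(** The pairs on which the gap condition of [trig_lower] says nothing, weighted by
the decay of the kernel in [dirichlet_bound]. *)
Definition far (L k l : nat) : R :=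
  if (L < k - l)%N || (L < l - k)%N then ((k%:R - l%:R) ^+ 2)^-1 else 0.

Lemma far_sym L k l : far L k l = far L l k.
Proof. by rewrite /far orbC -[in RHS]sqrrN opprB. Qed.

Lemma far_row L n (k : 'I_n) : (0 < L)%N -> \sum_(l < n) far L k l <= 2 / L%:R.
Proof.
move=> L0; rewrite -(big_mkord xpredT (fun l => far L k l)).
rewrite (big_cat_nat (n := k)) ?(ltnW (ltn_ord k))//=.
have -> : 2 / L%:R = L%:R^-1 + L%:R^-1 :> R by rewrite mulr_natl mulr2n.
apply: lerD.
  apply: le_trans (inv_sq_tail k.+1 L0).
  rewrite big_nat_rev/= -(big_mkord xpredT (fun i => if (L < i)%N then (i%:R ^+ 2)^-1 else 0 : R)).
  rewrite big_nat_recl// ltn0 add0r [leLHS]big_nat [leRHS]big_nat; apply: ler_sum => i /andP[_ ik].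
  rewrite /far add0n.
  have -> : (k - (k - i.+1))%N = i.+1 by rewrite subKn.
  have -> : (k - i.+1 - k)%N = 0%N by apply/eqP; rewrite subn_eq0 leq_subr.
  rewrite ltn0 orbF; case: ifP => // _.
  by rewrite natrB// opprB addrC subrK.
apply: le_trans (inv_sq_tail (n - k) L0).
rewrite -{1}[k : nat]add0n big_addn -(big_mkord xpredT (fun i => if (L < i)%N then (i%:R ^+ 2)^-1 else 0 : R)).
rewrite [leLHS]big_nat [leRHS]big_nat; apply: ler_sum => i _.
rewrite /far addnK.
have -> : (k - (i + k))%N = 0%N by apply/eqP; rewrite subn_eq0 leq_addl.
rewrite ltn0 /=; case: ifP => // _.
by rewrite natrD opprD addrCA subrr addr0 sqrrN.
Qed.

(** The angle is found on a grid of step [h = l / K], where [K >= l n] so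
that [dirichlet_bound] applies to all [(k - j) h].  Let [Q] be the sum of the
squares.  In the sum over the grid the diagonal contributes [K^2 Q]; the
remaining pairs contribute at least [- (32 / h^2) Q (2 / L)], which is at least
[- K^2 Q / 2] by the choice of [L].  So the mean over the [K^2] points of the
grid is at least [Q / 2]. *)
Lemma trig_lower c n (L : nat) d0 l :
  0 < l -> 128 / l ^+ 2 <= L%:R -> (0 < L)%N -> (forall k, 0 <= c k) ->
  (forall k j, (0 < j <= L)%N -> c k * c (k + j)%N = 0) ->
  exists2 t, `|t - d0| < l & (\sum_(k < n) c k ^+ 2) / 2 <= trigE c n t.
Proof.
move=> l0 hL L0 c0 gap.
pose K := (Num.truncn (l * n%:R)).+1.
have K0 : 0 < K%:R :> R by rewrite ltr0n.
have Kn : l * n%:R <= K%:R by apply: ltW; exact: truncnS_gt.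
pose h := l / K%:R; have h0 : 0 < h by rewrite divr_gt0.
have Kh : K%:R * h = l by rewrite /h mulrC divfK ?gt_eqF.
have nh : n%:R * h <= 1 by rewrite /h mulrA ler_pdivrMr// mul1r mulrC.
set Q := \sum_(k < n) c k ^+ 2.
have Q0 : 0 <= Q by apply: sumr_ge0 => i _; exact: sqr_ge0.
have K2 : 0 < K%:R ^+ 2 :> R by rewrite exprn_gt0.
have h2 : 0 < h ^+ 2 by rewrite exprn_gt0.
have term (k j : 'I_n) : (if k == j then c k ^+ 2 * K%:R ^+ 2 else 0) -
    (c k ^+ 2 + c j ^+ 2) / 2 * (32 / h ^+ 2) * far L k j <=
    c k * c j * cos ((k%:R - j%:R) * d0) * trigE ones K ((k%:R - j%:R) * h).
  have [<-|kj] := eqVneq k j.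
    rewrite /far subnn ltn0 /= mulr0 subr0 subrr !mul0r cos0 dirichlet_at0 mulr1.
    by rewrite expr2.
  rewrite sub0r /far; case: ifPn => [kjL|].
    have kjR : 0 < `|(k%:R - j%:R) * h| <= 1.
      rewrite normrM (gtr0_norm h0) pmulr_lgt0// normr_gt0 subr_eq0 eqr_nat kj /=.
      apply: le_trans nh; rewrite ler_pM2r//.
      have := ltn_ord k; have := ltn_ord j; rewrite -!(ltr_nat R) => j1 k1.
      have := ler0n R k; have := ler0n R j; rewrite ler_norml; lra.
    have hD := dirichlet_bound K kjR; rewrite exprMn in hD.
    have D0 : 0 <= trigE ones K ((k%:R - j%:R) * h) by rewrite addr_ge0// sqr_ge0.
    have kj2 : 0 < (k%:R - j%:R) ^+ 2 :> R.
      by rewrite lt_neqAle sqr_ge0 andbT eq_sym sqrf_eq0 subr_eq0 eqr_nat.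
    have -> : (c k ^+ 2 + c j ^+ 2) / 2 * (32 / h ^+ 2) * ((k%:R - j%:R) ^+ 2)^-1 =
        (c k ^+ 2 + c j ^+ 2) / 2 * (32 / ((k%:R - j%:R) ^+ 2 * h ^+ 2)).
      exact: div_rearr.
    exact: cross_term (c0 k) (c0 j) (cos_geN1 _) D0 hD.
  rewrite negb_or -!leqNgt !leq_subLR => /andP[k1 j1].
  have ckj : c k * c j = 0.
    have [lt|gt|e] := ltngtP k j.
    - by rewrite -(subnKC (ltnW lt)); apply: gap; rewrite subn_gt0 lt /= leq_subLR.
    - by rewrite mulrC -(subnKC (ltnW gt)); apply: gap; rewrite subn_gt0 gt /= leq_subLR.
    - by move: kj; rewrite -val_eqE /= e eqxx.
  by rewrite ckj mulr0 !mul0r oppr0.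
have total : K%:R ^+ 2 * (Q / 2) <= \sum_(a < K) \sum_(b < K) trigE c n (d0 + (a%:R - b%:R) * h).
  rewrite grid_sum.
  apply: (@le_trans _ _ (\sum_(k < n) \sum_(j < n) ((if k == j then c k ^+ 2 * K%:R ^+ 2 else 0) -
    (c k ^+ 2 + c j ^+ 2) / 2 * (32 / h ^+ 2) * far L k j))); last first.
    by apply: ler_sum => k _; apply: ler_sum => j _; exact: term.
  under eq_bigr do rewrite sumrB; rewrite sumrB.
  have -> : \sum_(k < n) \sum_(j < n) (if k == j then c k ^+ 2 * K%:R ^+ 2 else 0) = Q * K%:R ^+ 2.
    rewrite /Q mulr_suml; apply: eq_bigr => k _.
    by rewrite (bigD1 k)//= eqxx big1 ?addr0// => j jk; rewrite eq_sym (negbTE jk).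
  have far0 k j : 0 <= far L k j.
    by rewrite /far; case: ifP => // _; rewrite invr_ge0 sqr_ge0.
  have -> : \sum_(k < n) \sum_(j < n) (c k ^+ 2 + c j ^+ 2) / 2 * (32 / h ^+ 2) * far L k j =
      (32 / h ^+ 2) * \sum_(k < n) c k ^+ 2 * \sum_(j < n) far L k j.
    have E1 : \sum_(k < n) \sum_(j < n) (c k ^+ 2) * far L k j = \sum_(k < n) c k ^+ 2 * \sum_(j < n) far L k j.
      by apply: eq_bigr => k _; rewrite mulr_sumr.
    have E2 : \sum_(k < n) \sum_(j < n) (c j ^+ 2) * far L k j = \sum_(k < n) c k ^+ 2 * \sum_(j < n) far L k j.
      rewrite exchange_big/= -E1; apply: eq_bigr => k _; apply: eq_bigr => j _.
      by rewrite far_sym.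
    have -> : \sum_(k < n) c k ^+ 2 * \sum_(j < n) far L k j =
      (\sum_(k < n) \sum_(j < n) (c k ^+ 2) * far L k j + \sum_(k < n) \sum_(j < n) (c j ^+ 2) * far L k j) / 2.
      by rewrite E1 E2; lra.
    rewrite -big_split/= mulr_suml mulr_sumr; apply: eq_bigr => k _.
    rewrite -big_split/= mulr_suml mulr_sumr; apply: eq_bigr => j _.
    by field; rewrite gt_eqF.
  have S1 : \sum_(k < n) c k ^+ 2 * \sum_(j < n) far L k j <= Q * (2 / L%:R).
    rewrite /Q mulr_suml; apply: ler_sum => k _.
    by rewrite ler_wpM2l ?sqr_ge0//; exact: far_row.
  have S2 : 32 / h ^+ 2 * (Q * (2 / L%:R)) <= K%:R ^+ 2 * (Q / 2).
    have -> : 32 / h ^+ 2 * (Q * (2 / L%:R)) = (128 / l ^+ 2 / L%:R) * (K%:R ^+ 2 * (Q / 2)).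
      by rewrite /h; field; rewrite !gt_eqF// ltr0n.
    by rewrite ler_piMl ?mulr_ge0 ?(ltW K2)// ler_pdivrMr ?mul1r ?ltr0n.
  have S3 : 32 / h ^+ 2 * \sum_(k < n) c k ^+ 2 * \sum_(j < n) far L k j <= 32 / h ^+ 2 * (Q * (2 / L%:R)).
    by rewrite ler_wpM2l// divr_ge0// ltW.
  have := le_trans S3 S2; rewrite [Q * K%:R ^+ 2]mulrC; lra.
apply: contrapT => no.
have small (a b : 'I_K) : trigE c n (d0 + (a%:R - b%:R) * h) < Q / 2.
  rewrite ltNge; apply/negP => le; apply: no; exists (d0 + (a%:R - b%:R) * h) => //.
  rewrite addrAC subrr add0r normrM (gtr0_norm h0) -Kh ltr_pM2r//.
  have := ltn_ord a; have := ltn_ord b; rewrite -!(ltr_nat R) => h3 h4.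
  have := ler0n R a; have := ler0n R b; rewrite ltr_norml; lra.
have : \sum_(a < K) \sum_(b < K) trigE c n (d0 + (a%:R - b%:R) * h) < \sum_(a < K) \sum_(b < K) (Q / 2).
  apply: ltr_sum; first by apply/hasP; exists ord0; rewrite ?mem_index_enum.
  move=> a _; apply: ltr_sum => [|b _]; last exact: small.
  by apply/hasP; exists ord0; rewrite ?mem_index_enum.
move=> lt; have := le_lt_trans total lt.
by rewrite !sumr_const !card_ord -mulrnA -[_ *+ (K * K)]mulr_natl natrM expr2 ltxx.
Qed.
End Fejer.

(** * Resonance with unbounded twisted sums *)

Lemma sq_sum_le (R : realType) (p q : R) : p ^+ 2 + q ^+ 2 <= (`|p| + `|q|) ^+ 2.
Proof.
rewrite -(real_normK (num_real p)) -(real_normK (num_real q)) sqrrD.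
have := mulr_ge0 (normr_ge0 p) (normr_ge0 q); lra.
Qed.

Lemma le_sq_sum (R : realType) (p q : R) : (`|p| + `|q|) ^+ 2 <= 2 * (p ^+ 2 + q ^+ 2).
Proof.
rewrite -(real_normK (num_real p)) -(real_normK (num_real q)).
have := sqr_ge0 (`|p| - `|q|); rewrite sqrrB sqrrD; lra.
Qed.

Lemma large_square (R : realType) (b o E : R) : 0 <= b -> b * 2 + 1 <= o ->
  o ^+ 2 <= 2 * E -> b <= E.
Proof.
move=> b0 bo oE; have : (b * 2 + 1) ^+ 2 <= o ^+ 2.
  by rewrite ler_sqr ?nnegrE//; lra.
have := sqr_ge0 b; rewrite sqrrD exprMn; lra.
Qed.

Lemma tri_lip (R : realType) (w1 w2 v1 v2 k a b e : R) : `|w1 - v1| <= k ->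
  `|w2 - v2| <= k -> `|v1 - v2| <= a -> a <= b -> 2 * k <= e -> `|w1 - w2| <= b + e.
Proof. by rewrite !ler_norml => /andP[? ?] /andP[? ?] /andP[? ?] ? ?; apply/andP; split; lra. Qed.

Lemma near_radius (R : realType) (t0 : R) (P : R -> Prop) :
  (\forall t \near t0, P t) -> exists2 r, 0 < r & forall t, `|t - t0| < r -> P t.
Proof.
move=> /nbhs_ballP[r /= r0 hr]; exists r => // t tr; apply: hr.
by rewrite -ball_normE /= distrC.
Qed.

Section Resonance.
Variables (R : realType) (X : Type) (f : X -> X).
Variable dle : X -> X -> R -> Prop.
Hypothesis dle_ge0 : forall x y r, dle x y r -> 0 <= r.

(** [w] is bounded by [K] and [K]-Lipschitz, where [dle x y r] says that [x]
and [y] are at distance at most [r].  Using a relation avoids the infinite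
values of the Riemannian distance. *)
Definition bounded_lip (K : R) (w : X -> R) :=
  (forall x, `|w x| <= K) /\ forall x y r, dle x y r -> `|w x - w y| <= K * r.

(** Comparable with the modulus of the exponential sum along the orbit of
[x], but easier to perturb linearly. *)
Definition trig_size (w : X -> R) n x t : R :=
  `|trigC (fun k => w (iter k f x)) n t| + `|trigS (fun k => w (iter k f x)) n t|.

Lemma bounded_lipD K L w v : bounded_lip K w -> bounded_lip L v -> bounded_lip (K + L) (fun x => w x + v x).
Proof.
move=> [w1 w2] [v1 v2]; split=> [x|x y r xy].
  by rewrite (le_trans (ler_normD _ _))// lerD.
rewrite opprD addrACA (le_trans (ler_normD _ _))// mulrDl lerD//; [exact: w2|exact: v2].
Qed.

Lemma bounded_lipZ K a w : 0 <= a -> bounded_lip K w -> bounded_lip (a * K) (fun x => a * w x).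
Proof.
move=> a0 [w1 w2]; split=> [x|x y r xy].
  by rewrite normrM ger0_norm// ler_wpM2l.
by rewrite -mulrBr normrM ger0_norm// -mulrA ler_wpM2l//; exact: w2.
Qed.

Lemma trig_size_ge0 w n x t : 0 <= trig_size w n x t. Proof. by rewrite addr_ge0. Qed.

Lemma trig_size_sq_ge w n x t : trigE (fun k => w (iter k f x)) n t <= trig_size w n x t ^+ 2.
Proof. exact: sq_sum_le. Qed.

Lemma trig_size_sq_le w n x t : trig_size w n x t ^+ 2 <= 2 * trigE (fun k => w (iter k f x)) n t.
Proof. exact: le_sq_sum. Qed.

Lemma trigC_lin (w v : X -> R) (a : R) n x t : trigC (fun k => w (iter k f x) + a * v (iter k f x)) n t =
  trigC (fun k => w (iter k f x)) n t + a * trigC (fun k => v (iter k f x)) n t.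
Proof. by rewrite /trigC mulr_sumr -big_split/=; apply: eq_bigr => k _; ring. Qed.

Lemma trigS_lin (w v : X -> R) (a : R) n x t : trigS (fun k => w (iter k f x) + a * v (iter k f x)) n t =
  trigS (fun k => w (iter k f x)) n t + a * trigS (fun k => v (iter k f x)) n t.
Proof. by rewrite /trigS mulr_sumr -big_split/=; apply: eq_bigr => k _; ring. Qed.

Lemma trig_size_add (w v : X -> R) (a : R) n x t : 0 <= a ->
  a * trig_size v n x t - trig_size w n x t <= trig_size (fun y => w y + a * v y) n x t.
Proof.
move=> a0; rewrite /trig_size trigC_lin trigS_lin.
have aux (p q : R) : a * `|q| - `|p| <= `|p + a * q|.
  have h := lerB_normD (a * q) p.
  by rewrite normrM (ger0_norm a0) [a * q + p]addrC in h.
have := aux (trigC (fun k => w (iter k f x)) n t) (trigC (fun k => v (iter k f x)) n t).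
have := aux (trigS (fun k => w (iter k f x)) n t) (trigS (fun k => v (iter k f x)) n t).
lra.
Qed.

Lemma trig_size_close (w v : X -> R) n x t (k : R) : (forall y, `|w y - v y| <= k) ->
  trig_size v n x t <= trig_size w n x t + 2 * (n%:R * k).
Proof.
move=> wv; rewrite /trig_size.
have auxC : `|trigC (fun k => v (iter k f x)) n t| <= `|trigC (fun k => w (iter k f x)) n t| + n%:R * k.
  rewrite -lerBlDl (le_trans (lerB_dist _ _))// /trigC -sumrB.
  rewrite (le_trans (ler_norm_sum _ _ _))//.
  have -> : n%:R * k = \sum_(i < n) k by rewrite sumr_const card_ord mulr_natl.
  apply: ler_sum => i _; rewrite -mulrBl normrM distrC -[k]mulr1; apply: ler_pM => //.
  by rewrite ler_norml cos_geN1 cos_le1.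
have auxS : `|trigS (fun k => v (iter k f x)) n t| <= `|trigS (fun k => w (iter k f x)) n t| + n%:R * k.
  rewrite -lerBlDl (le_trans (lerB_dist _ _))// /trigS -sumrB.
  rewrite (le_trans (ler_norm_sum _ _ _))//.
  have -> : n%:R * k = \sum_(i < n) k by rewrite sumr_const card_ord mulr_natl.
  apply: ler_sum => i _; rewrite -mulrBl normrM distrC -[k]mulr1; apply: ler_pM => //.
  by rewrite ler_norml sin_geN1 sin_le1.
lra.
Qed.

Lemma trig_size_continuous w n x : continuous (trig_size w n x).
Proof.
have cl (h : R -> R) : continuous h -> continuous (fun t : R => \sum_(k < n) w (iter k f x) * h (k%:R * t)).
  move=> hc t; rewrite /continuous_at.
  elim: n => [|n' IH].
    rewrite big_ord0 (_ : (fun _ => _) = cst 0); first exact: cvg_cst.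
    by apply/funext => s; rewrite big_ord0.
  rewrite big_ord_recr/= (_ : (fun _ => _) = (fun s : R => \sum_(k < n') w (iter k f x) * h (k%:R * s)) \+
     (fun s : R => w (iter n' f x) * h (n'%:R * s))).
    apply: cvgD => //; apply: cvgM; first exact: cvg_cst.
    apply: (@continuous_comp _ _ _ (fun s : R => n'%:R * s) h); last exact: hc.
    by apply: continuousM; [exact: cst_continuous|exact: cvg_id].
  by apply/funext => s; rewrite big_ord_recr.
have cC : continuous (fun t => `|trigC (fun k => w (iter k f x)) n t|).
  move=> t; apply: (@continuous_comp _ _ _ (trigC (fun k => w (iter k f x)) n) (fun r : R => `|r|)).
    exact: (cl cos (@continuous_cos R)).
  exact: norm_continuous.
have cS : continuous (fun t => `|trigS (fun k => w (iter k f x)) n t|).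
  move=> t; apply: (@continuous_comp _ _ _ (trigS (fun k => w (iter k f x)) n) (fun r : R => `|r|)).
    exact: (cl sin (@continuous_sin R)).
  exact: norm_continuous.
by move=> t; exact: (cvgD (cC t) (cS t)).
Qed.

(** If the cosine is 1 at [d], then the sine vanishes there and moves off
0 nearby. *)
Lemma cos_ne1_dense (k : nat) (d r : R) : 0 < r ->
  exists2 t, `|t - d| < r & cos (k.+1%:R * t) != 1.
Proof.
move=> r0; have [c1|c1] := eqVneq (cos (k.+1%:R * d)) 1; last first.
  by exists d => //; rewrite subrr normr0.
have s0 : sin (k.+1%:R * d) = 0.
  have := cos2Dsin2 (k.+1%:R * d); rewrite c1 expr1n => h.
  by apply/eqP; rewrite -sqrf_eq0; apply/eqP; move: h; lra.
have k0 : 0 < k.+1%:R :> R by rewrite ltr0n.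
pose e := Num.min (r / 2) (k.+1%:R^-1).
have e0 : 0 < e by rewrite lt_min divr_gt0// invr_gt0.
have er : e < r by rewrite gt_min ltr_pdivrMr// ltr_pMr// ltr1n.
have ek : 0 <= k.+1%:R * e <= 1.
  rewrite mulr_ge0 ?(ltW e0) ?(ltW k0)//= -ler_pdivlMl// mulr1.
  by rewrite ge_min lexx orbT.
exists (d + e); first by rewrite addrAC subrr add0r gtr0_norm.
rewrite mulrDr cosD c1 s0 mul0r subr0 mul1r.
have := sin_ge_half ek; have : 0 < k.+1%:R * e by rewrite mulr_gt0.
move=> p0 p1; apply/eqP => c1'; have := cos2Dsin2 (k.+1%:R * e); rewrite c1' expr1n.
have : 0 < sin (k.+1%:R * e) ^+ 2 by rewrite exprn_gt0//; lra.
lra.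
Qed.

Lemma nested_intervals (a b : nat -> R) :
  (forall k, a k <= a k.+1) -> (forall k, b k.+1 <= b k) -> (forall k, a k <= b k) ->
  exists t, forall k, a k <= t <= b k.
Proof.
move=> am bm ab.
have am' i d : a i <= a (i + d)%N.
  by elim: d => [|d IH]; rewrite ?addn0// addnS (le_trans IH).
have bm' i d : b (i + d)%N <= b i.
  by elim: d => [|d IH]; rewrite ?addn0// addnS (le_trans _ IH).
have abij i j : a i <= b j.
  apply: (le_trans (am' i j)); apply: (le_trans (ab _)).
  by rewrite addnC.
exists (sup (range a)) => k; apply/andP; split.
  apply: ub_le_sup; last by exists k.
  by exists (b 0%N) => _ [i _ <-].
apply: ge_sup; first by exists (a 0%N); exists 0%N.
by move=> _ [i _ <-].
Qed.

(** A stage of the construction: the function reached so far, the centre and the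
half-width of the interval of admissible angles, and a uniform bound for the sum
of all later corrections to the function. *)
Record state := State { st_fun : X -> R ; st_angle : R ; st_width : R ; st_tol : R }.

Variable eps : R.
(** The last clause leaves room for the later corrections within the
final Lipschitz bound. *)
Definition admissible (s : state) := [/\ 0 < st_width s, 0 < st_tol s,
  0 < st_angle s - st_width s, st_angle s + st_width s < eps &
  exists2 a : R, bounded_lip a (st_fun s) & a + st_tol s <= eps].

(** The last clause is the point of the [k]-th refinement: it holds for every
function and angle that the later stages can lead to. *)
Definition refines k (s s' : state) := [/\ st_angle s - st_width s <= st_angle s' - st_width s',
  st_angle s' + st_width s' <= st_angle s + st_width s,
  forall x, `|st_fun s' x - st_fun s x| <= st_tol s / 2,
  st_tol s' <= st_tol s / 2 &
  forall w t, `|t - st_angle s'| <= st_width s' -> (forall x, `|w x - st_fun s' x| <= st_tol s') ->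
    cos (k.+1%:R * t) != 1 /\ exists n x, k%:R <= trig_size w n x t].

Hypothesis resonant : forall d l : R, 0 < l -> exists2 phi, exists K, bounded_lip K phi &
  forall B : R, exists t n x, `|t - d| < l /\ B <= trigE (fun k => phi (iter k f x)) n t.

(** If no angle of the interval already makes a sum of the current
function large, add a small multiple of [phi]: at some angle of the interval its
sum is so large that subtracting the moderate sum of the current function does
not matter.  A finite sum is continuous in the angle and in the function, so it
remains large nearby, and the angle can be moved slightly to make the cosine
different from 1. *)
Lemma refines_exists k s : admissible s -> exists s', admissible s' /\ refines k s s'.
Proof.
move=> [l0 k0 dl dr [a aW ak]].
have [phi [K hK] hphi] := resonant (st_angle s) l0.
have K0 : 0 < `|K| + 1 by rewrite ltr_wpDl.
pose c := st_tol s / 2 / (`|K| + 1).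
have c0 : 0 < c by rewrite !divr_gt0.
have [W [c' [c'0 c'1 WE [t0 [n [x [t0d big]]]]]]] : exists (W : X -> R) (c' : R),
   [/\ 0 <= c', c' <= c, W = (fun y => st_fun s y + c' * phi y) &
     exists t0 n x, `|t0 - st_angle s| < st_width s /\ k%:R + 2 <= trig_size W n x t0].
  have [[t0 [n [x [h1 h2]]]]|no] := pselect (exists t0 n x, `|t0 - st_angle s| < st_width s /\ k%:R + 2 <= trig_size (st_fun s) n x t0).
    exists (st_fun s), 0; split=> //; first exact: ltW.
      by apply/funext => y; rewrite mul0r addr0.
    by exists t0, n, x.
  exists (fun y => st_fun s y + c * phi y), c; split=> //; first exact: ltW.
  have [t0 [n [x [h1 h2]]]] := hphi (((2 * k%:R + 4) / c) ^+ 2).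
  exists t0, n, x; split=> //.
  have h3 : trig_size (st_fun s) n x t0 < k%:R + 2.
    by rewrite ltNge; apply/negP => h; apply: no; exists t0, n, x.
  have h4 : (2 * k%:R + 4) / c <= trig_size phi n x t0.
    have := le_trans h2 (trig_size_sq_ge phi n x t0).
    have kk : 0 <= (2 * k%:R + 4) / c by rewrite divr_ge0 ?(ltW c0)// addr_ge0// mulr_ge0.
    by rewrite ler_sqr ?nnegrE ?trig_size_ge0.
  apply: le_trans (trig_size_add (st_fun s) phi n x t0 (ltW c0)).
  move: h4; rewrite ler_pdivrMr// [_ * c]mulrC; lra.
have WsW y : `|W y - st_fun s y| <= st_tol s / 2.
  rewrite WE addrAC subrr add0r normrM (ger0_norm c'0).
  apply: (@le_trans _ _ (c * (`|K| + 1))); last by rewrite /c divfK ?gt_eqF.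
  by apply: ler_pM => //; rewrite (le_trans (hK.1 y))// (le_trans (ler_norm _))// lerDl.
have [r r0 hr] : exists2 r, 0 < r & forall t, `|t - t0| < r -> k%:R + 1 <= trig_size W n x t.
  have /cvgrPdist_le/(_ _ (ltr01 : 0 < (1:R))) := @trig_size_continuous W n x t0.
  move=> /near_radius[r r0 hr]; exists r => // t tr.
  have := hr t tr; rewrite ler_norml; lra.
pose r1 := Num.min r (st_width s - `|t0 - st_angle s|).
have r10 : 0 < r1 by rewrite lt_min r0 subr_gt0.
have [t1 t1r t1c] := cos_ne1_dense k t0 r10.
have [r2 r20 hr2] : exists2 r2, 0 < r2 & forall t, `|t - t1| < r2 -> cos (k.+1%:R * t) != 1.
  have cc : continuous (fun t : R => cos (k.+1%:R * t)).
    move=> t; apply: (@continuous_comp _ _ _ (fun s : R => k.+1%:R * s) cos); last exact: continuous_cos.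
    by apply: continuousM; [exact: cst_continuous|exact: cvg_id].
  have p0 : 0 < `|1 - cos (k.+1%:R * t1)| / 2 by rewrite divr_gt0// normr_gt0 subr_eq0 eq_sym.
  have /cvgrPdist_le/(_ _ p0) := cc t1.
  move=> /near_radius[r2 r20 h]; exists r2 => // t tr; apply/eqP => e.
  have := h t tr; rewrite e distrC; lra.
pose l' := Num.min (r2 / 2) ((r1 - `|t1 - t0|) / 2).
have l'0 : 0 < l' by rewrite lt_min !divr_gt0// subr_gt0.
have l'2 : l' < r2 by rewrite gt_min ltr_pdivrMr// ltr_pMr// ltr1n.
have l'1 : l' < r1 - `|t1 - t0|.
  by rewrite gt_min orbC ltr_pdivrMr// ltr_pMr ?ltr1n// subr_gt0.
pose k' := Num.min (st_tol s / 2) (1 / (2 * (n%:R + 1))).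
have n1 : 0 < 2 * (n%:R + 1) :> R by rewrite mulr_gt0// ltr_wpDl.
have k'0 : 0 < k' by rewrite lt_min !divr_gt0.
have k'1 : k' <= st_tol s / 2 by rewrite ge_min lexx.
have k'2 : 2 * (n%:R * k') <= 1.
  have : k' <= 1 / (2 * (n%:R + 1)) by rewrite ge_min lexx orbT.
  rewrite ler_pdivlMr// => h; apply: le_trans h; rewrite mulrCA mulrA mulrC.
  by rewrite ler_wpM2l ?(ltW k'0)// mulrC ler_wpM2l// lerDl.
have r1l : r1 <= st_width s - `|t0 - st_angle s| by rewrite ge_min lexx orbT.
have r1r : r1 <= r by rewrite ge_min lexx.
have := ler_norm (t1 - t0); have := ler_norm (t0 - t1); rewrite [`|t0 - t1|]distrC => n1' n2'.
have := ler_norm (t0 - st_angle s); have := ler_norm (st_angle s - t0); rewrite [`|st_angle s - t0|]distrC => n3' n4'.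
have b1 : st_angle s - st_width s <= t1 - l' by lra.
have b2 : t1 + l' <= st_angle s + st_width s by lra.
exists (State W t1 l' k'); split.
  split=> //=; [lra|lra|].
  exists (a + st_tol s / 2).
    have := bounded_lipD aW (bounded_lipZ c'0 hK); rewrite -WE => -[u1 u2].
    have c'K : c' * K <= st_tol s / 2.
      apply: (@le_trans _ _ (c * (`|K| + 1))); last by rewrite /c divfK ?gt_eqF.
      apply: (@le_trans _ _ (c' * (`|K| + 1))); last by rewrite ler_wpM2r// ltW.
      by rewrite ler_wpM2l// (le_trans (ler_norm _))// lerDl.
    split=> [y|y z q yz].
      by apply: (le_trans (u1 y)); rewrite lerD2l.
    apply: (le_trans (u2 _ _ _ yz)); rewrite ler_wpM2r ?lerD2l//.
    exact: dle_ge0 yz.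
  lra.
split=> //= w t tl hw.
have tr1 : `|t - t0| < r1.
  by have := ler_distD t1 t t0; lra.
split; first by apply: hr2; apply: le_lt_trans l'2.
exists n, x.
have := trig_size_close n x t hw; have := hr t (lt_le_trans tr1 r1r); lra.
Qed.

(** Limit of a sequence of refinements.  The limit function satisfies the
Lipschitz bound because each approximation does and the tolerances tend to 0. *)
Lemma resonance : 0 < eps -> exists d w, [/\ 0 < d < eps,
   bounded_lip eps w, forall k, cos (k.+1%:R * d) != 1 &
   forall B : R, exists n x, B <= trigE (fun k => w (iter k f x)) n d].
Proof.
move=> e0.
(* the final angle stays in the interval from [eps / 4] to [3 eps / 4] *)
pose s0 := State (fun _ => 0) (eps / 2) (eps / 4) eps.
have inv0 : admissible s0.
  split=> //=; try lra.
  exists 0; last by rewrite add0r.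
  by split=> [x|x y r _]; rewrite ?subrr normr0 ?mul0r.
have stepex (ks : nat * state) : exists s', admissible ks.2 -> admissible s' /\ refines ks.1 ks.2 s'.
  have [i|ni] := pselect (admissible ks.2); last by exists ks.2.
  by have [s' h] := refines_exists ks.1 i; exists s'.
have [nx hnx] := choice stepex.
pose s := fix s n := if n is k.+1 then nx (k, s k) else s0.
have sinv n : admissible (s n) by elim: n => //= n IH; exact: (hnx (n, s n) IH).1.
have sstep n : refines n (s n) (s n.+1) by exact: (hnx (n, s n) (sinv n)).2.
have [d hd] : exists d, forall k, st_angle (s k) - st_width (s k) <= d <= st_angle (s k) + st_width (s k).
  apply: nested_intervals => k.
  - by have [] := sstep k.
  - by have [] := sstep k.
  - by have [] := sinv k; lra.
have hw x : exists t, forall k, st_fun (s k) x - st_tol (s k) <= t <= st_fun (s k) x + st_tol (s k).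
  apply: nested_intervals => k.
  - by have [_ _ /(_ x) h1 h2 _] := sstep k; move: h1; rewrite ler_norml; lra.
  - by have [_ _ /(_ x) h1 h2 _] := sstep k; move: h1; rewrite ler_norml; lra.
  - by have [] := sinv k; lra.
have [w ww] := choice hw.
have wW k x : `|w x - st_fun (s k) x| <= st_tol (s k).
  by have := ww x k; rewrite ler_norml; lra.
have dD k : `|d - st_angle (s k)| <= st_width (s k).
  by have := hd k; rewrite ler_norml; lra.
exists d, w; split.
- have := hd 0%N; rewrite /=; lra.
- split=> [x|x y r xy].
    have [_ _ _ _ [a [a1 _] ak]] := sinv 0%N.
    have := wW 0%N x; have := a1 x; rewrite !ler_norml; lra.
  have skk k : st_tol (s k) <= eps / 2 ^+ k.
    elim: k => [|k IH]; first by rewrite expr0 divr1.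
    have [_ _ _ h _] := sstep k; apply: (le_trans h).
    have -> : eps / 2 ^+ k.+1 = eps / 2 ^+ k / 2 by rewrite exprS invfM mulrA mulrAC.
    by rewrite ler_pM2r ?invr_gt0.
  apply/ler_addgt0Pr => e e'0.
  pose k := (Num.truncn (2 * eps / e)).+1.
  have ke : 2 * eps / e <= 2 ^+ k.
    apply: (@le_trans _ _ k%:R); first by apply: ltW; exact: truncnS_gt.
    by rewrite -natrX ler_nat ltnW// ltn_expl.
  have k2 : 2 * st_tol (s k) <= e.
    apply: (@le_trans _ _ (2 * (eps / 2 ^+ k))); first by rewrite ler_pM2l.
    by rewrite mulrA ler_pdivrMr ?exprn_gt0// [e * _]mulrC -ler_pdivrMr.
  have [_ k0 _ _ [a [_ a2] ak]] := sinv k.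
  have h1 := wW k x; have h2 := wW k y; have h3 := a2 _ _ _ xy.
  have r0 := dle_ge0 xy.
  have h4 : a * r <= eps * r by rewrite ler_wpM2r//; lra.
  exact: tri_lip h1 h2 h3 h4 k2.
- by move=> k; have [_ _ _ _ h] := sstep k; exact: (h w d (dD _) (wW _)).1.
move=> B; pose k := (Num.truncn (`|B| * 2 + 1)).+1.
have [_ _ _ _ h] := sstep k; have [_ [n [x hn]]] := h w d (dD _) (wW _).
exists n, x; have h2 := trig_size_sq_le w n x d.
have kB : `|B| * 2 + 1 <= k%:R by apply: ltW; exact: truncnS_gt.
apply: (le_trans (ler_norm B)).
exact: large_square (normr_ge0 B) (le_trans kB hn) h2.
Qed.
End Resonance.

(** * Rotations composed with shears *)

Section Rotation.
Variables (R : realType) (d : nat).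
Hypothesis hd : (3 <= d)%N.

Definition i0 : 'I_d := Ordinal (leq_trans (isT : 0 < 3)%N hd).
Definition i1 : 'I_d := Ordinal (leq_trans (isT : 1 < 3)%N hd).
Definition i2 : 'I_d := Ordinal (leq_trans (isT : 2 < 3)%N hd).
Definition plane_proj : 'M[R]_d := delta_mx i0 i0 + delta_mx i1 i1.
Definition plane_turn : 'M[R]_d := delta_mx i1 i0 - delta_mx i0 i1.
(** Rotation by [t] in the plane of the first two basis vectors, the identity on
the others. *)
Definition rot (t : R) : 'M[R]_d := 1%:M + ((cos t - 1) *: plane_proj + sin t *: plane_turn).
Definition shear (a b : R) : 'M[R]_d := a *: delta_mx i0 i2 + b *: delta_mx i1 i2.

Lemma delta_mul (i j k l : 'I_d) : delta_mx i j *m delta_mx k l = (j == k)%:R *: delta_mx i l :> 'M[R]_d.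
Proof.
have [->|jk] := eqVneq j k; first by rewrite mul_delta_mx scale1r.
by rewrite mul_delta_mx_0// scale0r.
Qed.

Ltac delta_tac := rewrite ?(mulmxDl, mulmxDr) ?(mulmxN, mulNmx) !delta_mul ?eqxx /= ?scale1r ?scale0r ?oppr0 ?addr0 ?add0r ?oppr0 ?addr0.
Lemma proj_proj : plane_proj *m plane_proj = plane_proj. Proof. by rewrite /plane_proj; delta_tac. Qed.
Lemma proj_turn : plane_proj *m plane_turn = plane_turn. Proof. by rewrite /plane_proj /plane_turn; delta_tac; rewrite addrC. Qed.
Lemma turn_proj : plane_turn *m plane_proj = plane_turn. Proof. by rewrite /plane_proj /plane_turn; delta_tac. Qed.
Lemma turn_turn : plane_turn *m plane_turn = - plane_proj. Proof. by rewrite /plane_proj /plane_turn; delta_tac; rewrite opprD addrC. Qed.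

Definition shear0 : 'M[R]_d := delta_mx i0 i2.
Definition shear1 : 'M[R]_d := delta_mx i1 i2.
Lemma proj_shear0 : plane_proj *m shear0 = shear0. Proof. by rewrite /plane_proj /shear0; delta_tac. Qed.
Lemma proj_shear1 : plane_proj *m shear1 = shear1. Proof. by rewrite /plane_proj /shear1; delta_tac. Qed.
Lemma turn_shear0 : plane_turn *m shear0 = shear1. Proof. by rewrite /plane_turn /shear0 /shear1; delta_tac. Qed.
Lemma turn_shear1 : plane_turn *m shear1 = - shear0. Proof. by rewrite /plane_turn /shear0 /shear1; delta_tac. Qed.
Lemma shear0_proj : shear0 *m plane_proj = 0. Proof. by rewrite /plane_proj /shear0; delta_tac. Qed.
Lemma shear1_proj : shear1 *m plane_proj = 0. Proof. by rewrite /plane_proj /shear1; delta_tac. Qed.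
Lemma shear0_turn : shear0 *m plane_turn = 0. Proof. by rewrite /plane_turn /shear0; delta_tac. Qed.
Lemma shear1_turn : shear1 *m plane_turn = 0. Proof. by rewrite /plane_turn /shear1; delta_tac. Qed.
Lemma shear0_shear0 : shear0 *m shear0 = 0. Proof. by rewrite /shear0; delta_tac. Qed.
Lemma shear0_shear1 : shear0 *m shear1 = 0. Proof. by rewrite /shear0 /shear1; delta_tac. Qed.
Lemma shear1_shear0 : shear1 *m shear0 = 0. Proof. by rewrite /shear0 /shear1; delta_tac. Qed.
Lemma shear1_shear1 : shear1 *m shear1 = 0. Proof. by rewrite /shear1; delta_tac. Qed.

Lemma rotD s t : rot s *m rot t = rot (s + t).
Proof.
rewrite /rot !mulmxDl !mulmxDr !mul1mx !mulmx1 -!scalemxAl -!scalemxAr.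
rewrite proj_proj proj_turn turn_proj turn_turn cosD sinD -!addrA; congr (_ + _).
by apply/matrixP => i j; rewrite !mxE; ring.
Qed.

Lemma rot0 : rot 0 = 1%:M.
Proof. by rewrite /rot cos0 sin0 subrr !scale0r !addr0. Qed.

Lemma rot_tr t : (rot t)^T = rot (- t).
Proof.
rewrite /rot cosN sinN; apply/matrixP => i j; rewrite !mxE [j == i]eq_sym.
by rewrite ![(j == _) && _]andbC; ring.
Qed.

Lemma rot_orthogonal t : orthogonal_mx (rot t).
Proof. by rewrite /orthogonal_mx rot_tr rotD addNr rot0. Qed.

Lemma shear_mul_rot a b t : shear a b *m rot t = shear a b.
Proof.
rewrite /shear -/shear0 -/shear1 /rot mulmxDr mulmx1 mulmxDl !mulmxDr -!scalemxAl -!scalemxAr.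
by rewrite shear0_proj shear0_turn shear1_proj shear1_turn !scaler0 !addr0.
Qed.

Lemma rot_mul_shear a b t : rot t *m shear a b =
  shear (cos t * a - sin t * b) (sin t * a + cos t * b).
Proof.
rewrite /shear -/shear0 -/shear1 /rot mulmxDl mul1mx mulmxDl !mulmxDr -!scalemxAl -!scalemxAr.
rewrite proj_shear0 proj_shear1 turn_shear0 turn_shear1.
by apply/matrixP => i j; rewrite !mxE; ring.
Qed.

Lemma shear_shear a b a' b' : shear a b *m shear a' b' = 0.
Proof.
rewrite /shear -/shear0 -/shear1 mulmxDl !mulmxDr -!scalemxAl -!scalemxAr.
by rewrite shear0_shear0 shear0_shear1 shear1_shear0 shear1_shear1 !scaler0 !addr0.
Qed.

Lemma shearD a b a' b' : shear a b + shear a' b' = shear (a + a') (b + b').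
Proof. by apply/matrixP => i j; rewrite !mxE; ring. Qed.

Lemma shearN a b : - shear a b = shear (- a) (- b).
Proof. by apply/matrixP => i j; rewrite !mxE; ring. Qed.

Lemma left_inverse (n : nat) (P Q : 'M[R]_n) : Q *m P = 1%:M -> P \in unitmx /\ invmx P = Q.
Proof.
move=> QP; have [_ Pu] := mulmx1_unit QP; split=> //.
by rewrite -[RHS](mulmxK Pu) QP mul1mx.
Qed.

Definition rot_shear (t w : R) : 'M[R]_d := rot t + shear w 0.

Lemma rot_shear_unit t w : rot_shear t w \in unitmx.
Proof.
have E : (1%:M - shear w 0) *m rot_shear t w = rot t.
  by rewrite mulmxBl mul1mx {2}/rot_shear mulmxDr shear_mul_rot shear_shear addr0 /rot_shear addrK.
have H : (rot (- t) *m (1%:M - shear w 0)) *m rot_shear t w = 1%:M.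
  by rewrite -mulmxA E rotD addNr rot0.
by have [] := left_inverse H.
Qed.

(** Conjugation by [1 + N], where [N = shear p q], adds to the
rotation [T] the shear [T N - N]; as [T - 1] is invertible on the plane, [N]
can be chosen to produce any shear.  The matrix of [T - 1] on the plane is
[cos t - 1] times the identity plus [sin t] times a quarter turn, and [p], [q]
are the coordinates of its inverse applied to [(a, b)]. *)
Lemma conj_orthogonal t a b : cos t != 1 -> conjugate_to_orthogonal (rot t + shear a b).
Proof.
move=> ct.
pose D := (cos t - 1) ^+ 2 + sin t ^+ 2.
have D0 : D != 0.
  by rewrite gt_eqF// ltr_pwDl ?sqr_ge0// lt_neqAle sqr_ge0 andbT eq_sym sqrf_eq0 subr_eq0.
pose p := ((cos t - 1) * a + sin t * b) / D.
pose q := ((cos t - 1) * b - sin t * a) / D.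
have H : (1%:M - shear p q) *m (1%:M + shear p q) = 1%:M.
  by rewrite mulmxDr mulmx1 mulmxBl mul1mx shear_shear subr0 subrK.
have [Pu PV] := left_inverse H.
exists (1%:M + shear p q), (rot t); split=> //; first exact: rot_orthogonal.
rewrite PV mulmxBl mul1mx shear_mul_rot mulmxDr mulmx1 mulmxBl rot_mul_shear shear_shear subr0.
rewrite shearN -[RHS]addrA shearD; congr (rot t + shear _ _).
  by rewrite /p /q /D; field.
by rewrite /p /q /D; field.
Qed.

(** By induction on [n].  The vector [(a, b)] is the exponential sum
conjugated and rotated by the angle [(n - 1) t], hence of the same length. *)
Lemma cocycle_formula (X : Type) (f : X -> X) (w : X -> R) t n x :
  exists a b, cocycle_iter f (fun y => rot_shear t (w y)) n x = rot (n%:R * t) + shear a b /\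
    a ^+ 2 + b ^+ 2 = trigE (fun k => w (iter k f x)) n t.
Proof.
pose C n := trigC (fun k => w (iter k f x)) n t.
pose Sn n := trigS (fun k => w (iter k f x)) n t.
pose u n := (n%:R - 1) * t.
pose a n := cos (u n) * C n + sin (u n) * Sn n.
pose b n := sin (u n) * C n - cos (u n) * Sn n.
exists (a n), (b n); split; last first.
  rewrite /trigE -/(C n) -/(Sn n) /a /b; have := cos2Dsin2 (u n).
  set cc := cos _; set ss := sin _ => h.
  have -> : (cc * C n + ss * Sn n) ^+ 2 + (ss * C n - cc * Sn n) ^+ 2 = (cc ^+ 2 + ss ^+ 2) * (C n ^+ 2 + Sn n ^+ 2) by ring.
  by rewrite h mul1r.
elim: n => [|n IH].
  rewrite /= mul0r rot0 /a /b /C /Sn /trigC /trigS !big_ord0 !mulr0 addr0 subr0.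
  by rewrite /shear !scale0r !addr0.
rewrite /= IH /rot_shear mulmxDl mulmxDr rotD rot_mul_shear mulmxDr shear_mul_rot shear_shear addr0.
rewrite -addrA shearD.
have -> : t + n%:R * t = n.+1%:R * t by rewrite -natr1; ring.
congr (_ + shear _ _).
  have CE : C n.+1 = C n + w (iter n f x) * cos (n%:R * t) by rewrite /C /trigC big_ord_recr.
  have SE : Sn n.+1 = Sn n + w (iter n f x) * sin (n%:R * t) by rewrite /Sn /trigS big_ord_recr.
  rewrite /a /b CE SE.
  have -> : u n.+1 = n%:R * t by rewrite /u -natr1 addrK.
  have E : n%:R * t = t + u n by rewrite /u; ring.
  have h := cos2Dsin2 (t + u n).
  rewrite E -[X in _ + X = _](mulr1 (w (iter n f x))) -h cosD sinD; ring.
rewrite addr0.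
have CE : C n.+1 = C n + w (iter n f x) * cos (n%:R * t) by rewrite /C /trigC big_ord_recr.
have SE : Sn n.+1 = Sn n + w (iter n f x) * sin (n%:R * t) by rewrite /Sn /trigS big_ord_recr.
rewrite /a /b CE SE.
have -> : u n.+1 = n%:R * t by rewrite /u -natr1 addrK.
have E : n%:R * t = t + u n by rewrite /u; ring.
rewrite E cosD sinD; ring.
Qed.

Definition ev (i : 'I_d) : 'cV[R]_d := delta_mx i 0.

Lemma delta_ev (i j k : 'I_d) : delta_mx i j *m ev k = (j == k)%:R *: ev i.
Proof.
rewrite /ev; have [->|jk] := eqVneq j k; first by rewrite mul_delta_mx scale1r.
by rewrite mul_delta_mx_0// scale0r.
Qed.

Ltac ev_tac := rewrite ?mulmxDl ?mulNmx -?scalemxAl !delta_ev ?eqxx /= ?scale1r ?scale0r ?oppr0 ?scaler0 ?addr0 ?add0r ?oppr0 ?addr0.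
Lemma map_e0 t a b : (rot t + shear a b) *m ev i0 = cos t *: ev i0 + sin t *: ev i1.
Proof.
have hP : plane_proj *m ev i0 = ev i0 by rewrite /plane_proj; ev_tac.
have hJ : plane_turn *m ev i0 = ev i1 by rewrite /plane_turn; ev_tac.
have hn : shear a b *m ev i0 = 0 by rewrite /shear; ev_tac.
rewrite mulmxDl hn addr0 /rot mulmxDl mul1mx mulmxDl -!scalemxAl hP hJ.
by rewrite addrA scalerBl scale1r (addrC (ev i0)) subrK.
Qed.

Lemma map_e2 t a b : (rot t + shear a b) *m ev i2 = ev i2 + (a *: ev i0 + b *: ev i1).
Proof.
have hP : plane_proj *m ev i2 = 0 by rewrite /plane_proj; ev_tac.
have hJ : plane_turn *m ev i2 = 0 by rewrite /plane_turn; ev_tac.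
have hn : shear a b *m ev i2 = a *: ev i0 + b *: ev i1 by rewrite /shear; ev_tac.
by rewrite mulmxDl hn /rot mulmxDl mul1mx mulmxDl -!scalemxAl hP hJ !scaler0 !addr0.
Qed.

(** A crude bound for the operator norm that is easy to compute. *)
Definition entry_sum (B : 'M[R]_d) : R := \sum_i \sum_j `|B i j|.

Lemma euclid_ip : is_inner_product (@euclid R d).
Proof.
split.
- by move=> u v; apply: eq_bigr => i _; rewrite mulrC.
- move=> a u u' v; rewrite /euclid mulr_sumr -big_split/=; apply: eq_bigr => i _.
  by rewrite !mxE; ring.
- move=> u u0; have : exists i, u i 0 != 0.
    apply: contrapT => no; move/eqP: u0; apply; apply/matrixP => i j; rewrite ord1 mxE.
    by apply/eqP; apply: contrapT => ui; apply: no; exists i; apply/negP.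
  move=> [i ui]; rewrite /euclid (bigD1 i)//= ltr_pwDl//.
    by rewrite -expr2 lt_neqAle sqr_ge0 andbT eq_sym sqrf_eq0.
  by apply: sumr_ge0 => j _; rewrite -expr2 sqr_ge0.
Qed.

Lemma euclid_coord (v : 'cV[R]_d) i : `|v i 0| <= ip_norm (@euclid R d) v.
Proof.
rewrite -sqrtr_sqr; apply: ler_wsqrtr; rewrite /euclid (bigD1 i)//= -expr2 lerDl.
by apply: sumr_ge0 => j _; rewrite -expr2 sqr_ge0.
Qed.

Lemma euclid_le_sum (v : 'cV[R]_d) : ip_norm (@euclid R d) v <= \sum_i `|v i 0|.
Proof.
have s0 : 0 <= \sum_i `|v i 0| by apply: sumr_ge0.
rewrite -(ger0_norm s0) -sqrtr_sqr; apply: ler_wsqrtr.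
rewrite expr2 mulr_suml /euclid; apply: ler_sum => i _.
rewrite (le_trans (ler_norm _))// normrM ler_wpM2l// (bigD1 i)//= lerDl.
exact: sumr_ge0.
Qed.

Lemma mx_norm2_le (B : 'M[R]_d) : mx_norm2 B <= entry_sum B.
Proof.
apply: ge_sup.
  exists (ip_norm (@euclid R d) (B *m 0)); exists 0 => //=.
  by rewrite /ip_norm (ip0l euclid_ip) sqrtr0.
move=> _ [v /= v1 <-]; apply: (le_trans (euclid_le_sum _)).
apply: ler_sum => i _; rewrite mxE (le_trans (ler_norm_sum _ _ _))//.
apply: ler_sum => j _; rewrite normrM ler_piMr//.
exact: le_trans (euclid_coord _ _) v1.
Qed.

Lemma entry_sumD A B : entry_sum (A + B) <= entry_sum A + entry_sum B.
Proof.
rewrite /entry_sum -big_split; apply: ler_sum => i _; rewrite -big_split; apply: ler_sum => j _.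
by rewrite mxE ler_normD.
Qed.

Lemma entry_sumZ a B : entry_sum (a *: B) = `|a| * entry_sum B.
Proof.
rewrite /entry_sum mulr_sumr; apply: eq_bigr => i _; rewrite mulr_sumr; apply: eq_bigr => j _.
by rewrite mxE normrM.
Qed.

Lemma entry_sum_delta i j : entry_sum (delta_mx i j) = 1.
Proof.
rewrite /entry_sum (bigD1 i)//= (bigD1 j)//= mxE !eqxx normr1 big1 ?addr0 => [|k kj].
  by rewrite big1 ?addr0// => k ki; rewrite big1// => l _; rewrite mxE (negbTE ki) normr0.
by rewrite mxE (negbTE kj) andbF normr0.
Qed.

Lemma rot_shear_close t w : 0 <= t -> t <= 1 -> mx_norm2 (rot_shear t w - 1%:M) <= 4 * t + `|w|.
Proof.
move=> t0 t1; apply: (le_trans (mx_norm2_le _)).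
have -> : rot_shear t w - 1%:M = (cos t - 1) *: plane_proj + sin t *: plane_turn + w *: delta_mx i0 i2.
  by rewrite /rot_shear /rot /shear scale0r addr0; apply/matrixP => i j; rewrite !mxE; ring.
apply: (le_trans (entry_sumD _ _)); apply: lerD; last by rewrite entry_sumZ entry_sum_delta mulr1.
apply: (le_trans (entry_sumD _ _)); rewrite !entry_sumZ.
have hP : entry_sum plane_proj <= 2 by rewrite (le_trans (entry_sumD _ _))// !entry_sum_delta.
have hJ : entry_sum plane_turn <= 2.
  by rewrite (le_trans (entry_sumD _ _))// -scaleN1r entry_sumZ normrN1 !entry_sum_delta mul1r.
have hs := sin_abs_le t0.
have hc : `|cos t - 1| <= t.
  have t2 : 0 <= t / 2 by rewrite divr_ge0.
  have h2 := sin_abs_le t2.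
  have -> : cos t - 1 = - (2 * `|sin (t / 2)| ^+ 2).
    rewrite real_normK ?num_real//; have h := cos2Dsin2 (t / 2).
    rewrite {1}[t](_ : t = t / 2 + t / 2) ?cosD; last by field.
    by rewrite -[X in _ - X = _]h; ring.
  have s0 := normr_ge0 (sin (t / 2)).
  by rewrite normrN ger0_norm ?mulr_ge0// ?sqr_ge0//; nra.
have p0 A : 0 <= entry_sum A by apply: sumr_ge0 => i _; apply: sumr_ge0.
have -> : 4 * t = t * 2 + t * 2 by ring.
by apply: lerD; apply: ler_pM.
Qed.

Lemma rot_shear_diff t w w' : mx_norm2 (rot_shear t w - rot_shear t w') <= `|w - w'|.
Proof.
apply: (le_trans (mx_norm2_le _)).
have -> : rot_shear t w - rot_shear t w' = (w - w') *: delta_mx i0 i2.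
  by rewrite /rot_shear /shear; apply/matrixP => i j; rewrite !mxE; ring.
by rewrite entry_sumZ entry_sum_delta mulr1.
Qed.
End Rotation.

(** * Consequences of conformality *)

Section Conformal.
Variables (R : realType) (V W : lmodType R).
Variables (b : V -> V -> R) (b' : W -> W -> R).
Hypotheses (ib : is_inner_product b) (ib' : is_inner_product b').

(** The supremum of an unbounded set is 0, so a nonzero operator norm is
a genuine bound. *)
Lemma op_norm_bound (L : V -> W) : (forall a v, L (a *: v) = a *: L v) ->
  op_norm b b' L != 0 -> forall v, ip_norm b' (L v) <= op_norm b b' L * ip_norm b v.
Proof.
move=> Llin; rewrite /op_norm; set A := [set _ | _ in _] => sA v.
have hA : has_sup A by apply: contrapT => /sup_out e; move: sA; rewrite e eqxx.
have [->|v0] := eqVneq v 0.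
  have L0 : L 0 = 0 by rewrite -[in LHS](scale0r (0 : V)) Llin scale0r.
  by rewrite L0 /ip_norm (ip0l ib') (ip0l ib) sqrtr0 mulr0.
have nv := ip_norm_gt0 ib v0.
have : ip_norm b' (L ((ip_norm b v)^-1 *: v)) <= sup A.
  apply: ub_le_sup; first exact: hA.2.
  exists ((ip_norm b v)^-1 *: v) => //=.
  by rewrite (ip_normZ ib) gtr0_norm ?invr_gt0// mulVf// gt_eqF.
by rewrite Llin (ip_normZ ib') gtr0_norm ?invr_gt0// mulrC ler_pdivrMr.
Qed.
End Conformal.

(** Bound the image of [u] by the norm of [B], and [v], seen as the
preimage of [B v], by the norm of the inverse. *)
Lemma conformal_ratio (R : realType) (d : nat) (b b' : 'cV[R]_d -> 'cV[R]_d -> R)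
    (B : 'M[R]_d) u v : is_inner_product b -> is_inner_product b' -> B \in unitmx ->
  op_norm b b' (mulmx B) * op_norm b' b (mulmx (invmx B)) = 1 ->
  ip_norm b' (B *m u) * ip_norm b v <= ip_norm b u * ip_norm b' (B *m v).
Proof.
move=> ib ib' Bu e.
have n1 : op_norm b b' (mulmx B) != 0.
  by apply/eqP => h; move: e; rewrite h mul0r => /eqP; rewrite eq_sym oner_eq0.
have n2 : op_norm b' b (mulmx (invmx B)) != 0.
  by apply/eqP => h; move: e; rewrite h mulr0 => /eqP; rewrite eq_sym oner_eq0.
have h1 := op_norm_bound ib ib' (fun a v => esym (scalemxAr a B v)) n1 u.
have h2 := op_norm_bound ib' ib (fun a v => esym (scalemxAr a (invmx B) v)) n2 (B *m v).
rewrite mulKmx// in h2.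
have := ler_pM (ip_norm_ge0 _ _) (ip_norm_ge0 _ _) h1 h2.
by rewrite mulrACA e mul1r.
Qed.

(** With [x], [y], [z] the entries of the Gram matrix, the difference of the
two sides is [(p x + q y)^2 + (p y + q z)^2]. *)
Lemma gram_lower (R : realType) (V : lmodType R) (b : V -> V -> R) (e0 e1 : V) (p q : R) :
  is_inner_product b ->
  (b e0 e0 * b e1 e1 - b e0 e1 ^+ 2) * (p ^+ 2 + q ^+ 2) <=
  b (p *: e0 + q *: e1) (p *: e0 + q *: e1) * (b e0 e0 + b e1 e1).
Proof.
move=> ib; rewrite !(ipDl ib) !(ipDr ib) !(ipZl ib) !(ipZr ib) (ip_sym ib e1 e0).
set x := b e0 e0; set y := b e0 e1; set z := b e1 e1.
have := sqr_ge0 (p * x + q * y); have := sqr_ge0 (p * y + q * z).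
lra.
Qed.

(** The determinant is [b e0 e0] times the square distance from [e1] to the
line of [e0]. *)
Lemma gram_pos (R : realType) (V : lmodType R) (b : V -> V -> R) (e0 e1 : V) :
  is_inner_product b -> e0 != 0 -> (forall t, e1 != t *: e0) ->
  0 < b e0 e0 * b e1 e1 - b e0 e1 ^+ 2.
Proof.
move=> ib e00 e1n; have x0 := ip_pos ib e00.
have := ip_pos ib (_ : e1 - (b e0 e1 / b e0 e0) *: e0 != 0).
rewrite subr_eq0 e1n => /(_ isT).
rewrite -scaleNr !(ipDl ib) !(ipDr ib) !(ipZl ib) !(ipZr ib) (ip_sym ib e1 e0).
set x := b e0 e0 in x0 *; set y := b e0 e1; set z := b e1 e1.
have -> : z + - (y / x) * y + (- (y / x) * y + - (y / x) * (- (y / x) * x)) = (x * z - y ^+ 2) / x.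
  by field; rewrite gt_eqF.
by rewrite pmulr_lgt0// invr_gt0.
Qed.

(** * The cocycle *)

Section Resonant.
Variables (R : realType) (M : topologicalType) (m : nat) (S : smooth_structure R M m).
Variable g : riemannian_metric S.
Hypotheses (hM : hausdorff_space M) (cM : compact [set: M]).

Definition dist_le (x y : M) (r : R) : Prop := (riemannian_dist g x y <= r%:E)%E.

Lemma riemannian_dist_ge0 x y : (0 <= riemannian_dist g x y)%E.
Proof.
apply/ereal_infP => _ [gam _ <-]; apply: integral_ge0 => t _.
by rewrite lee_fin ip_norm_ge0.
Qed.

Lemma dist_le_ge0 x y r : dist_le x y r -> 0 <= r.
Proof. by move=> h; rewrite -lee_fin (le_trans (riemannian_dist_ge0 x y)). Qed.

(** The gap [L] only depends on the half-width [l] of the interval of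
angles, so that [recurrent_bump] can be applied before [trig_lower]. *)
Lemma resonant_bump (f : diffeo S) : anosov g f -> (0 < m)%N -> [set: M] !=set0 ->
  forall d0 l : R, 0 < l -> exists2 phi, exists K : R, bounded_lip dist_le K phi &
  forall B : R, exists t n x, `|t - d0| < l /\
    B <= trigE (fun k => phi (iter k f x)) n t.
Proof.
move=> af m0 M0 d0 l l0.
pose L := (Num.trunc (128 / l ^+ 2)).+1.
have Ll : 128 / l ^+ 2 <= L%:R by apply/ltW; rewrite truncnS_gt.
have [phi [ps [B hB] sep unb]] := recurrent_bump hM cM L af m0 M0.
have [K K0 hK] := strict_fun_lipschitz g cM ps.
have B0 : 0 <= B by have [x _] := M0; have /andP[h1 h2] := hB x; exact: le_trans h1 h2.
exists phi.
  exists (B + K); split=> [x|x y r xy].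
    by have /andP[h1 h2] := hB x; rewrite ger0_norm//; apply: (le_trans h2); rewrite lerDl ltW.
  have r0 := dist_le_ge0 xy.
  apply: (@le_trans _ _ (K * r)); last by rewrite ler_wpM2r// lerDr.
  rewrite -lee_fin; apply: (le_trans (hK x y)).
  by rewrite EFinM lee_wpmul2l// lee_fin ltW.
move=> C; have [x [n hn]] := unb (2 * C).
pose c k := phi (iter k f x).
have c0 k : 0 <= c k by have /andP[] := hB (iter k f x).
have cs k j : (0 < j <= L)%N -> c k * c (k + j)%N = 0.
  by move=> jL; rewrite /c addnC iterD sep.
have [t td ht] := trig_lower n d0 l0 Ll isT c0 cs.
exists t, n, x; split=> //; apply: (le_trans _ ht).
by rewrite ler_pdivlMr// mulrC.
Qed.

End Resonant.

Section CompactBounds.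
Variables (R : realType) (M : topologicalType).
Hypotheses (cM : compact [set: M]) (M0 : [set: M] !=set0).

Lemma compact_upper_bound (h : M -> R) : continuous h -> exists K, forall x, h x <= K.
Proof.
move=> hc; have [c _ hcm] := compact_EVT_max M0 cM (continuous_subspaceT hc).
by exists (h c) => x; apply: hcm; rewrite in_setT.
Qed.

Lemma compact_positive_lower_bound (h : M -> R) : continuous h -> (forall x, 0 < h x) ->
  exists2 k, 0 < k & forall x, k <= h x.
Proof.
move=> hc h0; have [c _ hcm] := compact_EVT_min M0 cM (continuous_subspaceT hc).
by exists (h c) => // x; apply: hcm; rewrite in_setT.
Qed.
End CompactBounds.

Lemma shear_bound (R : realType) (k kap gam n0 N Q G G2 s2 : R) :
  0 < kap -> 0 < gam -> 0 <= k -> kap <= n0 ->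
  N * n0 <= k * (2 * k) -> Q <= N + k -> 0 <= Q -> 0 <= N ->
  0 <= s2 -> gam <= G -> G2 <= 2 * k ^+ 2 -> G * s2 <= Q ^+ 2 * G2 ->
  s2 <= (2 * k ^+ 2 / kap + k) ^+ 2 * (2 * k ^+ 2) / gam.
Proof.
move=> kp gp k0 kn Nn QN Q0 N0 s0 gG G2k GQ.
have Nk : N <= 2 * k ^+ 2 / kap.
  rewrite ler_pdivlMr//; apply: (le_trans (ler_wpM2l N0 kn)); apply: (le_trans Nn).
  by rewrite le_eqVlt; apply/orP; left; apply/eqP; ring.
have Qk : Q <= 2 * k ^+ 2 / kap + k by apply: (le_trans QN); rewrite lerD2r.
rewrite ler_pdivlMr// mulrC; apply: (le_trans (ler_wpM2r s0 gG)); apply: (le_trans GQ).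
have Q2 : Q ^+ 2 <= (2 * k ^+ 2 / kap + k) ^+ 2 by rewrite lerXn2r// nnegrE// (le_trans Q0).
apply: (@le_trans _ _ (Q ^+ 2 * (2 * k ^+ 2))); first by rewrite ler_wpM2l// sqr_ge0.
by rewrite ler_wpM2r// mulr_ge0// sqr_ge0.
Qed.

Section Shear.
Variables (R : realType) (d : nat).
Hypothesis hd : (3 <= d)%N.
Notation e0 := (ev R (i0 hd)). Notation e1 := (ev R (i1 hd)). Notation e2 := (ev R (i2 hd)).

Lemma ev_neq0 (i : 'I_d) : ev R i != 0.
Proof.
apply/eqP => /matrixP/(_ i 0); rewrite !mxE !eqxx => /eqP; by rewrite oner_eq0.
Qed.

Lemma ev01_free (t : R) : e1 != t *: e0.
Proof.
apply/eqP => /matrixP/(_ (i1 hd) 0); rewrite !mxE !eqxx /= mulr0 => /eqP; by rewrite oner_eq0.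
Qed.

Lemma abs_cos_sin_le1 (t : R) : `|cos t| <= 1 /\ `|sin t| <= 1.
Proof.
by rewrite !ler_norml cos_geN1 cos_le1 sin_geN1 sin_le1.
Qed.

(** Compare the images of [e2] and [e0], using that the second
one has bounded length; then read the coordinates [p], [q] of the image of [e2]
off the Gram matrix of [e0] and [e1]. *)
Lemma conformal_shear_bound (b b' : 'cV[R]_d -> 'cV[R]_d -> R) k kap gam t p q :
  is_inner_product b -> is_inner_product b' ->
  0 < kap -> 0 < gam -> 0 <= k ->
  (forall j, ip_norm b (ev R j) <= k /\ ip_norm b' (ev R j) <= k) ->
  kap <= ip_norm b e0 -> gam <= b' e0 e0 * b' e1 e1 - b' e0 e1 ^+ 2 ->
  rot hd t + shear hd p q \in unitmx ->
  op_norm b b' (mulmx (rot hd t + shear hd p q)) *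
    op_norm b' b (mulmx (invmx (rot hd t + shear hd p q))) = 1 ->
  p ^+ 2 + q ^+ 2 <= (2 * k ^+ 2 / kap + k) ^+ 2 * (2 * k ^+ 2) / gam.
Proof.
move=> ib ib' kp gp k0 hk kn gG Bu cf.
have := conformal_ratio e2 e0 ib ib' Bu cf; rewrite map_e0 map_e2.
set v := p *: e0 + q *: e1 => H.
have [hc hs] := abs_cos_sin_le1 t.
have n1 : ip_norm b' (cos t *: e0 + sin t *: e1) <= 2 * k.
  apply: (le_trans (ip_normD ib' _ _)); rewrite !(ip_normZ ib') mulr_natl mulr2n.
  apply: lerD; rewrite -[leRHS]mul1r; apply: ler_pM => //; try exact: ip_norm_ge0.
    exact: (hk _).2.
  exact: (hk _).2.
have nv : ip_norm b' v <= ip_norm b' (e2 + v) + k.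
  apply: (@le_trans _ _ (ip_norm b' (e2 + v) + ip_norm b' e2)).
    have := ip_normD ib' (e2 + v) (- e2).
    by rewrite addrAC subrr add0r -scaleN1r (ip_normZ ib') normrN1 mul1r.
  by rewrite lerD2l; exact: (hk _).2.
apply: (@shear_bound _ k kap gam (ip_norm b e0) (ip_norm b' (e2 + v)) (ip_norm b' v)
  (b' e0 e0 * b' e1 e1 - b' e0 e1 ^+ 2) (b' e0 e0 + b' e1 e1)) => //.
- apply: (le_trans H); apply: ler_pM => //; try exact: ip_norm_ge0.
  exact: (hk _).1.
- exact: ip_norm_ge0.
- exact: ip_norm_ge0.
- by rewrite addr_ge0// sqr_ge0.
- rewrite -!(ip_norm_sq ib') mulr_natl mulr2n; apply: lerD; rewrite lerXn2r// ?nnegrE ?ip_norm_ge0//.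
    exact: (hk _).2.
  exact: (hk _).2.
by rewrite (ip_norm_sq ib') gram_lower.
Qed.

Variable M : topologicalType.
Hypotheses (cM : compact [set: M]) (M0 : [set: M] !=set0).

Lemma cocycle_unit (X : Type) (f : X -> X) (A : X -> 'M[R]_d) n x :
  (forall y, A y \in unitmx) -> cocycle_iter f A n x \in unitmx.
Proof.
by move=> Au; elim: n => [|n IH] /=; rewrite ?unitmx1// unitmx_mul Au.
Qed.

(** By compactness the constants of [conformal_shear_bound] can be taken
independent of the point, so the twisted sums would be bounded. *)
Lemma not_conformal (f finv : M -> M) (w : M -> R) (t : R) (b : M -> 'cV[R]_d -> 'cV[R]_d -> R) :
  continuous_metric b ->
  (forall B, exists n x, B <= trigE (fun k => w (iter k f x)) n t) ->
  ~ conformal_cocycle f finv (fun x => rot_shear hd t (w x)) b.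
Proof.
move=> [ib bc] unb cf.
have [K hK] := compact_upper_bound cM M0 (h := fun x => \sum_j b x (ev R j) (ev R j))
  (fun x => continuous_at_sum (fun j => bc (ev R j) (ev R j) x)).
have [kap kp hkap] := compact_positive_lower_bound cM M0 (bc e0 e0) (fun x => ip_pos (ib x) (ev_neq0 _)).
have [gam gp hgam] := compact_positive_lower_bound cM M0
  (h := fun x => b x e0 e0 * b x e1 e1 - b x e0 e1 ^+ 2)
  (fun x => continuousB (continuousM (bc e0 e0 x) (bc e1 e1 x)) (continuousM (bc e0 e1 x) (bc e0 e1 x)))
  (fun x => gram_pos (ib x) (ev_neq0 _) ev01_free).
have hk x j : ip_norm (b x) (ev R j) <= Num.sqrt K.
  apply: ler_wsqrtr; apply: le_trans (hK x); rewrite (bigD1 j)//= lerDl.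
  by apply: sumr_ge0 => i _; exact: ip_ge0.
set C := (2 * Num.sqrt K ^+ 2 / Num.sqrt kap + Num.sqrt K) ^+ 2 * (2 * Num.sqrt K ^+ 2) / gam.
have [n [x hn]] := unb (C + 1).
have [p [q [E pq]]] := cocycle_formula hd f w t n x.
have := cf x (Posz n) => /=; rewrite E => cf'.
have Bu : rot hd (n%:R * t) + shear hd p q \in unitmx.
  by rewrite -E; apply: cocycle_unit => y; exact: rot_shear_unit.
suff : p ^+ 2 + q ^+ 2 <= C.
  by rewrite pq => h; have := le_trans hn h; rewrite gerDl ler10.
apply: (conformal_shear_bound (ib x) (ib (iter n f x)) _ gp _ _ _ (hgam _) Bu cf').
- by rewrite sqrtr_gt0.
- exact: sqrtr_ge0.
- by move=> j; split; exact: hk.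
- by apply: ler_wsqrtr; exact: hkap.
Qed.
End Shear.

Theorem proposition1p2 (R : realType) (M : topologicalType) (m d : nat)
    (S : smooth_structure R M m) (g : riemannian_metric S) (f : diffeo S)
    (eps : R)
    (hcompact : compact [set: M]) (hhausdorff : hausdorff_space M)
    (hnonempty : [set: M] !=set0) (hm : (0 < m)%N)
    (hf : anosov g f) (hd : (3 <= d)%N) (heps : 0 < eps) :
  exists A : M -> 'M[R]_d,
    [/\ linear_cocycle A,
        lipschitz_cocycle g A,
        (forall x, mx_norm2 (A x - 1%:M) < eps),
        (forall (p : M) (n : nat), (0 < n)%N -> iter n f p = p ->
           conjugate_to_orthogonal (cocycle_iter f A n p))
      & forall b : M -> 'cV[R]_d -> 'cV[R]_d -> R,
          continuous_metric b -> ~ conformal_cocycle f (diffeo_inv f) A b].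
Proof.
(* [rot_shear_close] bounds the distance to the identity by [4 t + |w|], less than
   [5 e] *)
pose e : R := Num.min 1 (eps / 6).
have e0 : 0 < e by rewrite lt_min ltr01 divr_gt0.
have [t [w [/andP[t0 te] [wb wl] ct unb]]] := resonance (@dist_le_ge0 _ _ _ _ g)
  (resonant_bump hhausdorff hcompact hf hm hnonempty) e0.
exists (fun x => rot_shear hd t (w x)); split.
- by move=> x; exact: rot_shear_unit.
- exists e => // x y.
  apply: (@le_trans _ _ (`|w x - w y|%:E)); first by rewrite lee_fin rot_shear_diff.
  have := riemannian_dist_ge0 g x y; case E : (riemannian_dist g x y) => [r| |]// _.
    by rewrite -EFinM lee_fin wl// /dist_le E.
  by rewrite gt0_muley// leey.
- move=> x; have t1 : t <= 1 by rewrite ltW// (lt_le_trans te)// ge_min lexx.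
  apply: (le_lt_trans (rot_shear_close hd (w x) (ltW t0) t1)).
  have := wb x; have : e <= eps / 6 by rewrite ge_min lexx orbT.
  by move: te; clear -heps; lra.
- move=> p [//|n] _ _; have [a [b [-> _]]] := cocycle_formula hd f w t n.+1 p.
  exact: conj_orthogonal (ct n).
by move=> b bc; exact: not_conformal.
Qed.
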